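(* Let $d\ge 1$, $T>0$, $\lambda\in(0,2)$, let $f:\mathbb{R}\to\mathbb{R}^d$ and $A:\mathbb{R}\to\mathbb{R}$ be Lipschitz continuous, with $A$ non-decreasing and $A(0)=0$. Then there is at most one entropy solution of the initial value problem $$\partial_t u+\nabla\cdot f(u)=-(-\Delta)^{\lambda/2}A(u)\ \text{ in } Q_T=\mathbb{R}^d\times(0,T),\qquad u(\cdot,0)=u_0 \text{ in }\mathbb{R}^d$$ (uniqueness being understood up to equality a.e. on $Q_T$).
   Context: Fix a constant $c_\lambda>0$. The operator $-(-\Delta)^{\lambda/2}$, also written $g$, is $g[\phi](x)=c_\lambda\,\mathrm{P.V.}\int_{|z|>0}\frac{\phi(x+z)-\phi(x)}{|z|^{d+\lambda}}\,dz$ (acting in the space variable), where $\mathrm{P.V.}\int_{|z|>0}=\lim_{b\to0^+}\int_{|z|>b}$. For $r>0$ write $g=g_r+g^r$ with $$g_r[\varphi](x)=c_\lambda\,\mathrm{P.V.}\int_{|z|<r}\frac{\varphi(x+z)-\varphi(x)}{|z|^{d+\lambda}}\,dz,\qquad g^r[\varphi](x)=c_\lambda\int_{|z|>r}\frac{\varphi(x+z)-\varphi(x)}{|z|^{d+\lambda}}\,dz.$$ For $k\in\mathbb{R}$: $\eta_k(u)=|u-k|$, $\eta_k'(u)=\mathrm{sgn}(u-k)$ with $\mathrm{sgn}(0)=0$, $q_k(u)=\eta_k'(u)(f(u)-f(k))$. Entropy solution: a function $u$ is an entropy solution with initial datum $u_0$ if (i) $u\in L^\infty(Q_T)\cap C([0,T];L^1(\mathbb{R}^d))$;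 (ii) for all $k\in\mathbb{R}$, all $r>0$ and all nonnegative $\varphi\in C_c^\infty(Q_T)$, $$\iint_{Q_T}\eta_k(u)\,\partial_t\varphi+q_k(u)\cdot\nabla\varphi+\eta_{A(k)}(A(u))\,g_r[\varphi]+\eta_k'(u)\,g^r[A(u)]\,\varphi\;dx\,dt\ge0;$$ (iii) $u(\cdot,0)=u_0$ a.e. *)

(* Defs.v *)
From HB Require Import structures.
From mathcomp Require Import all_boot all_order all_algebra.
From mathcomp Require Import all_classical all_reals all_analysis.

Set Implicit Arguments.
Unset Strict Implicit.
Unset Printing Implicit Defensive.

Import Order.TTheory GRing.Theory Num.Theory.
Import numFieldNormedType.Exports.

Local Open Scope classical_set_scope.
Local Open Scope ring_scope.

(* The sigma-algebra of R^n is generated by the coordinates (hence it is the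
   Borel one), as the library does for tuples. *)
Section measurable_rV.
Context {R : realType}.
Variable n : nat.

Let coors : 'I_n -> 'rV[R]_n -> R := fun i x => x ord0 i.

Let rV_set0 : g_sigma_preimage coors set0.
Proof. exact: sigma_algebra0. Qed.

Let rV_setC A : g_sigma_preimage coors A -> g_sigma_preimage coors (~` A).
Proof. exact: sigma_algebraC. Qed.

Let rV_bigcup (F : (set 'rV[R]_n)^nat) :
  (forall i, g_sigma_preimage coors (F i)) ->
  g_sigma_preimage coors (\bigcup_i (F i)).
Proof. exact: sigma_algebra_bigcup. Qed.

HB.instance Definition _ :=
  @isMeasurable.Build (measure_tuple_display default_measure_display)
    'rV[R]_n (g_sigma_preimage coors) rV_set0 rV_setC rV_bigcup.

End measurable_rV.

Section measurable_rV_theory.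
Context {R : realType}.

Lemma measurable_coord n (i : 'I_n) :
  measurable_fun [set: 'rV[R]_n] (fun x : 'rV[R]_n => x ord0 i).
Proof.
move=> _ Y mY; rewrite setTI; apply: sub_sigma_algebra => /=.
rewrite -bigcup_seq/=; exists i => /=; first by rewrite mem_index_enum.
by exists Y => //; rewrite setTI.
Qed.

Lemma measurable_fun_rVP d (T : measurableType d) n (f : T -> 'rV[R]_n) :
  measurable_fun [set: T] f <->
  forall i, measurable_fun [set: T] (fun x => f x ord0 i).
Proof.
split=> [mf i|mf].
  exact: (measurableT_comp (measurable_coord i) mf).
apply: measurability; first by [].
move=> _ [B + <-]; rewrite -bigcup_seq/= => -[i _ [C mC <-]].
by rewrite !setTI; have := mf i measurableT C mC; rewrite setTI.
Qed.

Definition rV_cons n (p : R * 'rV[R]_n) : 'rV[R]_n.+1 :=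
  row_mx (const_mx p.1 : 'rV[R]_1) p.2.

Lemma rV_cons0 n (p : R * 'rV[R]_n) : rV_cons p ord0 ord0 = p.1.
Proof.
have -> : @ord0 n = lshift n (@ord0 0) by exact: val_inj.
by rewrite [LHS]row_mxEl mxE.
Qed.

Lemma rV_consS n (p : R * 'rV[R]_n) j :
  rV_cons p ord0 (lift ord0 j) = p.2 ord0 j.
Proof.
have -> : lift ord0 j = rshift 1 j by exact: val_inj.
exact: row_mxEr.
Qed.

Lemma measurable_rV_cons n :
  measurable_fun [set: R * 'rV[R]_n] (@rV_cons n).
Proof.
apply/measurable_fun_rVP => i; have [j ->|->] := unliftP ord0 i.
  under eq_fun do rewrite rV_consS.
  exact: (measurableT_comp (measurable_coord j) measurable_snd).
under eq_fun do rewrite rV_cons0.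
exact: measurable_fst.
Qed.

Definition rV_uncons n (x : 'rV[R]_n.+1) : R * 'rV[R]_n :=
  (x ord0 ord0, \row_j x ord0 (lift ord0 j)).

Lemma rV_consK n : cancel (@rV_cons n) (@rV_uncons n).
Proof.
move=> [a v]; rewrite /rV_uncons rV_cons0; congr pair.
by apply/rowP => j; rewrite mxE rV_consS.
Qed.

Lemma measurable_rV_uncons n :
  measurable_fun [set: 'rV[R]_n.+1] (@rV_uncons n).
Proof.
apply/measurable_fun_pairP; split; first exact: measurable_coord.
apply/measurable_fun_rVP => i.
rewrite (_ : (fun _ => _) = fun x : 'rV[R]_n.+1 => x ord0 (lift ord0 i)).
  exact: measurable_coord.
by apply/funext => x; rewrite /= mxE.
Qed.

End measurable_rV_theory.

(* The library has this instance, but canonical structure inference does not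
   find it: it is shadowed by the one for finite measures. *)
Lemma sigma_finite_prod d1 d2 (T1 : measurableType d1)
    (T2 : measurableType d2) (R : realType)
    (m1 : {sigma_finite_measure set T1 -> \bar R})
    (m2 : {sigma_finite_measure set T2 -> \bar R}) :
  sigma_finite [set: T1 * T2] (m1 \x m2)%E.
Proof.
have /sigma_finiteP[F [TF ndF Foo]] := sigma_finiteT m1.
have /sigma_finiteP[G [TG ndG Goo]] := sigma_finiteT m2.
exists (fun n => F n `*` G n).
  rewrite -setXTT TF TG predeqE => -[x y]; split.
    move=> [/= [n _ Fnx] [k _ Gky]]; exists (maxn n k) => //; split.
    - by move: x Fnx; exact/subsetPset/ndF/leq_maxl.
    - by move: y Gky; exact/subsetPset/ndG/leq_maxr.
  by move=> [n _ []/= ? ?]; split; exists n.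
move=> k; have [? ?] := Foo k; have [? ?] := Goo k.
split; first exact: measurableX.
by rewrite product_measure1E// lte_mul_pinfty// ge0_fin_numE.
Qed.

Section lebesgue_rV.
Context {R : realType}.
Local Open Scope ereal_scope.

Section step.
Context {n : nat}.
Variable mu : {sigma_finite_measure set 'rV[R]_n -> \bar R}.

Definition lebesgue_rV_step : set 'rV[R]_n.+1 -> \bar R :=
  pushforward (lebesgue_measure \x mu) (@rV_cons R n).

Let mpre (X : set 'rV[R]_n.+1) :
  measurable X -> measurable (@rV_cons R n @^-1` X).
Proof. by move=> mX; rewrite -[X in measurable X]setTI; exact: measurable_rV_cons. Qed.

Let step0 : lebesgue_rV_step set0 = 0.
Proof. by rewrite /lebesgue_rV_step /pushforward preimage_set0 measure0. Qed.

Let step_ge0 X : 0 <= lebesgue_rV_step X.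
Proof. by rewrite /lebesgue_rV_step /pushforward measure_ge0. Qed.

Let step_sigma_additive : semi_sigma_additive lebesgue_rV_step.
Proof.
move=> F mF tF mUF; rewrite /lebesgue_rV_step /pushforward preimage_bigcup.
apply: measure_semi_sigma_additive.
- by move=> k; exact: mpre.
- apply/trivIsetP => /= i j _ _ ij; rewrite -preimage_setI.
  by move/trivIsetP : tF => /(_ _ _ _ _ ij) ->//; rewrite preimage_set0.
- by rewrite -preimage_bigcup; exact: mpre.
Qed.

HB.instance Definition _ := isMeasure.Build _ _ _
  lebesgue_rV_step step0 step_ge0 step_sigma_additive.

Let step_sigma_finite : sigma_finite [set: 'rV[R]_n.+1] lebesgue_rV_step.
Proof.
have [F TF Foo] := sigma_finite_prod lebesgue_measure mu.
exists (fun k => @rV_uncons R n @^-1` F k).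
  by rewrite -preimage_bigcup -TF preimage_setT.
move=> k; have [mF Fk] := Foo k; split.
  by rewrite -[X in measurable X]setTI; exact: measurable_rV_uncons.
rewrite /lebesgue_rV_step /pushforward -comp_preimage.
by rewrite (_ : _ \o _ = id) ?preimage_id//; apply/funext => x; exact: rV_consK.
Qed.

HB.instance Definition _ := Measure_isSigmaFinite.Build _ _ _
  lebesgue_rV_step step_sigma_finite.

End step.

(* [lebesgue_rV n] is the n-fold product of the one-dimensional Lebesgue
   measure, R^(n+1) being identified with R * R^n; R^0 carries the unit mass.
   See [lebesgue_rV_box]. *)
Fixpoint lebesgue_rV n : {sigma_finite_measure set 'rV[R]_n -> \bar R} :=
  if n is n'.+1 then lebesgue_rV_step (lebesgue_rV n') else \d_(0%R : 'rV[R]_0).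

Lemma lebesgue_rV_box n (I : 'I_n -> set R) : (forall i, measurable (I i)) ->
  lebesgue_rV n [set x : 'rV[R]_n | forall i, I i (x ord0 i)] =
  \prod_(i < n) lebesgue_measure (I i).
Proof.
elim: n I => [|n IHn] I mI.
  rewrite big_ord0 /= diracE mem_set//.
  by case.
rewrite big_ord_recl /= /lebesgue_rV_step /pushforward.
have mJ : measurable [set x : 'rV[R]_n | forall i, I (lift ord0 i) (x ord0 i)].
  rewrite (_ : [set _ | _] = \bigcap_(i in [set: 'I_n])
      ((fun x : 'rV[R]_n => x ord0 i) @^-1` I (lift ord0 i))).
    apply: fin_bigcap_measurable => // i _.
    by rewrite -[X in measurable X]setTI; exact: measurable_coord.
  by apply/seteqP; split=> x /= Ix i; [move=> _|]; exact: Ix.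
have -> := esym (IHn _ (fun i => mI (lift ord0 i))).
have -> := esym (product_measure1E lebesgue_measure (lebesgue_rV n) (mI ord0) mJ).
congr (_ _); apply/seteqP; split=> -[a v] /=.
  move=> Iav; split=> [|i]; first by have := Iav ord0; rewrite rV_cons0.
  by have := Iav (lift ord0 i); rewrite rV_consS.
move=> [Ia Iv] i; have [j ->|->] := unliftP ord0 i.
  by rewrite rV_consS; exact: Iv.
by rewrite rV_cons0.
Qed.

Definition spacetime_measure d :
    set ('rV[R]_d * measurableTypeR R)%type -> \bar R :=
  lebesgue_rV d \x lebesgue_measure.
Arguments spacetime_measure : clear implicits.

HB.instance Definition _ d := Measure.on (spacetime_measure d).

HB.instance Definition _ d := Measure_isSigmaFinite.Build _ _ _
  (spacetime_measure d) (sigma_finite_prod (lebesgue_rV d) lebesgue_measure).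

End lebesgue_rV.
Arguments spacetime_measure : clear implicits.

Section test_functions.
Context {R : realType}.

Fixpoint Ck {V : normedModType R} (k : nat) (phi : V -> R) : Prop :=
  if k is k'.+1 then
    (forall x, differentiable phi x) /\ (forall v, Ck k' ('D_v phi))
  else continuous phi.

Definition smooth {V : normedModType R} (phi : V -> R) : Prop :=
  forall k, Ck k phi.

(* Q_T = R^d x (0, T); a point of space-time is a pair (x, t). *)
Definition QT {d} (T : R) : set ('rV[R]_d * R) :=
  [set: 'rV[R]_d] `*` `]0, T[%classic.

(* C_c^oo(U), for U open, as functions on V vanishing outside of U. *)
Definition Cc_infty {V : normedModType R} (U : set V) (phi : V -> R) : Prop :=
  [/\ smooth phi,
      compact (closure [set z | phi z != 0]) &
      closure [set z | phi z != 0] `<=` U].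

Definition dt d (phi : 'rV[R]_d * R -> R) (z : 'rV[R]_d * R) : R :=
  'D_((0, 1) : 'rV[R]_d * R) phi z.

Definition gradx d (phi : 'rV[R]_d * R -> R) (z : 'rV[R]_d * R) : 'rV[R]_d :=
  \row_i 'D_((delta_mx ord0 i, 0) : 'rV[R]_d * R) phi z.

End test_functions.

Section nonlocal.
Context {R : realType}.

(* The norm provided by the library on ['rV[R]_d] is the sup norm. *)
Definition enorm d (z : 'rV[R]_d) : R :=
  Num.sqrt (\sum_(i < d) z ord0 i ^+ 2).

Definition dotrV d (v w : 'rV[R]_d) : R := \sum_(i < d) v ord0 i * w ord0 i.

Definition levy_integrand d (lambda : R) (psi : 'rV[R]_d -> R)
    (x z : 'rV[R]_d) : R :=
  (psi (x + z) - psi x) / enorm z `^ (d%:R + lambda).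

(* [g_small] is g_r, where [lim] is the principal value, and [g_large] is g^r;
   [c] is the constant c_lambda. *)
Definition g_small d (c lambda r : R) (psi : 'rV[R]_d -> R) (x : 'rV[R]_d) : R :=
  c * lim ((\int[lebesgue_rV d]_(z in [set z | b < enorm z < r])
              levy_integrand lambda psi x z) @[b --> 0^'+]).

Definition g_large d (c lambda r : R) (psi : 'rV[R]_d -> R) (x : 'rV[R]_d) : R :=
  c * \int[lebesgue_rV d]_(z in [set z | r < enorm z])
        levy_integrand lambda psi x z.

End nonlocal.

Section entropy.
Context {R : realType}.

Definition eta (k w : R) : R := `|w - k|.

(* [Num.sg 0 = 0] *)
Definition eta' (k w : R) : R := Num.sg (w - k).

Definition entropy_flux d (f : R -> 'rV[R]_d) (k w : R) : 'rV[R]_d :=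
  eta' k w *: (f w - f k).

Definition slice d (u : 'rV[R]_d * R -> R) (t : R) : 'rV[R]_d -> R :=
  fun x => u (x, t).

Definition entropy_integrand d (c lambda : R) (f : R -> 'rV[R]_d) (A : R -> R)
    (u : 'rV[R]_d * R -> R) (k r : R) (phi : 'rV[R]_d * R -> R)
    (z : 'rV[R]_d * R) : R :=
  eta k (u z) * dt phi z
  + dotrV (entropy_flux f k (u z)) (gradx phi z)
  + eta (A k) (A (u z)) * g_small c lambda r (slice phi z.2) z.1
  + eta' k (u z) * g_large c lambda r (slice (A \o u) z.2) z.1 * phi z.

(* [u] is a function on R^d x [0, T]: a representative of its L^oo class whose
   time slices are representatives of the values of the curve in
   C([0, T]; L^1); values at other times are irrelevant. *)
Record entropy_solution d (T c lambda : R) (f : R -> 'rV[R]_d) (A : R -> R)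
    (u0 : 'rV[R]_d -> R) (u : 'rV[R]_d * R -> R) : Prop := {
  entropy_Linfty : u \_ (QT T) \in Lfun (spacetime_measure R d) +oo%E ;
  entropy_L1 : forall t, t \in `[0, T] -> slice u t \in Lfun (lebesgue_rV d) 1%E ;
  entropy_continuous : forall t, t \in `[0, T] ->
    ('N[lebesgue_rV d]_1[EFin \o (slice u s \- slice u t)%R])%E
      @[s --> within `[0, T]%classic (nbhs t)] --> 0%E ;
  entropy_inequality : forall (k r : R) (phi : 'rV[R]_d * R -> R), 0 < r ->
    Cc_infty (QT T) phi -> (forall z, 0 <= phi z) ->
    (0 <= \int[spacetime_measure R d]_(z in QT T)
            (entropy_integrand c lambda f A u k r phi z)%:E)%E ;
  entropy_initial : {ae lebesgue_rV d, forall x, u (x, 0) = u0 x}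
}.

End entropy.

(* Main.v *)
Require Import Defs.
From HB Require Import structures.
From mathcomp Require Import all_boot all_order all_algebra.
From mathcomp Require Import all_classical all_reals all_analysis.
From mathcomp Require Import measurable_realfun.
From mathcomp Require Import ring lra.
Set Implicit Arguments.
Unset Strict Implicit.
Unset Printing Implicit Defensive.
Import Order.TTheory GRing.Theory Num.Theory.
Import numFieldNormedType.Exports.
Local Open Scope classical_set_scope.
Local Open Scope ring_scope.

(** Kruzkov's doubling of variables. Test the entropy inequality of [u] with
    [k = v q] and [phi p = w (p.1 - q.1) * b (p.2) * b (q.2)], where [w] is an
    even mollifier in space and [b] a bump centred at a time [tau], integrate in
    [q], and add the inequality with [u] and [v] exchanged. As [w (x - y)] is
    killed by [grad_x + grad_y], the flux terms cancel. The large-jump terms add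
    up to at most the integral of [|D (x + z, y + z)| - |D (x, y)|], with
    [D = A (u p) - A (v q)], against a weight invariant under the diagonal
    translation, which is zero. The small-jump terms tend to [0] with [r], since
    [g_r w] is at most a multiple of the integral of [|z|^(2 - d - lambda)] over
    [|z| < r].
    What remains says that the doubled [L^1] distance is nonincreasing in [tau].
    Continuity in time and of translations in [L^1] remove the mollifiers, so
    [|u(t) - v(t)|_1] is nonincreasing, and it tends to [0] as [t -> 0+]. *)

(** The two times are not tied by a mollifier of their difference: both are localised near the same
    [tau]. The sum of the two time derivatives of the test function is then minus its derivative in
    [tau], so the doubled inequality is a sign for a derivative under the integral, and continuity
    in time with values in L^1 takes the place of Lebesgue points when the bump shrinks. In place of
    a cut-off in space, the proof uses that the pairs of points at distance at most [e], with both
    times in (0, T), have sections of bounded measure: an integrable function of [p] alone, or of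
    [q] alone, stays integrable there. The order of the limits deals with the singular kernel: [r]
    tends to 0 while [e] is fixed, so only second differences of the fixed smooth [w] meet the
    singularity, never those of the solutions. Monotonicity of [A] enters as sgn(u - v) (A u - A v)
    = |A u - A v|, which turns the large jumps into jumps of a modulus. The mollifiers are not
    normalised: their masses are the same at all times and cancel at the end. *)

(** * Iterated integrals of nonnegative functions *)

Section tonelli.
Context {R : realType} d1 d2 (X : measurableType d1) (Y : measurableType d2).
Context (m1 : {sigma_finite_measure set X -> \bar R}).
Context (m2 : {sigma_finite_measure set Y -> \bar R}).
Local Open Scope ereal_scope.

Lemma tonelli12 (f : X * Y -> \bar R) : measurable_fun setT f ->
  (forall z, 0 <= f z) ->
  \int[m1 \x m2]_z f z = \int[m1]_x \int[m2]_y f (x, y).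
Proof. by move=> mf f0; rewrite fubini_tonelli1. Qed.

Lemma tonelli21 (f : X * Y -> \bar R) : measurable_fun setT f ->
  (forall z, 0 <= f z) ->
  \int[m1 \x m2]_z f z = \int[m2]_y \int[m1]_x f (x, y).
Proof. by move=> mf f0; rewrite fubini_tonelli2. Qed.

Lemma measurable_int1 (f : X * Y -> \bar R) : measurable_fun setT f ->
  (forall z, 0 <= f z) -> measurable_fun setT (fun x => \int[m2]_y f (x, y)).
Proof. by move=> mf f0; exact: (@measurable_fun_fubini_tonelli_F _ _ _ _ _ m2 f). Qed.

Lemma measurable_int2 (f : X * Y -> \bar R) : measurable_fun setT f ->
  (forall z, 0 <= f z) -> measurable_fun setT (fun y => \int[m1]_x f (x, y)).
Proof. by move=> mf f0; exact: (@measurable_fun_fubini_tonelli_G _ _ _ _ _ m1 f). Qed.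

Lemma measurable_map_pair d3 d4 (X' : measurableType d3) (Y' : measurableType d4)
    (s : X -> X') (t : Y -> Y') :
  measurable_fun setT s -> measurable_fun setT t ->
  measurable_fun setT (fun z : X * Y => (s z.1, t z.2)).
Proof.
move=> ms mt; apply/measurable_fun_pairP; split => /=.
  exact: measurableT_comp ms measurable_fst.
exact: measurableT_comp mt measurable_snd.
Qed.

End tonelli.

(** * Measure-preserving maps *)

Section preserving.
Context {R : realType}.
Local Open Scope ereal_scope.

(** Stated on integrals of nonnegative functions and not on measures of sets: it then passes to
    products by Tonelli and serves directly as a change of variables. *)
Definition preserving d (X : measurableType d) (m : set X -> \bar R)
    (s : X -> X) :=
  measurable_fun setT s /\
  forall f : X -> \bar R, measurable_fun setT f -> (forall x, 0 <= f x) ->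
    \int[m]_x f (s x) = \int[m]_x f x.

Lemma preserving_integrable d (X : measurableType d)
    (m : {measure set X -> \bar R}) (s : X -> X) (f : X -> R) :
  preserving m s -> m.-integrable setT (EFin \o f) ->
  m.-integrable setT (EFin \o (fun x => f (s x))).
Proof.
move=> [ms ps] /integrableP[mf foo]; apply/integrableP; split.
  exact: measurableT_comp mf ms.
rewrite (ps (fun x => `|(EFin \o f) x|))//.
exact: measurableT_comp.
Qed.

Context d1 d2 (X : measurableType d1) (Y : measurableType d2).
Context (m1 : {sigma_finite_measure set X -> \bar R}).
Context (m2 : {sigma_finite_measure set Y -> \bar R}).

(** One variable is changed at a time: the inner integral in [y] absorbs [t], and after exchanging
    the order the inner integral in [x] absorbs [s]. *)
Lemma preserving_prod (s : X -> X) (t : Y -> Y) :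
  preserving m1 s -> preserving m2 t ->
  preserving (m1 \x m2) (fun z => (s z.1, t z.2)).
Proof.
move=> [ms ps] [mt pt]; split; first exact: measurable_map_pair.
move=> f mf f0.
have mfst : measurable_fun setT (fun z : X * Y => f (s z.1, t z.2)).
  exact: measurableT_comp mf (measurable_map_pair ms mt).
have mfs : measurable_fun setT (fun z : X * Y => f (s z.1, z.2)).
  exact: measurableT_comp mf (measurable_map_pair ms (@measurable_id _ _ _)).
rewrite (@tonelli12 _ _ _ _ _ m1 m2 (fun z => f (s z.1, t z.2)))//=.
under eq_integral.
  move=> x _.
  rewrite (pt (fun y => f (s x, y)))//; last exact: measurable_fun_pair2.
  over.
rewrite -(@tonelli12 _ _ _ _ _ m1 m2 (fun z => f (s z.1, z.2)))//.
rewrite (@tonelli21 _ _ _ _ _ m1 m2 (fun z => f (s z.1, z.2)))//=.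
under eq_integral.
  move=> y _.
  rewrite (ps (fun x => f (x, y)))//; last exact: measurable_fun_pair1.
  over.
by rewrite -(@tonelli21 _ _ _ _ _ m1 m2 f).
Qed.

(** Strong convergence to the identity of composition operators on L^1. The maps are abstract so
    that continuity of translations passes from the line to R^n through products. *)
Definition L1_cvg_id d (X : measurableType d) (m : set X -> \bar R)
    (s : nat -> X -> X) :=
  (forall k, preserving m (s k)) /\
  forall f : X -> R, m.-integrable setT (EFin \o f) ->
    (\int[m]_x `|(f (s k x) - f x)%:E|) @[k --> \oo] --> 0.

End preserving.

(** * Composition operators converging to the identity in L^1 *)

Section L1_cvg_id.
Context {R : realType}.
Local Open Scope ereal_scope.

Lemma measurable_sub_comp d (X : measurableType d) (s t : X -> X) (f : X -> R) :
  measurable_fun setT s -> measurable_fun setT t -> measurable_fun setT f ->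
  measurable_fun setT (fun x => `|(f (s x) - f (t x))%:E|).
Proof.
move=> ms mt mf; apply: measurableT_comp => //; apply/measurable_EFinP.
by apply: measurable_funB; exact: measurableT_comp mf _.
Qed.

Lemma L1_dist_le d (X : measurableType d) (m : {measure set X -> \bar R})
    (f g : X -> R) : measurable_fun setT f -> measurable_fun setT g ->
  \int[m]_x `|(f x - g x)%:E| <= \int[m]_x `|(f x)%:E| + \int[m]_x `|(g x)%:E|.
Proof.
move=> mf mg.
rewrite -ge0_integralD//; [|by do 2 apply: measurableT_comp => //..].
apply: ge0_le_integral => //.
- by do 2 apply: measurableT_comp => //; exact: measurable_funB.
- by apply: emeasurable_funD; do 2 apply: measurableT_comp => //.
- by move=> x _; rewrite /= -EFinD lee_fin ler_normB.
Qed.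

Lemma L1_dist_tri d (X : measurableType d) (m : {measure set X -> \bar R})
    (f g h : X -> R) :
  measurable_fun setT f -> measurable_fun setT g -> measurable_fun setT h ->
  \int[m]_x `|(f x - h x)%:E| <=
  \int[m]_x `|(f x - g x)%:E| + \int[m]_x `|(g x - h x)%:E|.
Proof.
move=> mf mg mh.
rewrite -ge0_integralD//;
  [|by do 2 apply: measurableT_comp => //; exact: measurable_funB..].
apply: ge0_le_integral => //.
- by do 2 apply: measurableT_comp => //; exact: measurable_funB.
- by apply: emeasurable_funD; do 2 apply: measurableT_comp => //;
    exact: measurable_funB.
- by move=> x _; rewrite /= -EFinD lee_fin ler_distD.
Qed.

Context d1 d2 (X : measurableType d1) (Y : measurableType d2).
Context (m1 : {sigma_finite_measure set X -> \bar R}).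
Context (m2 : {sigma_finite_measure set Y -> \bar R}).

(** Dominated convergence in the outer variable: for almost every [x] the section is integrable, so
    the inner integral tends to 0, and it is at most twice the norm of the section because [t k]
    preserves the measure. *)
Lemma L1_cvg_id2 (t : nat -> Y -> Y) : L1_cvg_id m2 t ->
  forall f : X * Y -> R, (m1 \x m2).-integrable setT (EFin \o f) ->
  \int[m1]_x \int[m2]_y `|(f (x, t k y) - f (x, y))%:E| @[k --> \oo] --> 0.
Proof.
move=> [pt ct] f fi; have [mf _] := integrableP _ _ _ fi.
have mf' : measurable_fun setT f by exact/measurable_EFinP.
have mfk k : measurable_fun setT
    (fun z : X * Y => `|(f (z.1, t k z.2) - f z)%:E|).
  apply: (@measurable_sub_comp _ _ (fun z : X * Y => (z.1, t k z.2)) id) => //.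
  by apply: (measurable_map_pair (@measurable_id _ _ _)); exact: (pt k).1.
have fx x : measurable_fun setT (fun y => f (x, y)) by exact: measurable_fun_pair2.
have [] := @dominated_convergence _ _ _ m1 setT measurableT
   (fun k x => \int[m2]_y `|(f (x, t k y) - f (x, y))%:E|) (cst 0)
   (fun x => 2%:E * \int[m2]_y `|(f (x, y))%:E|).
- by move=> k; exact: (@measurable_int1 _ _ _ _ _ m2 _ (mfk k)).
- by [].
- have := ae_integrable1 fi; apply: filterS => x fxi _ /=.
  exact: ct (fun y => f (x, y)) fxi.
- apply: integrableZl => //.
  have := @integrable_fubini_F _ _ _ _ _ m1 m2 _ (integrable_abse fi).
  by [].
- apply: aeW => x k _ /=; rewrite gee0_abs; last exact: integral_ge0.
  apply: (le_trans (L1_dist_le _ _ _)) => //.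
    exact: measurableT_comp (fx x) (pt k).1.
  rewrite ((pt k).2 (fun y => `|(f (x, y))%:E|))//.
    by rewrite -mule2n -mule_natl.
  by do 2 apply: measurableT_comp => //.
by rewrite integral_cst// mul0e => _ _.
Qed.


Lemma L1_cvg_id1 (s : nat -> X -> X) : L1_cvg_id m1 s ->
  forall f : X * Y -> R, (m1 \x m2).-integrable setT (EFin \o f) ->
  \int[m2]_y \int[m1]_x `|(f (s k x, y) - f (x, y))%:E| @[k --> \oo] --> 0.
Proof.
move=> [ps cs] f fi; have [mf _] := integrableP _ _ _ fi.
have mf' : measurable_fun setT f by exact/measurable_EFinP.
have mfk k : measurable_fun setT
    (fun z : X * Y => `|(f (s k z.1, z.2) - f z)%:E|).
  apply: (@measurable_sub_comp _ _ (fun z : X * Y => (s k z.1, z.2)) id) => //.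
  by apply: (measurable_map_pair _ (@measurable_id _ _ _)); exact: (ps k).1.
have fy y : measurable_fun setT (fun x => f (x, y)) by exact: measurable_fun_pair1.
have [] := @dominated_convergence _ _ _ m2 setT measurableT
   (fun k y => \int[m1]_x `|(f (s k x, y) - f (x, y))%:E|) (cst 0)
   (fun y => 2%:E * \int[m1]_x `|(f (x, y))%:E|).
- by move=> k; exact: (@measurable_int2 _ _ _ _ _ m1 _ (mfk k)).
- by [].
- have := ae_integrable2 fi; apply: filterS => y fyi _ /=.
  exact: cs (fun x => f (x, y)) fyi.
- apply: integrableZl => //.
  apply/integrableP; split.
    by apply: (@measurable_int2 _ _ _ _ _ m1 (fun z => `|(f z)%:E|)) => //;
      exact: measurableT_comp.
  under eq_integral do rewrite gee0_abs ?integral_ge0//.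
  by rewrite -(@tonelli21 _ _ _ _ _ m1 m2 (fun z => `|(f z)%:E|))//;
    [case/integrableP : fi|exact: measurableT_comp].
- apply: aeW => y k _ /=; rewrite gee0_abs; last exact: integral_ge0.
  apply: (le_trans (L1_dist_le _ _ _)) => //.
    exact: measurableT_comp (fy y) (ps k).1.
  rewrite ((ps k).2 (fun x => `|(f (x, y))%:E|))//.
    by rewrite -mule2n -mule_natl.
  by do 2 apply: measurableT_comp => //.
by rewrite integral_cst// mul0e => _ _.
Qed.

(** Triangle inequality through f (x, t_k y), where only the second variable has moved. *)
Lemma L1_cvg_id_prod (s : nat -> X -> X) (t : nat -> Y -> Y) :
  L1_cvg_id m1 s -> L1_cvg_id m2 t ->
  L1_cvg_id (m1 \x m2) (fun k z => (s k z.1, t k z.2)).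
Proof.
move=> cs ct; split; first by move=> k; exact: preserving_prod (cs.1 k) (ct.1 k).
move=> f fi; have [mf _] := integrableP _ _ _ fi.
have mf' : measurable_fun setT f by exact/measurable_EFinP.
have mt k : measurable_fun setT (fun z : X * Y => (z.1, t k z.2)).
  by apply: (measurable_map_pair (@measurable_id _ _ _)); exact: (ct.1 k).1.
have ms k : measurable_fun setT (fun z : X * Y => (s k z.1, z.2)).
  by apply: (measurable_map_pair _ (@measurable_id _ _ _)); exact: (cs.1 k).1.
have mst k : measurable_fun setT (fun z : X * Y => (s k z.1, t k z.2)).
  by apply: measurable_map_pair; [exact: (cs.1 k).1|exact: (ct.1 k).1].
apply: (@squeeze_cvge _ _ _ _ (cst 0) _
  (fun k => \int[m2]_y \int[m1]_x `|(f (s k x, y) - f (x, y))%:E| +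
            \int[m1]_x \int[m2]_y `|(f (x, t k y) - f (x, y))%:E|)).
- apply: nearW => k; rewrite integral_ge0//=.
  apply: (le_trans (L1_dist_tri _ (g := fun z => f (z.1, t k z.2)) _ _ _)) => //.
  + exact: measurableT_comp mf' (mst k).
  + exact: measurableT_comp mf' (mt k).
  (* The displacement by [s k] is measured at the point [t k y]; invariance under [t k] brings it
     back to [y]. *)
  have := (@preserving_prod _ _ _ _ _ m1 m2 _ _ (conj (@measurable_id _ _ setT) (fun _ _ _ => erefl)) (ct.1 k)).2
    (fun z => `|(f (s k z.1, z.2) - f z)%:E|) => /= ->.
  + apply: leeD.
      rewrite tonelli21//.
      by apply: (@measurable_sub_comp _ _ (fun z : X * Y => (s k z.1, z.2)) id).
    rewrite tonelli12//.
    by apply: (@measurable_sub_comp _ _ (fun z : X * Y => (z.1, t k z.2)) id).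
  + by apply: (@measurable_sub_comp _ _ (fun z : X * Y => (s k z.1, z.2)) id).
  + by [].
- exact: cvg_cst.
- rewrite -[X in _ --> X]adde0; apply: cvgeD => //.
    exact: L1_cvg_id1.
  exact: L1_cvg_id2.
Qed.

End L1_cvg_id.

Lemma cvge0_le {R : realType} (u : (\bar R)^nat) : (forall k, (0 <= u k)%E) ->
  (forall e : R, 0 < e -> \forall k \near \oo, (u k <= e%:E)%E) ->
  u k @[k --> \oo] --> 0%E.
Proof.
move=> u0 ue; apply/fine_cvgP; split.
  apply: filterS (ue 1 ltr01) => k uk.
  by rewrite ge0_fin_numE// (le_lt_trans uk)// ltry.
apply/cvgrPdist_le => e e0; apply: filterS (ue e e0) => k uk /=.
have ukf : u k \is a fin_num by rewrite ge0_fin_numE// (le_lt_trans uk)// ltry.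
rewrite sub0r normrN ger0_norm ?fine_ge0//.
by rewrite -lee_fin fineK.
Qed.

Lemma cvge0_near {R : realType} (u : (\bar R)^nat) : u k @[k --> \oo] --> 0%E ->
  forall e : R, 0 < e -> \forall k \near \oo, (u k <= e%:E)%E.
Proof.
move=> /fine_cvgP[uf /cvgrPdist_le u0] e e0.
apply: filterS2 uf (u0 e e0) => k ukf /=; rewrite sub0r normrN => uk.
by rewrite -(fineK ukf) lee_fin (le_trans (ler_norm _)).
Qed.

(** * Translations on the real line *)

Section shift1.
Context {R : realType}.
Notation leb := (@lebesgue_measure R).

Lemma lebesgue_itv_lty (a b : R) : (leb `[a, b] < +oo)%E.
Proof. by rewrite lebesgue_measure_itv/=; case: ifPn; rewrite ltry. Qed.

Lemma measurable_addr (h : R) : measurable_fun [set: R] (fun x => x + h).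
Proof. by apply: measurable_funD. Qed.

Lemma preserving_addr (h : R) : preserving leb (fun x : R => x + h).
Proof.
have mh := measurable_addr h; split => // f mf f0.
rewrite -[LHS](@ge0_integral_pushforward _ _ (measurableTypeR R) (measurableTypeR R) _ (fun x : R => x + h) mh leb setT f)//.
apply: eq_measure_integral => A mA _; apply/esym.
apply: (@lebesgue_measure_unique _ (pushforward leb (fun x : R => x + h : measurableTypeR R))) => //.
move=> _ [[a b] _ <-] /=; rewrite /pushforward.
rewrite (_ : _ @^-1` _ = `](a - h), (b - h)]%classic); last first.
  by apply/seteqP; split => x /=; rewrite !in_itv/= lerBrDr ltrBlDr.
rewrite !lebesgue_measure_itv/= !lte_fin ltrD2r -!EFinB.
by rewrite (_ : b - h - (a - h) = b - a)//; ring.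
Qed.

Lemma preserving_opp : preserving leb (fun x : R => - x).
Proof.
have mo : measurable_fun [set: R] (fun x : R => - x).
  exact: oppr_measurable.
split => // f mf f0.
rewrite -[LHS](@ge0_integral_pushforward _ _ (measurableTypeR R) (measurableTypeR R) _ (fun x : R => - x) mo leb setT f)//.
by apply: eq_measure_integral => A mA _; exact: lebesgue_measureN.
Qed.

Lemma integrable_approx_itv (f : R -> R) : leb.-integrable setT (EFin \o f) ->
  forall e : R, 0 < e -> exists2 n : R, 0 < n &
    (\int[leb]_x `|(f x - (f \_ `[- n, n]) x)%:E| <= e%:E)%E.
Proof.
move=> fi e e0; have [mf _] := integrableP _ _ _ fi.
have mf' : measurable_fun setT f by exact/measurable_EFinP.
have mr n : measurable_fun setT (f \_ `[- n, n]).
  by apply/(measurable_restrictT _ _).1 => //; exact: measurable_funTS.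
have [] := @dominated_convergence _ _ _ leb setT measurableT
   (fun n x => `|(f x - (f \_ `[- n.+1%:R, n.+1%:R]) x)%:E|%E) (cst 0%E)
   (fun x => `|(f x)%:E|%E).
- move=> k; have h := mr k.+1%:R.
  have h2 := measurable_funB mf' h.
  have h3 : measurable_fun setT (fun x => (f x - (f \_ `[- k.+1%:R, k.+1%:R]) x)%:E) by apply/measurable_EFinP.
  exact: (measurableT_comp (@abse_measurable _ setT) h3).
- by [].
- apply: aeW => x _.
  apply: (cvg_near_cst).
  near=> k; rewrite /patch ifT ?subrr ?abse0//.
  rewrite inE/= in_itv/= -ler_norml.
  have : `|x| <= k%:R by near: k; exact: nbhs_infty_ger.
  by move=> /le_trans; apply; rewrite ler_nat.
- exact: integrable_abse.
- apply: aeW => x k _ /=; rewrite lee_fin normr_id /patch.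
  by case: ifPn => _; rewrite ?subrr ?normr0// subr0.
rewrite integral_cst// mul0e => _ _ /cvge0_near/(_ e e0).
by move=> [k _ /(_ k (leqnn _))/= hk]; exists k.+1%:R.
Unshelve. all: by end_near.
Qed.

(** The restriction is continuous off the null set {-n, n}. Since [|h k| <= 1], all its translates
    live in [[-(n + 1), n + 1]], where a constant dominates them. *)
Lemma L1_cvg_id_restrict (g : R -> R) (n : R) (h : R^nat) :
  0 < n -> continuous g -> (forall k, `|h k| <= 1) -> h k @[k --> \oo] --> 0 ->
  (\int[leb]_x `|((g \_ `[- n, n]) (x + h k) - (g \_ `[- n, n]) x)%:E|)%E
    @[k --> \oo] --> 0%E.
Proof.
move=> n0 cg h1 h0; set G := g \_ _.
have mG : measurable_fun setT G.
  by apply/(measurable_restrictT _ _).1 => //; apply: measurable_funTS;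
    exact: continuous_measurable_fun.
have [M M0 gM] : exists2 M, 0 <= M & forall x, `|G x| <= M.
  have [||c cin hc] := @EVT_max R (fun x => `|g x|) (- n) n.
  - by rewrite (le_trans (y := 0)) ?oppr_le0 ?ltW.
  - by apply: continuous_subspaceT => x; apply: continuous_comp; [exact: cg|exact: norm_continuous].
  exists `|g c| => // x; rewrite /G /patch; case: ifPn => [|_]; last by rewrite normr0.
  by rewrite inE; exact: hc.
have G_out x : n < `|x| -> G x = 0.
  move=> nx; rewrite /G /patch ifF//; apply/negP; rewrite inE/= in_itv/= -ler_norml.
  by rewrite leNgt nx.
have cG x : x != n -> x != - n -> {for x, continuous G}.
  move=> xn xNn; have [nx|nx] := ltP n `|x|.
    rewrite /prop_for /continuous_at (G_out _ nx); apply: cvg_near_cst.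
    have : \forall y \near x, n < `|y|.
      by apply: (@cvgr_gt _ _ (nbhs x) _ Num.norm `|x|) => //; exact: (@norm_continuous _ _ x).
    by apply: filterS => y /G_out ->.
  have {}nx : `|x| < n.
    rewrite lt_neqAle nx andbT; apply: contra xn => /eqP xn'.
    move: xNn; rewrite -xn'; case: (ler0P x) => x0; rewrite ?opprK ?eqxx//.
  have Gg y : `|y| < n -> G y = g y.
    by move=> yn; rewrite /G /patch ifT// inE/= in_itv/= -ler_norml ltW.
  rewrite /prop_for /continuous_at (Gg _ nx); apply: cvg_trans (cg x).
  apply: near_eq_cvg.
  have : \forall y \near x, `|y| < n.
    by apply: (@cvgr_lt _ _ (nbhs x) _ Num.norm `|x|) => //; exact: (@norm_continuous _ _ x).
  by apply: filterS => y /Gg ->.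
have [] := @dominated_convergence _ _ _ leb setT measurableT
   (fun k x => `|(G (x + h k) - G x)%:E|%E) (cst 0%E)
   (fun x => (2 * M * \1_(`[- (n + 1), (n + 1)]%classic) x)%:E).
- move=> k; apply: measurableT_comp => //; apply/measurable_EFinP; apply: measurable_funB => //.
  by apply: measurableT_comp => //; exact: measurable_addr.
- by [].
- exists [set n; - n]; split; first exact: measurableU.
    by apply: countable_lebesgue_measure0; apply: finite_set_countable.
  move=> x /= /not_implyP[_ xcvg]; apply: contrapT => /not_orP[xn xNn]; apply: xcvg.
  have {xn} xn : x != n by exact/eqP.
  have {xNn} xNn : x != - n by exact/eqP.
  have cGx := cG x xn xNn.
  have cGh : (G (x + h k) - G x) @[k --> \oo] --> 0.
    rewrite -(subrr (G x)); apply: cvgB; last exact: cvg_cst.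
    have xh : (x + h k) @[k --> \oo] --> x.
      by rewrite -[X in _ --> X]addr0; apply: cvgD => //; exact: cvg_cst.
    exact: (@cvg_comp _ _ _ _ G _ _ _ xh cGx).
  have := cvg_norm cGh; rewrite normr0 => cN.
  apply: (@cvg_EFin _ _ \oo _ (fun k => `|(G (x + h k) - G x)%:E|%E) 0) => //.
    exact: nearW.
  exact: cN.
- apply/integrableP; split.
    by apply/measurable_EFinP; apply: measurable_funM => //; exact: measurable_indic.
  under eq_integral do rewrite EFinM abseM [X in (_ * X)%E]gee0_abs ?lee_fin//.
  rewrite ge0_integralZl_EFin//; last exact/measurable_EFinP/measurable_indic.
  rewrite integral_indic// setIT lte_mul_pinfty ?lee_fin//; exact: lebesgue_itv_lty.
- apply: aeW => x k _ /=; rewrite lee_fin normr_id indicE.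
  have [xn|xn] := boolP (x \in _).
    by rewrite mulr1 (le_trans (ler_normB _ _))// mulr_natl mulr2n lerD.
  have {}xn : n + 1 < `|x|.
    by rewrite ltNge ler_norml; apply: contra xn; rewrite inE/= in_itv.
  rewrite mulr0 (G_out x); last by apply: lt_trans xn; rewrite ltrDl.
  rewrite (G_out (x + h k)) ?subrr ?normr0//.
  have := lerB_dist x (- h k); rewrite opprK normrN => hx.
  by have := h1 k; lra.
by rewrite integral_cst// mul0e => _ _.
Unshelve. all: by end_near.
Qed.

Lemma L1_cvg_id_addr (h : R^nat) :
  (forall k, `|h k| <= 1) -> h k @[k --> \oo] --> 0 ->
  L1_cvg_id leb (fun k x => x + h k).
Proof.
move=> h1 h0; split=> [k|f fi]; first exact: preserving_addr.
have [mf _] := integrableP _ _ _ fi.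
have mf' : measurable_fun setT f by exact/measurable_EFinP.
apply: cvge0_le => [k|e e0]; first exact: integral_ge0.
(* Five errors: truncation and continuous approximation, each for [f] and for its translate, and the
   translation of the truncated continuous function. *)
have e5 : 0 < e / 5 by rewrite divr_gt0.
have [n n0 fn] := integrable_approx_itv fi e5.
have fin : leb.-integrable `[- n, n] (EFin \o f) by exact: integrableS fi.
have [g [cg gi fg]] := @approximation_continuous_integrable R `[- n, n] f
  (measurable_itv _) (lebesgue_itv_lty _ _) fin.
have [k0 _ /(_ k0 (leqnn _))/= {}fg] := cvge0_near fg e5.
have := L1_cvg_id_restrict n0 (cg k0) h1 h0; set G := g k0 \_ _ => cG.
have mG : measurable_fun setT G.
  by apply/(measurable_restrictT _ _).1 => //; apply: measurable_funTS;
    exact: continuous_measurable_fun.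
have mr : measurable_fun setT (f \_ `[- n, n]).
  by apply/(measurable_restrictT _ _).1 => //; exact: measurable_funTS.
have fG : (\int[leb]_x `|(f x - G x)%:E| <= (e / 5 + e / 5)%:E)%E.
  apply: (le_trans (L1_dist_tri _ mf' mr mG)).
  rewrite EFinD; apply: leeD => //.
  apply: le_trans fg; rewrite [leRHS]integral_mkcond le_eqVlt; apply/orP; left.
  apply/eqP; apply: eq_integral => x _; rewrite /G /patch.
  by case: ifPn => //; rewrite subrr abse0.
have := cvge0_near cG e5; apply: filterS => k Gk.
have ms : measurable_fun setT (fun x : R => x + h k) by exact: measurable_addr.
apply: (le_trans (@L1_dist_tri R _ (measurableTypeR R) leb (fun x => f (x + h k)) (fun x : R => G (x + h k)) f _ _ _)) => //.
- exact: measurableT_comp mf' ms.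
- exact: measurableT_comp mG ms.
rewrite ((preserving_addr (h k)).2 (fun x => `|(f x - G x)%:E|%E))//; last first.
  by do 2 apply: measurableT_comp => //; exact: measurable_funB.
rewrite (_ : e = (e / 5 + e / 5) + (e / 5 + (e / 5 + e / 5))); last by field.
rewrite EFinD leeD//.
apply: (le_trans (@L1_dist_tri R _ (measurableTypeR R) leb (fun x : R => G (x + h k)) G f _ _ _)) => //.
  exact: measurableT_comp mG ms.
rewrite EFinD leeD//.
rewrite (le_trans _ fG)// le_eqVlt; apply/orP; left; apply/eqP.
by apply: eq_integral => x _; rewrite /= distrC.
Qed.

End shift1.

(** * Translations and reflection on R^n, by induction on the dimension *)

Section shift_rV.
Context {R : realType}.
Local Open Scope ereal_scope.
Notation leb := (@lebesgue_measure R).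

Lemma ge0_integral_lebesgue_rVS n (f : 'rV[R]_n.+1 -> \bar R) :
  measurable_fun setT f -> (forall x, 0 <= f x) ->
  \int[lebesgue_rV n.+1]_x f x =
  \int[leb \x lebesgue_rV n]_z f (rV_cons z).
Proof.
move=> mf f0.
exact: (@ge0_integral_pushforward _ _ (measurableTypeR R * 'rV[R]_n)%type _ _ (@rV_cons R n)
  (@measurable_rV_cons R n) (leb \x lebesgue_rV n) setT f measurableT mf
  (fun x _ => f0 x)).
Qed.

Lemma measurable_addrV n (h : 'rV[R]_n) :
  measurable_fun setT (fun x : 'rV[R]_n => x + h)%R.
Proof.
apply/measurable_fun_rVP => i; under eq_fun do rewrite mxE.
by apply: measurable_funD => //; exact: measurable_coord.
Qed.

Lemma measurable_oprV n : measurable_fun setT (fun x : 'rV[R]_n => - x)%R.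
Proof.
apply/measurable_fun_rVP => i; under eq_fun do rewrite mxE.
by apply: measurableT_comp => //; exact: measurable_coord.
Qed.

Lemma rV_consD n (z : R * 'rV[R]_n) (h : 'rV[R]_n.+1) :
  (rV_cons z + h = rV_cons (z.1 + (rV_uncons h).1, z.2 + (rV_uncons h).2))%R.
Proof.
apply/rowP => i; rewrite mxE; have [j ->|->] := unliftP ord0 i.
  by rewrite !rV_consS !mxE.
by rewrite !rV_cons0.
Qed.

Lemma rV_consN n (z : R * 'rV[R]_n) : (- rV_cons z = rV_cons (- z.1, - z.2))%R.
Proof.
apply/rowP => i; rewrite mxE; have [j ->|->] := unliftP ord0 i.
  by rewrite !rV_consS !mxE.
by rewrite !rV_cons0.
Qed.

Lemma preserving_rVS n (s : 'rV[R]_n.+1 -> 'rV[R]_n.+1)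
    (s' : R * 'rV[R]_n -> R * 'rV[R]_n) :
  measurable_fun setT s -> preserving (leb \x lebesgue_rV n) s' ->
  (forall z, s (rV_cons z) = rV_cons (s' z)) ->
  preserving (lebesgue_rV n.+1) s.
Proof.
move=> ms [ms' ps'] ss'; split => // f mf f0.
rewrite !ge0_integral_lebesgue_rVS//; last exact: measurableT_comp mf ms.
under eq_integral do rewrite ss'.
rewrite (ps' (fun z => f (rV_cons z)))//.
exact: measurableT_comp mf (@measurable_rV_cons R n).
Qed.

Lemma preserving_rV0 (s : 'rV[R]_0 -> 'rV[R]_0) : preserving (lebesgue_rV 0) s.
Proof.
have sid x : s x = x by apply/rowP; case.
split=> [|f _ _]; last by under eq_integral do rewrite sid.
by rewrite (_ : s = id)//; apply/funext.
Qed.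

Lemma preserving_addrV n (h : 'rV[R]_n) :
  preserving (lebesgue_rV n) (fun x => x + h)%R.
Proof.
elim: n h => [|n ih] h; first exact: preserving_rV0.
apply: (@preserving_rVS _ _ (fun z => (z.1 + (rV_uncons h).1,
  z.2 + (rV_uncons h).2)%R) (measurable_addrV h)); last first.
  by move=> z; exact: rV_consD.
exact: (preserving_prod (preserving_addr _) (ih _)).
Qed.

Lemma preserving_oprV n : preserving (lebesgue_rV n) (fun x : 'rV[R]_n => - x)%R.
Proof.
elim: n => [|n ih]; first exact: preserving_rV0.
apply: (@preserving_rVS _ _ (fun z => (- z.1, - z.2)%R) (@measurable_oprV _));
  last by move=> z; exact: rV_consN.
exact: (preserving_prod preserving_opp ih).
Qed.

(** Through [rV_cons] a translation of R^(n+1) is the product of a translation of the line and one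
    of R^n, so [L1_cvg_id_prod] gives the induction step. *)
Lemma L1_cvg_id_addrV n (h : nat -> 'rV[R]_n) :
  (forall k i, `|h k ord0 i| <= 1)%R ->
  (forall i, h k ord0 i @[k --> \oo] --> 0%R) ->
  L1_cvg_id (lebesgue_rV n) (fun k x => x + h k)%R.
Proof.
elim: n h => [|n ih] h h1 h0.
  split=> [k|f _]; first exact: preserving_rV0.
  rewrite (_ : (fun k => _) = cst 0); first exact: cvg_cst.
  apply/funext => k; rewrite -[RHS](@integral0 _ _ _ (lebesgue_rV 0) setT).
  apply: eq_integral => x _; rewrite (_ : (x + h k)%R = x) ?subrr ?abse0//.
  by apply/rowP; case.
split=> [k|f fi]; first exact: preserving_addrV.
have [mf _] := integrableP _ _ _ fi.
have mf' : measurable_fun setT f by exact/measurable_EFinP.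
have mfc : measurable_fun setT (fun z => f (rV_cons z)).
  exact: measurableT_comp mf' (@measurable_rV_cons R n).
have ih' : L1_cvg_id (lebesgue_rV n) (fun k x => x + (rV_uncons (h k)).2)%R.
  apply: ih => [k i|i]; first by rewrite mxE.
  by under eq_fun do rewrite mxE; exact: h0.
have [_ H] := @L1_cvg_id_prod _ _ _ _ _ leb (lebesgue_rV n)
  (fun k a => a + (rV_uncons (h k)).1)%R (fun k x => x + (rV_uncons (h k)).2)%R
  (L1_cvg_id_addr (fun k => h1 k ord0) (h0 ord0)) ih'.
move: H.
have -> : (fun k => \int[lebesgue_rV n.+1]_x `|(f (x + h k)%R - f x)%:E|) =
  (fun k => \int[leb \x lebesgue_rV n]_z `|(f (rV_cons (z.1 + (rV_uncons (h k)).1,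
     z.2 + (rV_uncons (h k)).2)%R) - f (rV_cons z))%:E|).
  apply/funext => k; rewrite ge0_integral_lebesgue_rVS//.
    by under eq_integral do rewrite rV_consD.
  exact: (@measurable_sub_comp R _ _ (fun x : 'rV[R]_n.+1 => x + h k)%R id f
    (measurable_addrV _) (@measurable_id _ _ _) mf').
apply; apply/integrableP; split; first exact/measurable_EFinP.
rewrite -(ge0_integral_lebesgue_rVS (f := fun x => `|(f x)%:E|))//.
  by case/integrableP : fi.
exact: measurableT_comp.
Qed.

(** From sequences to a uniform modulus: if no [r] worked, vectors [h k] of size at most 1/(k+1)
    with a large translation error would contradict [L1_cvg_id_addrV]. *)
Lemma L1_translation n (f : 'rV[R]_n -> R) :
  (lebesgue_rV n).-integrable setT (EFin \o f) ->
  forall e : R, (0 < e)%R -> exists2 r : R, (0 < r)%R &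
  forall h : 'rV[R]_n, (forall i, `|h ord0 i| <= r)%R ->
  \int[lebesgue_rV n]_x `|(f (x + h)%R - f x)%:E| <= e%:E.
Proof.
move=> fi e e0; apply: contrapT => /forall2NP nr.
have H k : exists h : 'rV[R]_n, (forall i, `|h ord0 i| <= k.+1%:R^-1)%R /\
    ~~ (\int[lebesgue_rV n]_x `|(f (x + h)%R - f x)%:E| <= e%:E).
  have [|/existsNP[h /not_implyP[hk /negP he]]] := nr k.+1%:R^-1%R.
    by rewrite invr_gt0 ltr0n.
  by exists h.
pose h k := projT1 (cid (H k)).
have hP k : (forall i, `|h k ord0 i| <= k.+1%:R^-1)%R /\
    ~~ (\int[lebesgue_rV n]_x `|(f (x + h k)%R - f x)%:E| <= e%:E).
  exact: projT2 (cid (H k)).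
have [|i|_ /(_ f fi)/cvge0_near/(_ _ e0)] := @L1_cvg_id_addrV n h.
- by move=> k i; rewrite (le_trans ((hP k).1 i))// invf_le1 ?ltr0n// ler1n.
- apply/cvgrPdist_le => r r0; near=> k; rewrite sub0r normrN.
  rewrite (le_trans ((hP k).1 i))//.
  by apply: ltW; near: k; exact: (near_infty_natSinv_lt (PosNum r0)).
move=> [k _ /(_ k (leqnn _))/=]; exact/negP/(hP k).2.
Unshelve. all: by end_near.
Qed.

End shift_rV.

(** * Closure properties of smooth functions *)

Section smooth_closure.
Context {R : realType} {V : normedModType R}.
Implicit Types f g : V -> R.

Lemma CkS_Ck k f : Ck k.+1 f -> Ck k f.
Proof.
elim: k f => [f [df _] x|k ih f [df Df]]; first exact: differentiable_continuous.
by split=> // v; apply: ih; exact: Df.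
Qed.

Lemma Ck_cst k (a : R) : Ck k (cst a : V -> R).
Proof.
elim: k a => [|k ih] a; first by move=> x; exact: cvg_cst.
split=> [x|v]; first exact: differentiable_cst.
rewrite (_ : 'D_v (cst a) = cst 0); first exact: ih.
by apply/funext => x; rewrite derive_cst.
Qed.

Lemma Ck_add k f g : Ck k f -> Ck k g -> Ck k (f + g).
Proof.
elim: k f g => [f g cf cg x|k ih f g [df Df] [dg Dg]].
  by apply: continuousD; [exact: cf|exact: cg].
split=> [x|v]; first exact: differentiableD.
rewrite (_ : 'D_v (f + g) = 'D_v f + 'D_v g).
  exact: ih (Df v) (Dg v).
by apply/funext => x; rewrite deriveD//; apply: diff_derivable.
Qed.

Lemma Ck_mul k f g : Ck k f -> Ck k g -> Ck k (f * g).
Proof.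
elim: k f g => [f g cf cg x|k ih f g Cf Cg].
  by apply: continuousM; [exact: cf|exact: cg].
have [[df Df] [dg Dg]] := (Cf, Cg).
split=> [x|v]; first exact: differentiableM.
rewrite (_ : 'D_v (f * g) = f * 'D_v g + g * 'D_v f).
  by apply: Ck_add; apply: ih; [exact: CkS_Ck|exact: Dg|exact: CkS_Ck|exact: Df].
by apply/funext => x; rewrite deriveM//; apply: diff_derivable.
Qed.

Lemma Ck_scale k a f : Ck k f -> Ck k (fun x => a * f x).
Proof. by move=> Cf; exact: (Ck_mul (Ck_cst k a) Cf). Qed.

Lemma smooth_mul f g : smooth f -> smooth g -> smooth (fun x => f x * g x).
Proof. by move=> sf sg k; exact: Ck_mul. Qed.

Lemma smooth_prod (I : Type) (s : seq I) (F : I -> V -> R) :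
  (forall i, smooth (F i)) -> smooth (fun x => \prod_(i <- s) F i x).
Proof.
move=> sF; elim: s => [|i s ih].
  by rewrite (_ : (fun _ => _) = cst 1); [move=> k; exact: Ck_cst|apply/funext => x; rewrite big_nil].
rewrite (_ : (fun _ => _) = fun x => F i x * \prod_(j <- s) F j x); first exact: smooth_mul.
by apply/funext => x; rewrite big_cons.
Qed.

(** The derivative in the direction [v] is the constant [l v] times b' at the same affine argument,
    so the induction stays within this form. *)
Lemma Ck_comp_affine k (b : R -> R) (l : {linear V -> R}) (c : R) :
  continuous l -> Ck k b -> Ck k (fun x => b (l x + c)).
Proof.
move=> cl; elim: k b => [b cb x|k ih b [db Db]].
  apply: (@continuous_comp _ _ _ (fun x => l x + c) b); last exact: cb.
  by apply: continuousD; [exact: cl|exact: cst_continuous].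
have dlc x : differentiable (fun x => l x + c) x.
  by apply: differentiableD => //; exact: linear_differentiable.
split=> [x|v].
  by apply: (@differentiable_comp _ _ _ _ (fun x => l x + c) b); [exact: dlc|exact: db].
rewrite (_ : 'D_v _ = fun x => l v * 'D_1 b (l x + c)).
  by apply: Ck_scale; exact: (ih _ (Db 1)).
apply/funext => x; rewrite deriveE; last first.
  by apply: (@differentiable_comp _ _ _ _ (fun x => l x + c) b); [exact: dlc|exact: db].
rewrite (@diff_comp _ _ _ _ (fun x => l x + c) b)//=.
rewrite (deriveE (1 : R) (db (l x + c))).
rewrite (_ : 'd (fun x => l x + c) x v = l v *: (1 : R)).
  by rewrite linearZ.
rewrite (_ : (fun x => l x + c) = (l : V -> R) + cst c)// diffD//; last exact: linear_differentiable.
by rewrite /= diff_lin// diff_cst/= addr0 /GRing.scale/= mulr1.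
Qed.

Lemma smooth_comp_affine (b : R -> R) (l : V -> R) (c : R) :
  linear l -> continuous l -> smooth b -> smooth (fun x => b (l x + c)).
Proof.
move=> ll cl sb k.
pose lM := GRing.isLinear.Build _ _ _ _ l ll.
pose L : {linear V -> R} := HB.pack l lM.
exact: (@Ck_comp_affine k b L).
Qed.

(** Reduces the partial derivatives of the test function to derivatives in one real variable. *)
Lemma deriveE1 f x v : 'D_v f x = 'D_1 (fun h : R => f (h *: v + x)) 0.
Proof.
rewrite /derive; congr (lim (_ @ 0^')); apply/funext => h /=.
by rewrite /shift/= addr0 scale0r add0r /GRing.scale/= mulr1.
Qed.

End smooth_closure.

(** * A smooth bump on the line *)

Section bump.
Context {R : realType}.

(** The functions x^(-n) e^(-1/x), extended by 0 to x <= 0. Their span is stable under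
    differentiation, so that all of them, and [expV 0] in particular, are smooth by induction. *)
Definition expV (n : nat) (x : R) : R :=
  if 0 < x then x^-1 ^+ n * expR (- x^-1) else 0.

Lemma expV_ge0 n x : 0 <= expV n x.
Proof.
by rewrite /expV; case: ifPn => // x0; rewrite mulr_ge0 ?expR_ge0// exprn_ge0// invr_ge0 ltW.
Qed.

(** From e^y >= y^(n+1) / (n+1)! at y = 1/x. Linear decay at 0 for every [n] is all that
    differentiability at 0 requires. *)
Lemma expV_le n x : 0 <= x -> expV n x <= (n.+1)`!%:R * x.
Proof.
rewrite le_eqVlt => /predU1P[<-|x0]; first by rewrite /expV ltxx mulr0.
rewrite /expV x0 expRN ler_pdivrMr ?expR_gt0//.
have x'0 : 0 <= x^-1 by rewrite invr_ge0 ltW.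
have -> : x^-1 ^+ n = x^-1 ^+ n.+1 * x by rewrite exprSr mulfVK ?gt_eqF.
rewrite [leRHS]mulrAC ler_pM2r// -ler_pdivrMl ?ltr0n ?fact_gt0// mulrC.
by apply: le_trans (expR_ge1Dxn n x'0); rewrite lerDr.
Qed.

Lemma expV_is_derive n (x : R) :
  is_derive x 1 (expV n) (expV n.+2 x - n%:R * expV n.+1 x).
Proof.
have [x0|x0|<-] := ltgtP 0 x.
- have x0' : x != 0 by rewrite gt_eqF.
  have dV : is_derive x 1 (fun y : R => y^-1) (- x ^- 2).
    apply: is_derive_eq; first exact: (@is_deriveV _ id).
    by rewrite /GRing.scale/= mulr1.
  have dE : is_derive x 1 (fun y : R => expR (- y^-1)) (expR (- x^-1) * x ^- 2).
    have dNV : is_derive x 1 (fun y : R => - y^-1) (x ^- 2).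
      by rewrite -[x ^- 2]opprK; exact: (is_deriveN dV).
    exact: (@is_derive1_comp _ expR (fun y : R => - y^-1) x _ _ (is_derive_expR _) dNV).
  apply: (@near_eq_is_derive _ _ _ (fun y : R => y^-1 ^+ n * expR (- y^-1))).
    near=> y; rewrite /expV ifT//; near: y; exact: lt_nbhsr.
  have D := is_deriveM (is_deriveX n dV) dE.
  have -> : (fun y : R => y^-1 ^+ n * expR (- y^-1)) =
      (fun y => y^-1) ^+ n * (fun y => expR (- y^-1)).
    by apply/funext => y; rewrite !fctE.
  apply: (is_derive_eq D).
  rewrite /expV x0 /GRing.scale/=.
  case: n {D} => [|n] /=; first by rewrite mul0r !expr0 !mul0r mulr0 mul1r addr0 subr0 exprVn mulrC.
  rewrite !fctE -!exprVn. 
  by rewrite (exprS _ n.+2) !(exprS _ n.+1) !(exprS _ n); move: (x^-1) => y;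
    move: (y ^+ n) (expR _) (n.+1%:R) => a b m; ring.
- apply: (@near_eq_is_derive _ _ _ (cst 0)).
    near=> y; rewrite /expV ifF//; apply/negbTE; rewrite -leNgt ltW//.
    by near: y; exact: lt_nbhsl.
  have e0 m : expV m x = 0.
    by rewrite /expV ifF//; apply/negbTE; rewrite -leNgt ltW.
  by rewrite !e0 mulr0 subr0; exact: is_derive_cst.
- rewrite /expV ltxx mulr0 subr0.
  have c0 : h^-1 *: ((expV n \o shift 0) (h *: (1 : R)) - expV n 0) @[h --> 0^'] --> (0 : R).
    apply/cvgrPdist_le => e e0; near=> h.
    rewrite sub0r normrN /shift/= addr0 /GRing.scale/= mulr1 {2}/expV ltxx subr0.
    have hn0 : h != 0 by near: h; exact: nbhs_dnbhs_neq.
    have [h0|h0] := ltP 0 h; last first.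
      by rewrite /expV ltNge h0/= mulr0 normr0 ltW.
    (* The difference quotient of [expV n] at 0 is [expV n.+1], which [expV_le] makes small. *)
    rewrite (_ : _ * _ = expV n.+1 h); last by rewrite /expV h0 mulrA exprS.
    rewrite ger0_norm ?expV_ge0// (le_trans (expV_le _ (ltW h0)))//.
    rewrite -ler_pdivlMl ?ltr0n ?fact_gt0// -[leLHS]gtr0_norm//.
    near: h; apply: dnbhs0_le.
    by rewrite mulr_gt0// invr_gt0 ltr0n fact_gt0.
  by split; [apply/cvg_ex; exists 0|exact/cvg_lim].
Unshelve. all: by end_near.
Qed.

Lemma smooth_expV n : smooth (expV n).
Proof.
move=> k; elim: k n => [|k ih] n.
  by move=> x; apply: differentiable_continuous; apply/derivable1_diffP;
    exact: (@ex_derive _ _ _ _ _ _ _ (expV_is_derive n x)).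
split=> [x|v].
  by apply/derivable1_diffP; exact: (@ex_derive _ _ _ _ _ _ _ (expV_is_derive n x)).
rewrite (_ : 'D_v _ = fun x => v * (expV n.+2 x + (- n%:R) * expV n.+1 x)).
  by apply: Ck_scale; apply: Ck_add => //; exact: Ck_scale.
apply/funext => x.
have dx : differentiable (expV n) x.
  by apply/derivable1_diffP; exact: (@ex_derive _ _ _ _ _ _ _ (expV_is_derive n x)).
rewrite deriveE// -[v in 'd _ _ v]mulr1 -[v * 1]/(v *: (1 : R)) linearZ/=.
rewrite -deriveE// (@derive_val _ _ _ _ _ _ _ (expV_is_derive n x)).
by rewrite mulNr.
Qed.

Lemma expV0_homo x y : x <= y -> expV 0 x <= expV 0 y.
Proof.
move=> xy; rewrite /expV !expr0 !mul1r; case: ltP => x0.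
  rewrite (lt_le_trans x0 xy) ler_expR lerN2 lef_pV2//.
  by rewrite posrE (lt_le_trans x0 xy).
by case: ifPn => // _; exact: expR_ge0.
Qed.

(** On (-1, 1) this is exp(-2 / (1 - x^2)). *)
Definition bump (x : R) : R := expV 0 (x + 1) * expV 0 (- x + 1).
Definition dbump : R -> R := 'D_1 bump.

Lemma smooth_bump : smooth bump.
Proof.
apply: smooth_mul.
  apply: (@smooth_comp_affine _ _ (expV 0) id 1) => //; last exact: smooth_expV.
  by move=> x; exact: cvg_id.
apply: (@smooth_comp_affine _ _ (expV 0) (fun x : R => - x) 1) => //.
- by move=> a u v; rewrite opprD scalerN.
- exact: opp_continuous.
- exact: smooth_expV.
Qed.

Lemma smooth_derive1 (f : R -> R) : smooth f -> smooth ('D_1 f).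
Proof. by move=> sf k; exact: (sf k.+1).2. Qed.

Lemma smooth_is_derive (f : R -> R) (x : R) : smooth f -> is_derive x 1 f ('D_1 f x).
Proof. by move=> /(_ 1)[+ _] => /(_ x) /diff_derivable h; split. Qed.

Lemma smooth_continuous (f : R -> R) : smooth f -> continuous f.
Proof. by move=> /(_ 0). Qed.

Lemma bump_ge0 x : 0 <= bump x.
Proof. by rewrite mulr_ge0// expV_ge0. Qed.

Lemma bumpN x : bump (- x) = bump x.
Proof. by rewrite /bump opprK mulrC. Qed.

Lemma bump_out x : 1 <= `|x| -> bump x = 0.
Proof.
rewrite ler_normr /bump => /orP[x1|x1].
  by rewrite {2}/expV ifF ?mulr0//; apply/negbTE; rewrite -leNgt; lra.
by rewrite {1}/expV ifF ?mul0r//; apply/negbTE; rewrite -leNgt; lra.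
Qed.

(** Both factors of [bump] are nondecreasing functions taken at arguments that are at least 1/2. The
    bound makes the masses of the mollifiers positive. *)
Lemma bump_lower : exists2 c : R, 0 < c & forall x, `|x| <= 2^-1 -> c <= bump x.
Proof.
exists (expV 0 2^-1 * expV 0 2^-1).
  have -> : expV 0 (2^-1 : R) = expR (- 2).
    by rewrite /expV invr_gt0 ltr0n expr0 mul1r invrK.
  by rewrite mulr_gt0// expR_gt0.
move=> x; rewrite ler_norml => /andP[x1 x2].
by apply: ler_pM; rewrite ?expV_ge0//; apply: expV0_homo; lra.
Qed.

Lemma derive_out (f : R -> R) : (forall x, 1 < `|x| -> f x = 0) ->
  forall x, 1 < `|x| -> 'D_1 f x = 0.
Proof.
move=> f0 x x1; have -> : 0 = 'D_1 (cst 0 : R -> R) x by rewrite derive_cst.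
apply: near_eq_derive.
have : \forall y \near x, 1 < `|y|.
  by apply: (@cvgr_gt _ _ (nbhs x) _ Num.norm `|x|) => //; exact: (@norm_continuous _ _ x).
by apply: filterS => y /f0.
Qed.

Lemma continuous_bounded_support (f : R -> R) : continuous f ->
  (forall x, 1 < `|x| -> f x = 0) -> exists2 B : R, 0 <= B & forall x, `|f x| <= B.
Proof.
move=> cf f0; have [||c cin hc] := @EVT_max R (fun x => `|f x|) (- 1) 1.
- lra.
- by apply: continuous_subspaceT => x; apply: continuous_comp;
    [exact: cf|exact: norm_continuous].
exists `|f c| => // x; have [x1|x1] := leP `|x| 1; last by rewrite (f0 x x1) normr0.
by apply: hc; rewrite in_itv/= -ler_norml.
Qed.

Lemma MVT_le (f df : R -> R) (B : R) : (forall x : R, is_derive x 1 f (df x)) ->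
  (forall x, `|df x| <= B) -> forall x y, `|f y - f x| <= B * `|y - x|.
Proof.
move=> fd dB x y; wlog xy : x y / x < y.
  move=> H; have [xy|yx|->] := ltgtP x y; first exact: H.
    by rewrite distrC (distrC y); exact: H.
  by rewrite !subrr normr0 mulr0.
have cf : {within `[x, y], continuous f}.
  apply: continuous_subspaceT => z; apply: differentiable_continuous.
  by apply/derivable1_diffP; exact: (@ex_derive _ _ _ _ _ _ _ (fd z)).
have [c _ ->] := MVT xy (fun z _ => fd z) cf.
by rewrite normrM ler_wpM2r.
Qed.

Lemma dbump_out (x : R) : 1 < `|x| -> dbump x = 0.
Proof. by apply: derive_out => y /ltW; exact: bump_out. Qed.

Lemma dbump_continuous : continuous dbump.
Proof. by apply: smooth_continuous; exact/smooth_derive1/smooth_bump. Qed.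

Lemma bump_is_derive (x : R) : is_derive x 1 bump (dbump x).
Proof. by apply: smooth_is_derive; exact: smooth_bump. Qed.

Lemma bump_bounds : exists2 B : R, 0 < B & forall x z,
  [/\ `|bump x| <= B, `|dbump x| <= B, `|bump (x + z) - bump x| <= B * `|z| &
   `|bump (x + z) + bump (x - z) - 2 * bump x| <= B * `|z| ^+ 2].
Proof.
have [B0 B00 hB0] : exists2 B : R, 0 <= B & forall x, `|bump x| <= B.
  apply: continuous_bounded_support; first exact/smooth_continuous/smooth_bump.
  by move=> x /ltW; exact: bump_out.
have [B1 B10 hB1] := continuous_bounded_support dbump_continuous dbump_out.
have sdb : smooth dbump by apply: smooth_derive1; exact: smooth_bump.
have [B2 B20 hB2] := continuous_bounded_support
  (smooth_continuous (smooth_derive1 sdb)) (derive_out dbump_out).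
(* [B0], [B1] and [2 * B2] serve the function, its derivative and the second difference; the 1 makes
   the constant positive. *)
exists (B0 + B1 + 2 * B2 + 1); first lra.
move=> x z; split.
- by rewrite (le_trans (hB0 x))//; lra.
- by rewrite (le_trans (hB1 x))//; lra.
- have := MVT_le bump_is_derive hB1 x (x + z); rewrite [x + z - x]addrAC subrr add0r.
  by move/le_trans; apply; rewrite ler_wpM2r//; lra.
wlog z0 : z / 0 <= z.
  move=> H; have [z0|z0] := leP 0 z; first exact: H.
  have := H (- z); rewrite opprK normrN (addrC (bump (x - z))).
  by apply; rewrite oppr_ge0 ltW.
(* The second difference is [F z - F 0], and F' is at most [2 * B2 * |s|] because [dbump] is
   [B2]-Lipschitz; the mean value theorem then gives a quadratic bound. *)
pose F s := bump (x + s) + bump (x - s).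
pose dF s := dbump (x + s) - dbump (x - s).
have dFP (s : R) : is_derive s 1 F (dF s).
  have dp : is_derive s 1 (fun t : R => x + t) 1.
    have := is_deriveD (is_derive_cst x s (1 : R)) (is_derive_id s (1 : R)).
    by rewrite add0r.
  have dm : is_derive s 1 (fun t : R => x - t) (- 1).
    have := is_deriveB (is_derive_cst x s (1 : R)) (is_derive_id s (1 : R)).
    by rewrite sub0r.
  have h1 := @is_derive1_comp _ bump (fun t : R => x + t) s _ _ (bump_is_derive _) dp.
  have h2 := @is_derive1_comp _ bump (fun t : R => x - t) s _ _ (bump_is_derive _) dm.
  by apply: (is_derive_eq (is_deriveD h1 h2)); rewrite mulr1 mulrN1.
have ddb (y : R) : is_derive y 1 dbump ('D_1 dbump y) by exact: smooth_is_derive.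
have dFB s : `|dF s| <= B2 * (2 * `|s|).
  have := MVT_le ddb hB2 (x - s) (x + s).
  by rewrite [x + s - _](_ : _ = 2 * s) ?normrM ?(ger0_norm (ler0n _ 2))//; ring.
have -> : bump (x + z) + bump (x - z) - 2 * bump x = F z - F 0.
  by rewrite /F addr0 subr0 mulr_natl mulr2n.
move: z0; rewrite le_eqVlt => /predU1P[<-|z0].
  by rewrite subrr !normr0 expr0n/= mulr0.
have cF : {within `[0, z], continuous F}.
  apply: continuous_subspaceT => s; apply: differentiable_continuous.
  by apply/derivable1_diffP; exact: (@ex_derive _ _ _ _ _ _ _ (dFP s)).
have [s sz ->] := MVT z0 (fun s _ => dFP s) cF.
rewrite subr0 normrM expr2 mulrA ler_wpM2r// (le_trans (dFB s))//.
have sz' : `|s| <= `|z|.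
  by move: sz; rewrite in_itv/= => /andP[s0 sz]; rewrite !gtr0_norm ?ltW.
rewrite mulrA ler_pM// ?mulr_ge0//; lra.
Qed.

End bump.

(** * The mollifier in space and its finite differences *)

Section mollifier.
Context {R : realType} {d : nat}.
Variable e : R.
Implicit Types h z : 'rV[R]_d.

(** A product of one-dimensional bumps, supported in a cube: derivatives and bounds reduce to
    [bump]. *)
Definition moll h : R := \prod_(i < d) bump (e^-1 * h ord0 i).

Definition dmoll (i : 'I_d) h : R :=
  e^-1 * dbump (e^-1 * h ord0 i) * \prod_(j < d | j != i) bump (e^-1 * h ord0 j).

Lemma moll_ge0 h : 0 <= moll h.
Proof. by apply: prodr_ge0 => i _; exact: bump_ge0. Qed.

Lemma mollN h : moll (- h) = moll h.
Proof. by apply: eq_bigr => i _; rewrite mxE mulrN bumpN. Qed.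

Lemma dbumpN (x : R) : dbump (- x) = - dbump x.
Proof.
have dN : is_derive x 1 (fun t : R => - t) (- 1).
  exact: is_deriveN.
have := @is_derive1_comp _ bump (fun t : R => - t) x _ _ (bump_is_derive _) dN.
have -> : bump \o (fun t : R => - t) = bump by apply/funext => t; exact: bumpN.
move=> /(@derive_val _ _ _ _ _ _ _); rewrite mulrN1 => dx.
by rewrite -[dbump x]/('D_1 bump x) dx opprK.
Qed.

(** The form in which the sum of the two gradients annihilates w (x - y): exchanging the two points
    changes the sign of the gradient. *)
Lemma dmollN i h : dmoll i (- h) = - dmoll i h.
Proof.
rewrite /dmoll mxE mulrN dbumpN mulrN mulNr; congr (- (_ * _)).
by apply: eq_bigr => j _; rewrite mxE mulrN bumpN.
Qed.

Lemma measurable_moll : measurable_fun setT moll.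
Proof.
apply: measurable_prod => i _.
apply: (@measurableT_comp _ _ _ _ _ _ bump).
  by apply: continuous_measurable_fun; exact/smooth_continuous/smooth_bump.
by apply: measurable_funM => //; exact: measurable_coord.
Qed.

Lemma measurable_dmoll i : measurable_fun setT (dmoll i).
Proof.
apply: measurable_funM.
  apply: measurable_funM => //; apply: (@measurableT_comp _ _ _ _ _ _ dbump).
    by apply: continuous_measurable_fun; exact: dbump_continuous.
  by apply: measurable_funM => //; exact: measurable_coord.
under eq_fun do rewrite big_mkcond/=.
apply: measurable_prod => j _; case: (j != i) => //.
apply: (@measurableT_comp _ _ _ _ _ _ bump).
  by apply: continuous_measurable_fun; exact/smooth_continuous/smooth_bump.
by apply: measurable_funM => //; exact: measurable_coord.
Qed.

Hypothesis e0 : 0 < e.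

Let e1 : 0 < e^-1. Proof. by rewrite invr_gt0. Qed.

Lemma scale_gt1 (x : R) : e < `|x| -> 1 < `|e^-1 * x|.
Proof. by move=> ex; rewrite normrM (gtr0_norm e1) ?invr_gt0// mulrC ltr_pdivlMr// mul1r. Qed.

Lemma moll_out h i : e < `|h ord0 i| -> moll h = 0.
Proof.
by move=> ei; rewrite /moll (bigD1 i)//= bump_out ?mul0r// ltW// scale_gt1.
Qed.

Lemma dmoll_out i h j : e < `|h ord0 j| -> dmoll i h = 0.
Proof.
move=> ej; rewrite /dmoll; have [<-|ij] := eqVneq j i.
  by rewrite dbump_out ?mulr0 ?mul0r// scale_gt1.
by rewrite (bigD1 j)//= bump_out ?mul0r ?mulr0// ltW// scale_gt1.
Qed.

Lemma moll_lower : exists2 c : R, 0 < c &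
  forall h, (forall i, `|h ord0 i| <= e / 2) -> c <= moll h.
Proof.
have [c c0 hc] := @bump_lower R.
exists (c ^+ d); first by rewrite exprn_gt0.
move=> h he; rewrite -[X in c ^+ X]card_ord -prodr_const.
apply: ler_prod => i _; rewrite ltW//= hc// normrM (gtr0_norm e1) ?invr_gt0//.
by rewrite ler_pdivrMl.
Qed.

Lemma enorm_coord h i : `|h ord0 i| <= enorm h.
Proof.
rewrite -sqrtr_sqr ler_wsqrtr// (bigD1 i)//= lerDl.
by apply: sumr_ge0 => j _; exact: sqr_ge0.
Qed.

Lemma enorm_ge0 h : 0 <= enorm h.
Proof. exact: sqrtr_ge0. Qed.

Lemma enormN h : enorm (- h) = enorm h.
Proof. by congr Num.sqrt; apply: eq_bigr => i _; rewrite mxE sqrrN. Qed.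

(* The bounds are stable under products, which reduces [moll] to [bump]. *)
Definition C11_bounded (f : 'rV[R]_d -> R) := exists2 B : R, 0 <= B & forall h z,
  [/\ `|f h| <= B, `|f (h + z) - f h| <= B * enorm z &
   `|f (h + z) + f (h - z) - 2 * f h| <= B * enorm z ^+ 2].

Lemma C11_bounded_mul f g : C11_bounded f -> C11_bounded g ->
  C11_bounded (fun h => f h * g h).
Proof.
move=> [B B0 hB] [C C0 hC]; exists (4 * (B * C)); first by rewrite !mulr_ge0.
move=> h z; have [f0 f1 f2] := hB h z; have [g0 g1 g2] := hC h z.
have [_ f1' _] := hB h (- z); have [_ g1' _] := hC h (- z).
have [fz _ _] := hB (h + z) 0; have [gz _ _] := hC (h + z) 0.
rewrite enormN in f1' g1'; have N0 := enorm_ge0 z.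
have BC0 : 0 <= B * C by rewrite mulr_ge0.
split.
- by rewrite normrM (le_trans (ler_pM _ _ f0 g0))//; lra.
- rewrite (_ : _ - _ = f (h + z) * (g (h + z) - g h) + g h * (f (h + z) - f h)); last by ring.
  rewrite (le_trans (ler_normD _ _))// !normrM.
  have := ler_pM (normr_ge0 _) (normr_ge0 _) fz g1.
  have := ler_pM (normr_ge0 _) (normr_ge0 _) g0 f1.
  have := mulr_ge0 BC0 N0.
  by lra.
(* Discrete Leibniz rule of order two: each factor times the second difference of the other, and for
   each sign of [z] a product of first differences. The four terms account for the constant 4. *)
- rewrite (_ : _ - _ = f h * (g (h + z) + g (h - z) - 2 * g h) +
    g h * (f (h + z) + f (h - z) - 2 * f h) +
    (f (h + z) - f h) * (g (h + z) - g h) +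
    (f (h - z) - f h) * (g (h - z) - g h)); last by ring.
  have n0 x : `|x| = `|x| :> R by [].
  rewrite (le_trans (ler_normD _ _))//.
  have := ler_normD (f h * (g (h + z) + g (h - z) - 2 * g h) +
    g h * (f (h + z) + f (h - z) - 2 * f h)) ((f (h + z) - f h) * (g (h + z) - g h)).
  have := ler_normD (f h * (g (h + z) + g (h - z) - 2 * g h))
    (g h * (f (h + z) + f (h - z) - 2 * f h)).
  have := ler_pM (normr_ge0 _) (normr_ge0 _) f0 g2.
  have := ler_pM (normr_ge0 _) (normr_ge0 _) g0 f2.
  have := ler_pM (normr_ge0 _) (normr_ge0 _) f1 g1.
  have := ler_pM (normr_ge0 _) (normr_ge0 _) f1' g1'.
  rewrite -!normrM expr2.
  have -> : B * enorm z * (C * enorm z) = B * C * (enorm z * enorm z) by ring.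
  have -> : C * (B * (enorm z * enorm z)) = B * C * (enorm z * enorm z) by ring.
  have -> : B * (C * (enorm z * enorm z)) = B * C * (enorm z * enorm z) by ring.
  have -> : 4 * (B * C) * (enorm z * enorm z) = 4 * (B * C * (enorm z * enorm z)) by ring.
  by lra.
Qed.

Lemma C11_bounded_moll : C11_bounded moll.
Proof.
have [B B0 hB] := @bump_bounds R.
have bound1 (i : 'I_d) : C11_bounded (fun h => bump (e^-1 * h ord0 i)).
  (* One constant for the three bounds, which bring in the powers 0, 1 and 2 of [e^-1]. *)
  exists (B * (1 + e^-1 ^+ 2 + e^-1)).
    apply: mulr_ge0; first exact: ltW.
    by have := sqr_ge0 e^-1; have := e1; lra.
  move=> h z; have [b0 _ b1 b2] := hB (e^-1 * h ord0 i) (e^-1 * z ord0 i).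
  have ei0 := e1.
  have zi : `|e^-1 * z ord0 i| <= e^-1 * enorm z.
    by rewrite normrM (gtr0_norm e1) ler_pM2l//; exact: enorm_coord.
  have e20 := sqr_ge0 e^-1; have N0 := enorm_ge0 z.
  have -> : e^-1 * (h + z) ord0 i = e^-1 * h ord0 i + e^-1 * z ord0 i.
    by rewrite mxE mulrDr.
  have -> : e^-1 * (h - z) ord0 i = e^-1 * h ord0 i - e^-1 * z ord0 i.
    by rewrite !mxE mulrBr.
  split.
  - rewrite (le_trans b0)// ler_peMr ?ltW//; lra.
  - rewrite (le_trans b1)// -mulrA ler_pM2l// (le_trans zi)//.
    by rewrite ler_wpM2r//; lra.
  - rewrite (le_trans b2)// -mulrA ler_pM2l//.
    rewrite (@le_trans _ _ ((e^-1 * enorm z) ^+ 2))//.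
      by rewrite lerXn2r// nnegrE mulr_ge0// ltW.
    by rewrite exprMn ler_wpM2r ?sqr_ge0//; lra.
rewrite /moll; elim: (index_enum _) => [|i s ih].
  exists 1 => // h z; rewrite !big_nil subrr normr0 normr1; split => //.
    by rewrite mul1r enorm_ge0.
  by rewrite (_ : 1 + 1 - 2 * 1 = 0) ?normr0 ?mul1r ?sqr_ge0//; ring.
rewrite (_ : (fun h => _) = fun h => bump (e^-1 * h ord0 i) *
    \prod_(j <- s) bump (e^-1 * h ord0 j)).
  exact: C11_bounded_mul.
by apply/funext => h; rewrite big_cons.
Qed.

Lemma dmoll_bound : exists2 B : R, 0 <= B & forall i h, `|dmoll i h| <= B.
Proof.
have [B B0 hB] := @bump_bounds R.
(* [1 + B] bounds every factor of the product over [j != i], including the value 1 that stands for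
   the omitted one. *)
exists (e^-1 * B * (1 + B) ^+ d).
  by rewrite !mulr_ge0 ?exprn_ge0 ?addr_ge0 ?invr_ge0 ?ltW.
move=> i h; rewrite /dmoll normrM ler_pM ?normr_ge0//.
  rewrite normrM (gtr0_norm e1) ?invr_gt0// (ler_pM2l e1)//.
  by have [] := hB (e^-1 * h ord0 i) 0.
rewrite normr_prod big_mkcond/= -[X in _ ^+ X]card_ord -prodr_const.
apply: ler_prod => j _; case: ifPn => _; last by rewrite ler01 lerDl ltW.
rewrite normr_ge0/=; have [+ _ _ _] := hB (e^-1 * h ord0 j) 0.
by move=> /le_trans; apply; rewrite lerDr.
Qed.

End mollifier.

(** * The test function of the doubling of variables *)

Section test_function.
Context {R : realType} {d : nat}.
Variables (e dl tau T : R).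
Hypotheses (e0 : 0 < e) (dl0 : 0 < dl).
Local Notation Z := ('rV[R]_d * R)%type.

Definition tbump (t : R) : R := bump (dl^-1 * (t - tau)).
Definition dtbump (t : R) : R := dl^-1 * dbump (dl^-1 * (t - tau)).

Definition testfun (q p : Z) : R := moll e (p.1 - q.1) * (tbump p.2 * tbump q.2).

Lemma tbump_ge0 t : 0 <= tbump t.
Proof. exact: bump_ge0. Qed.

Lemma tbump_out t : dl < `|t - tau| -> tbump t = 0.
Proof. by move=> h; apply: bump_out; rewrite ltW// scale_gt1. Qed.

Lemma dtbump_out t : dl < `|t - tau| -> dtbump t = 0.
Proof. by move=> h; rewrite /dtbump dbump_out ?mulr0// scale_gt1. Qed.

Lemma measurable_tbump : measurable_fun setT tbump.
Proof.
apply: (@measurableT_comp _ _ _ _ _ _ bump).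
  by apply: continuous_measurable_fun; exact/smooth_continuous/smooth_bump.
by apply: measurable_funM => //; apply: measurable_funB.
Qed.

Lemma measurable_dtbump : measurable_fun setT dtbump.
Proof.
apply: measurable_funM => //; apply: (@measurableT_comp _ _ _ _ _ _ dbump).
  by apply: continuous_measurable_fun; exact: dbump_continuous.
by apply: measurable_funM => //; apply: measurable_funB.
Qed.

Lemma testfun_ge0 q p : 0 <= testfun q p.
Proof. by apply: mulr_ge0; [exact: moll_ge0|apply: mulr_ge0; exact: tbump_ge0]. Qed.

Lemma smooth_testfun q : smooth (testfun q).
Proof.
apply: smooth_mul.
  apply: smooth_prod => i.
  rewrite (_ : (fun _ => _) = fun p : Z => bump (e^-1 * p.1 ord0 i + - (e^-1 * q.1 ord0 i))).
    apply: (@smooth_comp_affine _ _ bump (fun p : Z => e^-1 * p.1 ord0 i)).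
    - by move=> a u v; rewrite !mxE mulrDr /GRing.scale/= mulrCA.
    - move=> p; apply: (@continuousM R Z (cst e^-1) (fun p => p.1 ord0 i)); first exact: cst_continuous.
      apply: (@continuous_comp _ _ _ fst (fun x : 'rV[R]_d => x ord0 i)).
        exact: cvg_fst.
      exact: coord_continuous.
    - exact: smooth_bump.
  by apply/funext => p; rewrite !mxE mulrBr.
apply: smooth_mul; last by move=> k; exact: Ck_cst.
rewrite (_ : (fun _ => _) = fun p : Z => bump (dl^-1 * p.2 + - (dl^-1 * tau))).
  apply: (@smooth_comp_affine _ _ bump (fun p : Z => dl^-1 * p.2)).
  - by move=> a u v; rewrite mulrDr /GRing.scale/= mulrCA.
  - by move=> p; apply: (@continuousM R Z (cst dl^-1) snd); [exact: cst_continuous|exact: cvg_snd].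
  - exact: smooth_bump.
by apply/funext => p; rewrite /tbump mulrBr.
Qed.

Lemma Cc_infty_testfun q : dl < tau -> tau < T - dl ->
  Cc_infty (QT T) (testfun q).
Proof.
move=> dtau tauT.
pose K : set Z := [set x : 'rV[R]_d | forall i,
  `[(q.1 ord0 i - e), (q.1 ord0 i + e)]%classic (x ord0 i)] `*`
  `[(tau - dl), (tau + dl)]%classic.
have cK : compact K.
  apply: compact_setX; last exact: segment_compact.
  by apply: (@rV_compact R d (fun i => `[(q.1 ord0 i - e), (q.1 ord0 i + e)]%classic)) => i;
    exact: segment_compact.
have clK : closed K by apply: compact_closed.
have sK : [set p | testfun q p != 0] `<=` K.
  move=> [x t] /=; rewrite /testfun /= => n0; split => /=.
    move=> i; apply: contraNT n0 => n0; rewrite (@moll_out _ _ _ e0 _ i) ?mul0r//.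
    by rewrite !mxE ltNge ler_norml; apply: contra n0; rewrite in_itv/=; lra.
  apply: contraNT n0 => n0; rewrite (tbump_out (t := t)) ?mul0r ?mulr0//.
  by rewrite ltNge ler_norml; apply: contra n0; rewrite in_itv/=; lra.
have sclK : closure [set p | testfun q p != 0] `<=` K.
  by rewrite [X in _ `<=` X]((closure_id K).1 clK); exact: closure_subset.
split; first exact: smooth_testfun.
- exact: (subclosed_compact (@closed_closure _ _) cK).
- move=> p /sclK[_]; rewrite /QT/= !in_itv/= => /andP[? ?]; split => //=.
  by apply/andP; split; lra.
Qed.

Lemma dt_testfun q p :
  dt (testfun q) p = moll e (p.1 - q.1) * (dtbump p.2 * tbump q.2).
Proof.
rewrite /dt deriveE1.
pose C := moll e (p.1 - q.1) * tbump q.2.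
rewrite (_ : (fun h => _) = fun h : R => C * bump (dl^-1 * (h + (p.2 - tau)))).
  have dl' : is_derive (0 : R) 1 (fun h : R => dl^-1 * (h + (p.2 - tau))) dl^-1.
    have := is_deriveZ dl^-1 (is_deriveD (is_derive_id (0 : R) (1 : R)) (is_derive_cst (p.2 - tau) (0 : R) (1 : R))).
    by rewrite addr0 /GRing.scale/= mulr1.
  have db := @is_derive1_comp _ bump _ (0 : R) _ _ (bump_is_derive _) dl'.
  have := is_deriveZ C db => /(@derive_val _ _ _ _ _ _ _) /= ->.
  by rewrite /C /dtbump add0r /GRing.scale/=; ring.
apply/funext => h; have -> : h *: ((0 : 'rV[R]_d), (1 : R)) + p = (p.1, h + p.2).
  case: p @C => x t C; apply/pair_equal_spec; split => /=.
    by rewrite scaler0 add0r.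
  by rewrite [h *: _]mulr1.
by rewrite /testfun /C /tbump/= addrA; ring.
Qed.

Lemma gradx_testfun q p i :
  gradx (testfun q) p ord0 i = dmoll e i (p.1 - q.1) * (tbump p.2 * tbump q.2).
Proof.
rewrite mxE deriveE1.
pose C := \prod_(j < d | j != i) bump (e^-1 * (p.1 - q.1) ord0 j) *
  (tbump p.2 * tbump q.2).
rewrite (_ : (fun h => _) = fun h : R => C * bump (e^-1 * (h + (p.1 - q.1) ord0 i))).
  have dl' : is_derive (0 : R) 1 (fun h : R => e^-1 * (h + (p.1 - q.1) ord0 i)) e^-1.
    have := is_deriveZ e^-1 (is_deriveD (is_derive_id (0 : R) (1 : R)) (is_derive_cst ((p.1 - q.1) ord0 i) (0 : R) (1 : R))).
    by rewrite addr0 /GRing.scale/= mulr1.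
  have db := @is_derive1_comp _ bump _ (0 : R) _ _ (bump_is_derive _) dl'.
  have := is_deriveZ C db => /(@derive_val _ _ _ _ _ _ _) /= ->.
  by rewrite /C /dmoll add0r /GRing.scale/=; ring.
apply/funext => h.
have -> : h *: ((delta_mx ord0 i : 'rV[R]_d), (0 : R)) + p =
    (h *: delta_mx ord0 i + p.1, p.2).
  by case: p @C => x t C; apply/pair_equal_spec; split => //=; rewrite scaler0 add0r.
rewrite /testfun /C /moll (bigD1 i)//= !mxE !eqxx mulr1 -addrA.
rewrite (eq_bigr (fun j => bump (e^-1 * (p.1 - q.1) ord0 j))); first by ring.
by move=> j ji; rewrite !mxE (negbTE ji) mulr0 add0r.
Qed.

End test_function.

(** * Integrability of the Lévy kernel near and away from the origin *)

Section kernel.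
Context {R : realType} {d : nat}.
Variable lambda : R.
Hypothesis lambda0 : 0 < lambda.
Implicit Types z : 'rV[R]_d.

Definition levy_kernel z : R := (enorm z `^ (d%:R + lambda))^-1.

Lemma levy_kernel_ge0 z : 0 <= levy_kernel z.
Proof. by rewrite invr_ge0 powR_ge0. Qed.

Lemma levy_kernelN z : levy_kernel (- z) = levy_kernel z.
Proof. by rewrite /levy_kernel enormN. Qed.

Lemma measurable_enorm : measurable_fun setT (@enorm R d).
Proof.
have ms : measurable_fun setT (fun z : 'rV[R]_d => \sum_(i < d) z ord0 i ^+ 2).
  apply: measurable_sum => i.
  by apply: measurable_funX; exact: measurable_coord.
exact: (measurableT_comp (continuous_measurable_fun (@sqrt_continuous R)) ms).
Qed.

Lemma measurable_levy_kernel : measurable_fun setT levy_kernel.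
Proof.
rewrite (_ : levy_kernel = fun z => enorm z `^ (- (d%:R + lambda))); last first.
  by apply/funext => z; rewrite powRN.
apply: (@measurableT_comp _ _ _ _ _ _ (fun x : R => x `^ (- (d%:R + lambda)))).
  exact: measurable_powR.
exact: measurable_enorm.
Qed.

Lemma measurable_enorm_itv (i : interval R) : measurable [set z : 'rV[R]_d | enorm z \in i].
Proof. by have := measurable_enorm measurableT (measurable_itv i); rewrite setTI. Qed.

Lemma lebesgue_rV_enorm_le (s : R) : 0 <= s ->
  (lebesgue_rV d [set z : 'rV[R]_d | (enorm z \in `]-oo, s])%R] <= ((2 * s) ^+ d)%:E)%E.
Proof.
move=> s0.
have mb : measurable [set z : 'rV[R]_d | forall i, (`[- s, s]%classic : set R) (z ord0 i)].
  rewrite (_ : [set _ | _] = \bigcap_(i in [set: 'I_d])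
      ((fun z : 'rV[R]_d => z ord0 i) @^-1` `[- s, s]%classic)).
    apply: fin_bigcap_measurable => // i _.
    by rewrite -[X in measurable X]setTI; apply: measurable_coord.
  by apply/seteqP; split=> z /= Iz i; [move=> _|]; exact: Iz.
have -> : ((2 * s) ^+ d)%:E = lebesgue_rV d
    [set z : 'rV[R]_d | forall i, (`[- s, s]%classic : set R) (z ord0 i)].
  rewrite (@lebesgue_rV_box _ d (fun=> `[- s, s]%classic))//.
  rewrite (eq_bigr (fun=> (2 * s)%:E)).
    by rewrite prodEFin prodr_const card_ord.
  move=> i _; rewrite lebesgue_measure_itv/= lte_fin.
  case: ltP => ss; first by rewrite -EFinB; congr EFin; ring.
  by congr EFin; lra.
apply: le_measure; rewrite ?inE//; first exact: measurable_enorm_itv.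
move=> z /=; rewrite in_itv/= => zs i; rewrite in_itv/= -ler_norml.
exact: le_trans (enorm_coord z i) zs.
Qed.

(** On the annulus the integrand is at most (2s)^m s^(-d-lambda), and the annulus lies in a cube of
    side 4s. *)
Lemma annulus_le (m : nat) (s : R) : 0 < s ->
  (\int[lebesgue_rV d]_(z in [set z | (enorm z \in `[s, (2 * s)])%R])
     (enorm z ^+ m * levy_kernel z)%:E <= (4 ^+ d * 2 ^+ m * s `^ (m%:R - lambda))%:E)%E.
Proof.
move=> s0; have mA := measurable_enorm_itv `[s, (2 * s)].
apply: (@le_trans _ _ (\int[lebesgue_rV d]_(z in [set z | (enorm z \in `[s, (2 * s)])%R])
     (cst ((2 * s) ^+ m / s `^ (d%:R + lambda))%:E z)))%E.
  apply: ge0_le_integral => //.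
  - by move=> z _; rewrite lee_fin mulr_ge0 ?exprn_ge0 ?enorm_ge0 ?levy_kernel_ge0.
  - apply: measurable_funTS; apply/measurable_EFinP; apply: measurable_funM.
      apply: (@measurableT_comp _ _ _ _ _ _ (fun x : R => x ^+ m)) => //.
      exact: measurable_enorm.
    exact: measurable_levy_kernel.
  - move=> z /=; rewrite in_itv/= => /andP[z1 z2]; rewrite lee_fin.
    have z0 : 0 < enorm z by exact: lt_le_trans z1.
    apply: ler_pM; rewrite ?exprn_ge0 ?enorm_ge0 ?levy_kernel_ge0//.
      by rewrite lerXn2r// nnegrE ?ltW//; lra.
    rewrite lef_pV2 ?posrE ?powR_gt0//.
    have p0 : 0 <= d%:R + lambda by rewrite addr_ge0// ltW.
    by apply: (ge0_ler_powR p0); rewrite ?nnegrE ?enorm_ge0// ltW.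
rewrite integral_cst//.
apply: (@le_trans _ _ (((2 * s) ^+ m / s `^ (d%:R + lambda))%:E * ((2 * (2 * s)) ^+ d)%:E)%E).
  rewrite lee_pmul2l ?lte_fin ?divr_gt0 ?exprn_gt0 ?powR_gt0 ?mulr_gt0//.
  apply: le_trans (lebesgue_rV_enorm_le _); last by lra.
  apply: le_measure; rewrite ?inE//; first exact: measurable_enorm_itv.
  by move=> z /=; rewrite !in_itv/= => /andP[].
rewrite -EFinM lee_fin powRD ?(gt_eqF s0) ?implybT//.
rewrite [s `^ (m%:R - _)]powRD ?(gt_eqF s0) ?implybT// powRN !powR_mulrn ?(ltW s0)// invfM.
rewrite le_eqVlt; apply/orP; left; apply/eqP.
rewrite !exprMn (_ : (4 : R) = 2 * 2) ?exprMn; last by ring.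
have sd : s ^+ d != 0 by rewrite expf_neq0// gt_eqF.
have sl : s `^ lambda != 0 by rewrite gt_eqF// powR_gt0.
by field; rewrite sd sl.
Qed.

(** The bounds of [annulus_le] form a geometric series of ratio q^(m-lambda). With m = 0 and q = 2
    it converges because lambda > 0 and gives the tail; with m = 2 and q = 1/2 it converges because
    lambda < 2 and gives the core. *)
Lemma dyadic_annuli_le (m : nat) (a q : R) : 0 < a -> 0 < q ->
  q `^ (m%:R - lambda) < 1 ->
  (\int[lebesgue_rV d]_(z in \bigcup_k [set z | (enorm z \in `[(a * q ^+ k), (2 * (a * q ^+ k))])%R])
     (enorm z ^+ m * levy_kernel z)%:E < +oo)%E.
Proof.
move=> a0 q0 q1.
pose A k := [set z : 'rV[R]_d | enorm z \in `[(a * q ^+ k), (2 * (a * q ^+ k))]].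
pose f z := (enorm z ^+ m * levy_kernel z)%:E.
have mA k : measurable (A k) := measurable_enorm_itv _.
have mf : measurable_fun setT f.
  apply/measurable_EFinP; apply: measurable_funM.
    apply: (@measurableT_comp _ _ _ _ _ _ (fun x : R => x ^+ m)) => //.
    exact: measurable_enorm.
  exact: measurable_levy_kernel.
have f0 z : (0 <= f z)%E.
  by rewrite lee_fin mulr_ge0 ?exprn_ge0 ?enorm_ge0 ?levy_kernel_ge0.
have mfA k : measurable_fun setT (f \_ (A k)).
  by apply/(measurable_restrictT _ _).1 => //; exact: measurable_funTS.
have fA0 k z : (0 <= (f \_ (A k)) z)%E by exact: erestrict_ge0.
apply: (@le_lt_trans _ _ (\int[lebesgue_rV d]_z (\sum_(k <oo) (f \_ (A k)) z)))%E.
  rewrite integral_mkcond; apply: ge0_le_integral => //.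
  - by move=> z _; apply: erestrict_ge0 => ? _; exact: f0.
  - apply/(measurable_restrictT _ _).1; last exact: measurable_funTS.
    exact: (bigcup_measurable (fun k _ => mA k)).
  - by apply: ge0_emeasurable_sum => [k x _ _|k _]; [exact: fA0|exact: mfA].
  - move=> z _; rewrite {1}/patch; case: ifPn => [|_]; last exact: nneseries_ge0.
    rewrite inE => -[k _ zk].
    apply: le_trans (nneseries_lim_ge k.+1 _) => //.
    rewrite [leLHS](_ : _ = (f \_ (A k)) z); last by rewrite /patch ifT// inE.
    by rewrite big_nat_recr//= leeDr// sume_ge0.
rewrite integral_nneseries//.
set C := 4 ^+ d * 2 ^+ m * a `^ (m%:R - lambda).
have C0 : 0 <= C by rewrite !mulr_ge0 ?exprn_ge0 ?powR_ge0.
set x := q `^ (m%:R - lambda) in q1.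
have x0 : 0 < x by rewrite powR_gt0.
apply: (@le_lt_trans _ _ (C / (1 - x))%:E); last exact: ltry.
apply: lime_le; first by apply: is_cvg_nneseries => k _ _; exact: integral_ge0.
apply: nearW => n; apply: (@le_trans _ _ (\sum_(0 <= k < n) (C * x ^+ k)%:E)%E).
  apply: lee_sum => k _; rewrite -integral_mkcond.
  apply: (le_trans (annulus_le m _)); first by rewrite mulr_gt0// exprn_gt0.
  rewrite lee_fin /C powRM ?exprn_ge0 ?(ltW a0) ?(ltW q0)// -!mulrA.
  do 3 (rewrite ler_wpM2l ?exprn_ge0 ?powR_ge0//).
  by rewrite -powR_mulrn ?(ltW q0)// -powRrM mulrC powRrM powR_mulrn ?powR_ge0.
rewrite sumEFin lee_fin; apply: geometric_le_lim => //.
by rewrite gtr0_norm.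
Qed.

(** The least [k] with x <= 2 * 2^k; its minimality gives the lower bound. *)
Lemma dyadic_bound (x : R) : 1 < x -> exists k, 2 ^+ k <= x <= 2 * 2 ^+ k.
Proof.
move=> x1; have ex : exists k, x <= 2 * 2 ^+ k.
  exists (Num.bound x); rewrite -exprS.
  apply: (@le_trans _ _ (Num.bound x)%:R); first exact/ltW/archi_boundP/ltW/(lt_trans ltr01).
  rewrite -natrX ler_nat; apply: ltnW; apply: (ltn_trans (ltnSn _)).
  exact: ltn_expl.
have [[|k] hk kmin] := ex_minnP ex; first by exists 0%N; rewrite expr0 (ltW x1) -(expr0 2).
exists k.+1; rewrite hk andbT exprS leNgt; apply/negP => /ltW /kmin.
by rewrite ltnn.
Qed.

Lemma levy_kernel_tail (r : R) : 0 < r ->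
  (\int[lebesgue_rV d]_(z in [set z | (r < enorm z)%R]) (levy_kernel z)%:E < +oo)%E.
Proof.
move=> r0.
have q1 : (2 : R) `^ (0%:R - lambda) < 1.
  rewrite sub0r powRN invf_lt1 ?powR_gt0//.
  have := @gt0_ltr_powR _ _ lambda0 1 2; rewrite powR1 !nnegrE; apply; lra.
apply: le_lt_trans (@dyadic_annuli_le 0 r 2 r0 (ltr0n _ 2) q1).
have mr : measurable [set z : 'rV[R]_d | r < enorm z].
  have := measurable_enorm_itv `]r, +oo[; congr measurable.
  by apply/seteqP; split => z /=; rewrite in_itv/= andbT.
under [leRHS]eq_integral do rewrite expr0 mul1r.
apply: ge0_subset_integral => //.
- by apply: bigcup_measurable => k _; exact: measurable_enorm_itv.
- by apply: measurable_funTS; apply/measurable_EFinP; exact: measurable_levy_kernel.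
- by move=> z _; rewrite lee_fin levy_kernel_ge0.
move=> z /= rz; have [|k /andP[k1 k2]] := @dyadic_bound (enorm z / r).
  by rewrite ltr_pdivlMr// mul1r.
exists k => //=; rewrite in_itv/=; apply/andP; split.
  by rewrite mulrC -ler_pdivlMr.
by move: k2; rewrite ler_pdivrMr// => /le_trans; apply; rewrite mulrAC -mulrA.
Qed.

Lemma levy_kernel_core : lambda < 2 ->
  (\int[lebesgue_rV d]_(z in [set z | (0 < enorm z < 1)%R])
    (enorm z ^+ 2 * levy_kernel z)%:E < +oo)%E.
Proof.
move=> l2.
have h0 : 0 < 2^-1 :> R by rewrite invr_gt0.
have q1 : (2^-1 : R) `^ (2%:R - lambda) < 1.
  have l2' : 0 < 2%:R - lambda by rewrite subr_gt0.
  by have := @gt0_ltr_powR _ _ l2' 2^-1 1; rewrite powR1 !nnegrE; apply; lra.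
apply: le_lt_trans (@dyadic_annuli_le 2 2^-1 2^-1 h0 h0 q1).
have mr : measurable [set z : 'rV[R]_d | 0 < enorm z < 1].
  exact: (measurable_enorm_itv `]0, 1[).
apply: ge0_subset_integral => //.
- by apply: bigcup_measurable => k _; exact: measurable_enorm_itv.
- apply: measurable_funTS; apply/measurable_EFinP; apply: measurable_funM.
    by apply: measurable_funX; exact: measurable_enorm.
  exact: measurable_levy_kernel.
- by move=> z _; rewrite lee_fin mulr_ge0 ?exprn_ge0 ?enorm_ge0 ?levy_kernel_ge0.
move=> z /= /andP[z0 z1]; have [|k /andP[k1 k2]] := @dyadic_bound (enorm z)^-1.
  by rewrite invf_gt1.
exists k => //=; rewrite in_itv/= mulrA divff ?mul1r; last by rewrite pnatr_eq0.
have k0 : 0 < 2 ^+ k :> R by rewrite exprn_gt0.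
apply/andP; split.
  by rewrite exprVn -invfM -[leRHS]invrK lef_pV2// posrE ?invr_gt0// mulr_gt0.
by rewrite exprVn -[leLHS]invrK lef_pV2// posrE ?invr_gt0.
Qed.

(** The balls of radius 1/(k+1) without the origin decrease to the empty set, and dominated
    convergence applies. This is what makes the small jumps disappear with [r]. *)
Lemma levy_kernel_core_small : lambda < 2 -> forall eta : R, 0 < eta ->
  exists2 r : R, 0 < r <= 1 &
  (\int[lebesgue_rV d]_(z in [set z | (0 < enorm z < r)%R])
    (enorm z ^+ 2 * levy_kernel z)%:E <= eta%:E)%E.
Proof.
move=> l2 eta eta0.
pose f z := (enorm z ^+ 2 * levy_kernel z)%:E.
pose D (k : nat) := [set z : 'rV[R]_d | 0 < enorm z < k.+1%:R^-1].
have mD k : measurable (D k) := measurable_enorm_itv `]0, k.+1%:R^-1[.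
have mf : measurable_fun setT f.
  apply/measurable_EFinP; apply: measurable_funM; last exact: measurable_levy_kernel.
  by apply: measurable_funX; exact: measurable_enorm.
have f0 z : (0 <= f z)%E.
  by rewrite lee_fin mulr_ge0 ?exprn_ge0 ?enorm_ge0 ?levy_kernel_ge0.
have mfD k : measurable_fun setT (f \_ (D k)).
  by apply/(measurable_restrictT _ _).1 => //; exact: measurable_funTS.
have D0 : D 0%N = [set z | 0 < enorm z < 1].
  by apply/seteqP; split => z; rewrite /D/= invr1.
have [] := @dominated_convergence _ _ _ (lebesgue_rV d) setT measurableT
   (fun k => f \_ (D k)) (cst 0%E) (f \_ (D 0%N)).
- exact: mfD.
- by [].
- apply: aeW => z _; apply: cvg_near_cst.
  have [z0|z0] := leP (enorm z) 0.
    by apply: nearW => k; rewrite /patch memNset//= => /andP[]; rewrite ltNge z0.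
  have := near_infty_natSinv_lt (PosNum z0); apply: filterS => k /= kz.
  by rewrite /patch memNset//= => /andP[_]; rewrite ltNge ltW.
- apply/integrableP; split => //.
  under eq_integral do rewrite gee0_abs ?erestrict_ge0//.
  by rewrite -integral_mkcond D0; exact: levy_kernel_core.
- apply: aeW => z k _; rewrite gee0_abs ?erestrict_ge0// /patch.
  case: ifPn => [|_]; last by case: ifPn.
  rewrite inE/= => /andP[z0 zk]; rewrite ifT// inE/=; apply/andP; split => //.
  by rewrite (lt_le_trans zk)// invr1 invf_le1// ler1n.
rewrite integral_cst// mul0e => _ _ /cvge0_near/(_ _ eta0).
move=> [k _ /(_ k (leqnn _))/=]; rewrite -integral_mkcond => hk.
by exists k.+1%:R^-1; rewrite // invr_gt0 ltr0n/= invf_le1// ler1n.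
Qed.

End kernel.

(** * Integrals depending on a parameter *)

Section parametrized.
Context {R : realType} d1 d2 (X : measurableType d1) (Y : measurableType d2).
Context (m2 : {sigma_finite_measure set Y -> \bar R}).

(** Tonelli applies to the positive and the negative part, and [fine] is measurable; parameters at
    which the integral diverges are covered by its default value. *)
Lemma measurable_Rintegral_param (f : X * Y -> R) : measurable_fun setT f ->
  measurable_fun setT (fun x => \int[m2]_y f (x, y)).
Proof.
move=> mf; have mEf : measurable_fun setT (EFin \o f) by exact/measurable_EFinP.
rewrite (_ : (fun _ => _) = fun x => fine
    (\int[m2]_y ((EFin \o f)^\+%E (x, y)) - \int[m2]_y ((EFin \o f)^\-%E (x, y)))%E).
  apply: measurableT_comp; first exact: fine_measurable.
  apply: emeasurable_funB.
    by apply: measurable_int1 => //; exact: measurable_funepos.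
  by apply: measurable_int1 => //; exact: measurable_funeneg.
apply/funext => x; rewrite /Rintegral; congr fine; rewrite [LHS]integralE.
by congr (_ - _)%E; apply: eq_integral => y _; rewrite ?funeposE ?funenegE.
Qed.

Lemma preserving_integral (s : Y -> Y) (f : Y -> \bar R) :
  preserving m2 s -> measurable_fun setT f ->
  (\int[m2]_y f (s y) = \int[m2]_y f y)%E.
Proof.
move=> [ms ps] mf; rewrite integralE [RHS]integralE.
have sp : (fun y => f (s y))^\+%E = (fun y => f^\+%E (s y)).
  by apply/funext => y; rewrite !funeposE.
have sn : (fun y => f (s y))^\-%E = (fun y => f^\-%E (s y)).
  by apply/funext => y; rewrite !funenegE.
by rewrite sp sn (ps f^\+%E)// ?(ps f^\-%E)//; [exact: measurable_funeneg|exact: measurable_funepos].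
Qed.

End parametrized.

(** * The principal value as an absolutely convergent integral *)

Section small_jumps.
Context {R : realType} {d : nat}.
Variable lambda : R.
Hypotheses (lambda0 : 0 < lambda) (lambda2 : lambda < 2).
Local Notation kern := (@levy_kernel R d lambda).
Local Notation leb := (@lebesgue_rV R d).
Local Notation mass := (fun z : 'rV[R]_d => enorm z ^+ 2 * kern z)%R.

(** The average of the Lévy integrand over [z] and [-z]. The gradient term cancels, so for a C^{1,1}
    function it is bounded by a multiple of |z|^(2-d-lambda), which is integrable near 0. *)
Definition sdiff (psi : 'rV[R]_d -> R) (x z : 'rV[R]_d) : R :=
  2^-1 * (psi (x + z) + psi (x - z) - 2 * psi x) * kern z.

Definition small_jumps (r : R) (psi : 'rV[R]_d -> R) (x : 'rV[R]_d) : R :=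
  \int[leb]_(z in [set z | 0 < enorm z < r]) sdiff psi x z.

Definition small_mass (r : R) : R :=
  \int[leb]_(z in [set z | 0 < enorm z < r]) (enorm z ^+ 2 * kern z).

Let measurable_ball (a r : R) : measurable [set z : 'rV[R]_d | a < enorm z < r].
Proof. exact: (measurable_enorm_itv `]a, r[). Qed.

Let measurable_mass : measurable_fun setT (fun z : 'rV[R]_d => enorm z ^+ 2 * kern z).
Proof.
apply: measurable_funM; last exact: measurable_levy_kernel.
by apply: measurable_funX; exact: measurable_enorm.
Qed.

Let mass_ge0 z : 0 <= enorm z ^+ 2 * kern z.
Proof. by rewrite mulr_ge0 ?exprn_ge0 ?enorm_ge0 ?levy_kernel_ge0. Qed.

Lemma integrable_mass (r : R) : r <= 1 ->
  leb.-integrable [set z | 0 < enorm z < r] (EFin \o (fun z => enorm z ^+ 2 * kern z)).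
Proof.
move=> r1; apply: (@integrableS _ _ _ _ [set z | 0 < enorm z < 1]) => //.
  by move=> z /= /andP[-> /lt_le_trans]; exact.
apply/integrableP; split; first exact/measurable_funTS/measurable_EFinP.
under eq_integral do rewrite gee0_abs ?lee_fin//.
exact: levy_kernel_core.
Qed.

(** Reflection preserves the measure and [D], so [L] and its reflection have the same integral. *)
Lemma Rintegral_symmetrize (D : set 'rV[R]_d) (L : 'rV[R]_d -> R) :
  measurable D -> (forall z, D (- z) = D z) ->
  leb.-integrable D (EFin \o L) ->
  leb.-integrable D (EFin \o (fun z : 'rV[R]_d => L (- z))) ->
  \int[leb]_(z in D) L z = \int[leb]_(z in D) (2^-1 * (L z + L (- z))).
Proof.
move=> mD DN iL iLN.
have LNE : (\int[leb]_(z in D) (L (- z))%:E = \int[leb]_(z in D) (L z)%:E)%E.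
  rewrite [LHS]integral_mkcond [RHS]integral_mkcond.
  rewrite -[RHS](preserving_integral (@preserving_oprV R d)).
    apply: eq_integral => z _; rewrite /patch.
    by have -> : (- z \in D) = (z \in D) by apply/idP/idP; rewrite !inE DN.
  by apply/(measurable_restrictT _ _).1 => //; exact: measurable_int iL.
rewrite RintegralZl//; last exact: (integrableD mD iL iLN).
have LN : \int[leb]_(z in D) L (- z) = \int[leb]_(z in D) L z := congr1 fine LNE.
by rewrite RintegralD// LN; lra.
Qed.

Variable psi : 'rV[R]_d -> R.
Hypothesis mpsi : measurable_fun setT psi.
Variable B : R.
Hypothesis psiB : forall h z, [/\ `|psi h| <= B, `|psi (h + z) - psi h| <= B * enorm z &
   `|psi (h + z) + psi (h - z) - 2 * psi h| <= B * enorm z ^+ 2].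

Let B0 : 0 <= B.
Proof. by have [+ _ _] := psiB 0 0; exact: le_trans. Qed.

Lemma measurable_shift (x : 'rV[R]_d) : measurable_fun setT (fun z => psi (x + z)).
Proof.
rewrite (_ : (fun z => _) = fun z => psi (z + x)).
  exact: measurableT_comp mpsi (measurable_addrV x).
by apply/funext => z; rewrite addrC.
Qed.

Lemma measurable_sdiff x : measurable_fun setT (sdiff psi x).
Proof.
apply: measurable_funM; last exact: measurable_levy_kernel.
apply: measurable_funM => //; apply: measurable_funB => //.
apply: measurable_funD; first exact: measurable_shift.
exact: (measurableT_comp (measurable_shift x) (@measurable_oprV _ _)).
Qed.

Lemma sdiff_le x z : `|sdiff psi x z| <= B * (enorm z ^+ 2 * kern z).
Proof.
rewrite /sdiff normrM (ger0_norm (levy_kernel_ge0 _ _)) mulrA.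
rewrite ler_wpM2r ?levy_kernel_ge0// normrM ger0_norm ?invr_ge0//.
have [_ _ h] := psiB x z; have := normr_ge0 (psi (x + z) + psi (x - z) - 2 * psi x).
by lra.
Qed.

Lemma integrable_sdiff x (r : R) : r <= 1 ->
  leb.-integrable [set z | 0 < enorm z < r] (EFin \o sdiff psi x).
Proof.
move=> r1; apply: (@le_integrable _ _ _ _ _ _ _
  (fun z => (B * (enorm z ^+ 2 * kern z))%:E)) => //.
- by apply: measurable_funTS; apply/measurable_EFinP; exact: measurable_sdiff.
- move=> z _ /=; rewrite lee_fin (le_trans (sdiff_le x z))//.
  exact: ler_norm.
- rewrite (_ : (fun _ => _) = fun z => B%:E * (EFin \o mass) z)%E//.
  by apply: integrableZl => //; exact: integrable_mass.
Qed.

Lemma small_jumps_le x (r : R) : r <= 1 ->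
  `|small_jumps r psi x| <= B * small_mass r.
Proof.
move=> r1; apply: (le_trans (le_normr_Rintegral _ (integrable_sdiff x r1))) => //.
rewrite /small_mass -RintegralZl//; last exact: integrable_mass.
apply: le_Rintegral => //.
- by apply: integrable_abse (integrable_sdiff x r1).
- rewrite (_ : (EFin \o _) = fun z => B%:E * (EFin \o mass) z)%E//.
  by apply: integrableZl => //; exact: integrable_mass.
- by move=> z _; exact: sdiff_le.
Qed.

(** Beyond radius [b] the integrand and its reflection are each at most [2 * B] times the integrable
    kernel; this is why the symmetrisation is done before [b] tends to 0. *)
Lemma levy_symmetrize x (b r : R) : 0 < b ->
  \int[leb]_(z in [set z | b < enorm z < r]) levy_integrand lambda psi x z =
  \int[leb]_(z in [set z | b < enorm z < r]) sdiff psi x z.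
Proof.
move=> b0; pose D := [set z : 'rV[R]_d | b < enorm z < r].
pose L z := levy_integrand lambda psi x z.
have mL : measurable_fun setT L.
  apply: measurable_funM; last exact: measurable_levy_kernel.
  by apply: measurable_funB => //; exact: measurable_shift.
have mLN : measurable_fun setT (fun z : 'rV[R]_d => L (- z)).
  exact: (measurableT_comp mL (@measurable_oprV _ _)).
have ik : leb.-integrable D (EFin \o kern).
  apply: (@integrableS _ _ _ _ [set z | b < enorm z]) => //.
  - have := @measurable_enorm_itv R d `]b, +oo[; congr measurable.
    by apply/seteqP; split => z /=; rewrite in_itv/= andbT.
  - exact: measurable_ball.
  - by move=> z /= /andP[].
  apply/integrableP; split.
    by apply/measurable_funTS/measurable_EFinP; exact: measurable_levy_kernel.
  under eq_integral do rewrite gee0_abs ?lee_fin ?levy_kernel_ge0//.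
  exact: levy_kernel_tail.
have mD : measurable D by exact: measurable_ball.
have iB (y : 'rV[R]_d -> R) : (forall z, `|y z| <= 2 * B * kern z) -> measurable_fun setT y ->
    leb.-integrable D (EFin \o y).
  move=> yB my; apply: (@le_integrable _ _ _ _ _ _ _ (fun z => (2 * B * kern z)%:E)) => //.
  - exact/measurable_funTS/measurable_EFinP.
  - by move=> z _ /=; rewrite lee_fin (le_trans (yB z))// ler_norm.
  - rewrite (_ : (fun _ => _) = fun z => (2 * B)%:E * (EFin \o kern) z)%E//.
    exact: integrableZl.
have LB z : `|L z| <= 2 * B * kern z.
  rewrite /L /levy_integrand -/(kern z) normrM (ger0_norm (levy_kernel_ge0 _ _)).
  rewrite ler_wpM2r ?levy_kernel_ge0// (le_trans (ler_normB _ _))//.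
  by have [h1 _ _] := psiB (x + z) 0; have [h2 _ _] := psiB x 0; lra.
have iL : leb.-integrable D (EFin \o L) by exact: iB.
have iLN : leb.-integrable D (EFin \o (fun z : 'rV[R]_d => L (- z))).
  by apply: iB mLN => z; rewrite -levy_kernelN; exact: LB.
rewrite (Rintegral_symmetrize mD _ iL iLN); last first.
  by move=> z; rewrite /D/= enormN.
apply: eq_Rintegral => z _; rewrite /L /levy_integrand -/(kern z) enormN -/(kern z) /sdiff.
ring.
Qed.

(** Dominated convergence, the majorant being the modulus of the integrand on the whole punctured
    ball. It shows that the limit in the principal value exists. *)
Lemma small_jumps_cvg x (r : R) : 0 < r <= 1 ->
  \int[leb]_(z in [set z | b < enorm z < r]) sdiff psi x z @[b --> 0^'+] -->
  small_jumps r psi x.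
Proof.
move=> /andP[r0 r1]; apply/cvg_at_rightP => b [b0 cb].
have iD := integrable_sdiff x r1.
have ms : measurable_fun setT (EFin \o sdiff psi x).
  by apply/measurable_EFinP; exact: measurable_sdiff.
have [] := @dominated_convergence _ _ _ leb setT measurableT
   (fun n => (EFin \o sdiff psi x) \_ [set z | b n < enorm z < r])
   ((EFin \o sdiff psi x) \_ [set z | 0 < enorm z < r])
   (abse \o ((EFin \o sdiff psi x) \_ [set z | 0 < enorm z < r])).
- move=> n; apply/(measurable_restrictT _ _).1; first exact: measurable_ball.
  exact: measurable_funTS.
- apply/(measurable_restrictT _ _).1; first exact: measurable_ball.
  exact: measurable_funTS.
- apply: aeW => z _; apply: cvg_near_cst; rewrite /patch.
  have [z0|z0] := leP (enorm z) 0.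
    apply: nearW => n; rewrite !memNset//= => /andP[+ _]; first by rewrite ltNge z0.
    by move/(lt_trans (b0 n)); rewrite ltNge z0.
  have : \forall n \near \oo, b n < enorm z by exact: (cvgr_lt _ cb).
  apply: filterS => n bz; congr (if _ then _ else _).
  by apply/idP/idP; rewrite !inE/= => /andP[_ ->]; rewrite ?bz ?z0.
- apply: integrable_abse; exact: ((integrable_mkcond _ (measurable_ball 0 r)).1 iD).
- apply: aeW => z n _ /=; rewrite /patch; case: ifPn => [|_]; last first.
    by rewrite abse0 abse_ge0.
  by rewrite inE/= => /andP[bz zr]; rewrite ifT// inE/= zr (lt_trans (b0 n) bz).
move=> _ _ H; rewrite /small_jumps /Rintegral; apply: fine_cvg; rewrite fineK.
  by under eq_fun do rewrite integral_mkcond; rewrite integral_mkcond.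
exact: integrable_fin_num.
Qed.

Lemma g_smallE (c r : R) x : 0 < r <= 1 ->
  g_small c lambda r psi x = c * small_jumps r psi x.
Proof.
move=> r01; rewrite /g_small; congr (_ * _); apply: cvg_lim => //.
have H := @small_jumps_cvg x r r01; apply: cvg_trans; last exact: H.
apply: near_eq_cvg.
near=> b; apply/esym/levy_symmetrize.
by [].
Unshelve. all: by end_near.
Qed.

End small_jumps.

(** * Small jumps of the mollifier and of the test function *)

Section moll_small_jumps.
Context {R : realType} {d : nat}.
Variables (lambda e : R).
Hypotheses (lambda0 : 0 < lambda) (lambda2 : lambda < 2) (e0 : 0 < e).
Local Notation leb := (@lebesgue_rV R d).

Lemma measurable_addrV2 d' (X : measurableType d') (f g : X -> 'rV[R]_d) :
  measurable_fun setT f -> measurable_fun setT g ->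
  measurable_fun setT (fun x => f x + g x).
Proof.
move=> mf mg; apply/measurable_fun_rVP => i.
under eq_fun do rewrite mxE.
by apply: measurable_funD; [move: mf|move: mg] => /measurable_fun_rVP.
Qed.

Lemma measurable_subrV2 d' (X : measurableType d') (f g : X -> 'rV[R]_d) :
  measurable_fun setT f -> measurable_fun setT g ->
  measurable_fun setT (fun x => f x - g x).
Proof.
move=> mf mg; apply: measurable_addrV2 => //.
exact: measurableT_comp (@measurable_oprV _ _) mg.
Qed.

Lemma measurable_small_jumps (psi : 'rV[R]_d -> R) (r : R) :
  measurable_fun setT psi -> measurable_fun setT (small_jumps lambda r psi).
Proof.
move=> mpsi.
have mD : measurable [set z : 'rV[R]_d | 0 < enorm z < r].
  exact: (measurable_enorm_itv `]0, r[).
rewrite (_ : small_jumps _ _ _ = fun x => \int[leb]_z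
    (sdiff lambda psi x z * \1_[set z : 'rV[R]_d | 0 < enorm z < r] z)).
  apply: (@measurable_Rintegral_param R _ _ _ _ leb (fun p => sdiff lambda psi p.1 p.2 *
    \1_[set z : 'rV[R]_d | 0 < enorm z < r] p.2)).
  apply: measurable_funM; last first.
    exact: (measurableT_comp (measurable_indic mD) measurable_snd).
  apply: measurable_funM; last first.
    exact: (measurableT_comp (measurable_levy_kernel lambda) measurable_snd).
  apply: measurable_funM => //; apply: measurable_funB.
    apply: measurable_funD; apply: (measurableT_comp mpsi).
      exact: measurable_addrV2.
    exact: measurable_subrV2.
  by apply: measurable_funM => //; exact: (measurableT_comp mpsi measurable_fst).
apply/funext => x; rewrite /small_jumps Rintegral_mkcond; apply: eq_Rintegral => z _.
by rewrite /patch indicE; case: ifPn => _; rewrite ?mulr1 ?mulr0.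
Qed.

(** A jump shorter than [r] starting outside the cube of half-side [e + r] cannot reach the support
    of [moll e]. *)
Lemma small_jumps_moll_out (r : R) (h : 'rV[R]_d) i : e + r < `|h ord0 i| ->
  small_jumps lambda r (moll e) h = 0.
Proof.
move=> hi.
have out (z : 'rV[R]_d) : enorm z < r -> moll e (h + z) = 0.
  move=> zr; apply: (@moll_out _ _ e e0 _ i); rewrite mxE.
  have := enorm_coord z i; have := lerB_normD (h ord0 i) (z ord0 i); lra.
transitivity (\int[leb]_(z in [set z | 0 < enorm z < r]) (0 : R)); last first.
  by rewrite /Rintegral integral0.
apply: eq_Rintegral => z; rewrite inE/= => /andP[z0 zr].
rewrite /sdiff (out z zr) (out (- z)) ?enormN// (@moll_out _ _ e e0 h i).
  by rewrite mulr0 subr0 addr0 mulr0 mul0r.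
by have := enorm_coord z i; lra.
Qed.

Lemma small_jumps_translate (r K : R) (y x : 'rV[R]_d) : r <= 1 ->
  small_jumps lambda r (fun x => moll e (x - y) * K) x =
  small_jumps lambda r (moll e) (x - y) * K.
Proof.
move=> r1; have [B B0 hB] := @C11_bounded_moll R d e e0.
have mD : measurable [set z : 'rV[R]_d | 0 < enorm z < r].
  exact: (measurable_enorm_itv `]0, r[).
rewrite mulrC /small_jumps -RintegralZl//; last first.
  exact: (integrable_sdiff lambda0 lambda2 (measurable_moll e) hB _ r1).
apply: eq_Rintegral => z _; rewrite /sdiff.
by rewrite (addrAC x z) (addrAC x (- z)); ring.
Qed.

Lemma C11_bounded_translate (K : R) (y : 'rV[R]_d) :
  C11_bounded (fun x => moll e (x - y) * K).
Proof.
have [B B0 hB] := @C11_bounded_moll R d e e0.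
exists (B * `|K|); first by rewrite mulr_ge0.
move=> h z; have [h1 h2 h3] := hB (h - y) z.
rewrite (addrAC h z) (addrAC h (- z)); split.
- by rewrite normrM ler_wpM2r.
- by rewrite -mulrBl normrM [leRHS]mulrAC ler_wpM2r.
- by rewrite mulrA -mulrDl -mulrBl normrM [leRHS]mulrAC ler_wpM2r.
Qed.

Lemma g_small_testfun (c dl tau r : R) (q : 'rV[R]_d * R) x t : 0 < r <= 1 ->
  g_small c lambda r (slice (testfun e dl tau q) t) x =
  c * (small_jumps lambda r (moll e) (x - q.1) * (tbump dl tau t * tbump dl tau q.2)).
Proof.
move=> r01; have [B B0 hB] := C11_bounded_translate (tbump dl tau t * tbump dl tau q.2) q.1.
have mpsi : measurable_fun setT (slice (testfun e dl tau q) t).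
  rewrite /slice /testfun /=; apply: measurable_funM => //.
  exact: (measurableT_comp (measurable_moll e) (measurable_addrV (- q.1))).
rewrite (@g_smallE _ _ _ lambda0 lambda2 _ mpsi _ hB)//.
congr (_ * _); have /andP[_ r1] := r01.
exact: (small_jumps_translate (tbump dl tau t * tbump dl tau q.2) q.1 x r1).
Qed.

End moll_small_jumps.

(** * The product measure on pairs of points of space-time *)

Lemma ae_fst {R : realType} d1 d2 (X : measurableType d1) (Y : measurableType d2)
    (m1 : {sigma_finite_measure set X -> \bar R})
    (m2 : {sigma_finite_measure set Y -> \bar R}) (P : X -> Prop) :
  {ae m1, forall x, P x} -> {ae (m1 \x m2)%E, forall z, P z.1}.
Proof.
move=> [N [mN N0 PN]]; exists (N `*` setT); split; first exact: measurableX.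
  by rewrite product_measure1E// [X in (X * _)%E](N0 : m1 N = 0%E) mul0e.
by move=> z /= nP; split => //; exact: PN.
Qed.

Lemma ae_snd {R : realType} d1 d2 (X : measurableType d1) (Y : measurableType d2)
    (m1 : {sigma_finite_measure set X -> \bar R})
    (m2 : {sigma_finite_measure set Y -> \bar R}) (P : Y -> Prop) :
  {ae m2, forall y, P y} -> {ae (m1 \x m2)%E, forall z, P z.2}.
Proof.
move=> [N [mN N0 PN]]; exists (setT `*` N); split; first exact: measurableX.
  by rewrite product_measure1E// [X in (_ * X)%E](N0 : m2 N = 0%E) mule0.
by move=> z /= nP; split => //; exact: PN.
Qed.

Lemma lebesgue_itvoo_le {R : realType} (T : R) : 0 <= T ->
  (@lebesgue_measure R `]0%R, T[ <= T%:E)%E.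
Proof.
by move=> T0; rewrite lebesgue_measure_itv/= lte_fin; case: ifPn => _; rewrite ?sube0 lee_fin.
Qed.

Section double.
Context {R : realType} {d : nat}.
Local Notation Z := ('rV[R]_d * measurableTypeR R)%type.
Local Notation mu := (spacetime_measure R d).

Definition double_measure : set (Z * Z) -> \bar R := (mu \x mu)%E.

HB.instance Definition _ := Measure.on double_measure.

HB.instance Definition _ := Measure_isSigmaFinite.Build _ _ _
  double_measure (sigma_finite_prod mu mu).

Local Notation M := double_measure.

Lemma preserving_swap : preserving M (fun z => (z.2, z.1)).
Proof.
have ms : measurable_fun setT (fun z : Z * Z => (z.2, z.1)) by exact: measurable_swap.
split => // f mf f0.
rewrite [LHS](@tonelli12 _ _ _ _ _ mu mu (fun z => f (z.2, z.1)))//=; last first.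
  exact: measurableT_comp mf ms.
by rewrite -(@tonelli21 _ _ _ _ _ mu mu f).
Qed.

(** The set that carries the doubled integrands. Its measure may be infinite, but its sections at a
    fixed point of space-time have bounded measure. *)
Definition near_pairs (rho T : R) : set (Z * Z) :=
  [set z : Z * Z | [/\ forall i, `|(z.1.1 - z.2.1) ord0 i| <= rho,
    0 < (z.1.2 : R) < T & 0 < (z.2.2 : R) < T]].

Lemma measurable_coordZ d' (X : measurableType d') (f : X -> 'rV[R]_d) i :
  measurable_fun setT f -> measurable_fun setT (fun x => f x ord0 i).
Proof. by move=> /measurable_fun_rVP. Qed.

Lemma measurable_diff_space :
  measurable_fun setT (fun z : Z * Z => z.1.1 - z.2.1).
Proof.
by apply: measurable_subrV2;
  [exact: measurableT_comp measurable_fst measurable_fst|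
   exact: measurableT_comp measurable_fst measurable_snd].
Qed.

Lemma measurable_near_pairs rho T : measurable (near_pairs rho T).
Proof.
rewrite (_ : near_pairs rho T =
  (\bigcap_(i in [set: 'I_d]) ((fun z : Z * Z => (z.1.1 - z.2.1) ord0 i) @^-1` `[- rho, rho]%classic)) `&`
  ((fun z : Z * Z => z.1.2) @^-1` `]0, T[%classic) `&`
  ((fun z : Z * Z => z.2.2) @^-1` `]0, T[%classic)).
  apply: measurableI; first apply: measurableI.
  - apply: fin_bigcap_measurable => // i _; rewrite -[X in measurable X]setTI.
    have mi := @measurable_coordZ _ _ _ i measurable_diff_space.
    exact: (mi measurableT _ (measurable_itv _)).
  - rewrite -[X in measurable X]setTI.
    have mi : measurable_fun setT (fun z : Z * Z => z.1.2).
      exact: measurableT_comp measurable_snd measurable_fst.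
    exact: (mi measurableT _ (measurable_itv _)).
  - rewrite -[X in measurable X]setTI.
    have mi : measurable_fun setT (fun z : Z * Z => z.2.2).
      exact: measurableT_comp measurable_snd measurable_snd.
    exact: (mi measurableT _ (measurable_itv _)).
apply/seteqP; split => [[p q] [/= h1 h2 h3]|[p q] [[/= h1 h2] h3]].
  by split; [split => // i _ /=; rewrite in_itv/= -ler_norml|].
by split => // i; have := h1 i Logic.I; rewrite /= in_itv/= -ler_norml.
Qed.

Lemma near_pairs_swap rho T p q : near_pairs rho T (p, q) -> near_pairs rho T (q, p).
Proof.
move=> [/= h1 h2 h3]; split => //= i.
by have := h1 i; rewrite !mxE distrC.
Qed.

Lemma near_pairs_section (rho T : R) (p : Z) : 0 <= rho -> 0 <= T ->
  (\int[mu]_q (\1_(near_pairs rho T) (p, q))%:E <= ((2 * rho) ^+ d * T)%:E)%E.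
Proof.
move=> rho0 T0.
pose I (i : 'I_d) := `[(p.1 ord0 i - rho), (p.1 ord0 i + rho)]%classic : set R.
pose Bx := [set x : 'rV[R]_d | forall i, I i (x ord0 i)].
have mBx : measurable Bx.
  rewrite (_ : Bx = \bigcap_(i in [set: 'I_d]) ((fun x : 'rV[R]_d => x ord0 i) @^-1` I i)).
    apply: fin_bigcap_measurable => // i _.
    rewrite -[X in measurable X]setTI.
    exact: (measurable_coord i measurableT (measurable_itv _)).
  by apply/seteqP; split=> x /= Ix i; [move=> _|]; exact: Ix.
have mBt : measurable (Bx `*` (`]0, T[%classic : set (measurableTypeR R))).
  by apply: measurableX => //; exact: measurable_itv.
apply: (@le_trans _ _ (mu (Bx `*` `]0, T[%classic))).
  rewrite -[leRHS]mul1e -integral_cst// [leRHS]integral_mkcond.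
  apply: ge0_le_integral => //.
  - have mi := measurable_indic (R := R) (D := setT) (measurable_near_pairs rho T).
    have h := measurable_fun_pair2 p mi.
    exact/measurable_EFinP.
  - by apply/(measurable_restrictT _ _).1.
  - move=> q _; rewrite indicE /patch; case: (asboolP (near_pairs rho T (p, q))) => h.
      rewrite !mem_set//; case: h => /= h1 _ h3; split => //= i.
      by rewrite /I/= in_itv/=; have := h1 i; rewrite !mxE ler_norml; lra.
    by rewrite memNset//; case: ifPn; rewrite lee_fin.
rewrite [leLHS](product_measure1E (lebesgue_rV d) lebesgue_measure mBx (measurable_itv `]0, T[)).
rewrite [X in (X * _)%E](@lebesgue_rV_box _ d I (fun i => measurable_itv _)).
rewrite (eq_bigr (fun=> (2 * rho)%:E)); last first.
  move=> i _; rewrite lebesgue_measure_itv/= lte_fin.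
  case: ltP => hh; first by rewrite -EFinB; congr EFin; ring.
  by congr EFin; lra.
rewrite prodEFin prodr_const card_ord EFinM lee_wpmul2l ?lee_fin ?exprn_ge0 ?mulr_ge0//.
exact: lebesgue_itvoo_le.
Qed.

(** For [w1], integrating first in the other point costs only the measure (2 rho)^d T of a section;
    [w2] reduces to this case by exchanging the two points. *)
Lemma integrable_near_pairs (rho T : R) (w1 w2 : Z -> R) (F : Z * Z -> R) :
  0 <= rho -> 0 <= T ->
  mu.-integrable setT (EFin \o w1) -> mu.-integrable setT (EFin \o w2) ->
  (forall p, 0 <= w1 p) -> (forall q, 0 <= w2 q) ->
  measurable_fun setT F ->
  (forall z, near_pairs rho T z -> `|F z| <= w1 z.1 + w2 z.2) ->
  (forall z, ~ near_pairs rho T z -> F z = 0) ->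
  M.-integrable setT (EFin \o F).
Proof.
move=> rho0 T0 iw1 iw2 w10 w20 mF F1 F0.
have mS := measurable_near_pairs rho T.
have mI : measurable_fun setT (\1_(near_pairs rho T) : Z * Z -> R).
  exact: measurable_indic.
have half (w : Z -> R) : mu.-integrable setT (EFin \o w) -> (forall p, 0 <= w p) ->
    M.-integrable setT (fun z => (w z.1 * \1_(near_pairs rho T) z)%:E).
  move=> iw w0; have mw : measurable_fun setT w by apply/measurable_EFinP; exact: measurable_int iw.
  have mwI : measurable_fun setT (fun z : Z * Z => (w z.1 * \1_(near_pairs rho T) z)%:E).
    apply/measurable_EFinP; apply: measurable_funM => //.
    exact: measurableT_comp mw measurable_fst.
  apply/integrableP; split => //.
  under eq_integral do rewrite gee0_abs ?lee_fin ?mulr_ge0//.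
  rewrite [ltLHS](@tonelli12 _ _ _ _ _ mu mu _ mwI); last first.
    by move=> z; rewrite lee_fin mulr_ge0.
  apply: (@le_lt_trans _ _ (\int[mu]_p ((w p)%:E * ((2 * rho) ^+ d * T)%:E))%E).
    apply: ge0_le_integral => //.
    - by move=> p _; apply: integral_ge0 => q _; rewrite lee_fin mulr_ge0.
    - by apply: measurable_int1 mwI _ => z; rewrite lee_fin mulr_ge0.
    - by apply: emeasurable_funM => //; exact: measurable_int iw.
    - move=> p _ /=; under eq_integral do rewrite EFinM.
      rewrite ge0_integralZl_EFin//.
        by apply: lee_wpmul2l; rewrite ?lee_fin//; exact: near_pairs_section.
      apply/measurable_EFinP; exact: (measurable_fun_pair2 p mI).
  rewrite ge0_integralZr//.
  - apply: lte_mul_pinfty; last exact: ltry.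
      by apply: integral_ge0 => p _; rewrite lee_fin.
    exact: (integrable_fin_num _ iw).
  - exact: measurable_int iw.
  - by move=> p _; rewrite lee_fin.
  - by rewrite lee_fin mulr_ge0// exprn_ge0// mulr_ge0.
have i1 := half w1 iw1 w10.
have i2 : M.-integrable setT (fun z => (w2 z.2 * \1_(near_pairs rho T) z)%:E).
  have := preserving_integrable preserving_swap (half w2 iw2 w20).
  apply: eq_integrable => // -[p q] _; rewrite /comp !indicE /=.
  have [h|h] := pselect (near_pairs rho T (p, q)).
    by rewrite (mem_set h) (mem_set (near_pairs_swap h)).
  by rewrite (memNset h) memNset// => /near_pairs_swap.
have := integrableD measurableT i1 i2; apply: le_integrable => //.
  exact/measurable_EFinP.
move=> z _ /=; rewrite lee_fin -mulrDl.
have [Sz|nSz] := pselect (near_pairs rho T z).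
  rewrite indicE mem_set// mulr1 (le_trans (F1 z Sz))//.
  exact: ler_norm.
by rewrite F0// normr0.
Qed.

End double.

(** * Large jumps of an integrable function *)

Section large_jumps.
Context {R : realType} {d : nat}.
Variables (lambda r : R).
Hypotheses (lambda0 : 0 < lambda) (r0 : 0 < r).
Local Notation Z := ('rV[R]_d * measurableTypeR R)%type.
Local Notation mu := (spacetime_measure R d).
Local Notation leb := (@lebesgue_rV R d).
Local Notation M := (@double_measure R d).

Definition kernel_out (z : 'rV[R]_d) : R :=
  levy_kernel lambda z * \1_[set z : 'rV[R]_d | r < enorm z] z.

Definition shiftZ (z : 'rV[R]_d) (p : Z) : Z := (p.1 + z, p.2).

(** With the indicator absorbed in [kernel_out], the operator [g_large] becomes an integral over the
    whole of R^d, ready for Tonelli. *)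
Definition large_jumps (a : Z -> R) (p : Z) : R :=
  \int[leb]_z (kernel_out z * (a (shiftZ z p) - a p)).

Lemma measurable_out : measurable [set z : 'rV[R]_d | r < enorm z].
Proof.
have := @measurable_enorm_itv R d `]r, +oo[; congr measurable.
by apply/seteqP; split => z /=; rewrite in_itv/= andbT.
Qed.

Lemma kernel_out_ge0 z : 0 <= kernel_out z.
Proof. by rewrite mulr_ge0 ?levy_kernel_ge0. Qed.

Lemma measurable_kernel_out : measurable_fun setT kernel_out.
Proof.
apply: measurable_funM; first exact: measurable_levy_kernel.
by apply: measurable_indic; exact: measurable_out.
Qed.

Lemma kernel_out_restrict z : kernel_out z =
  (levy_kernel lambda \_ [set z : 'rV[R]_d | r < enorm z]) z.
Proof. by rewrite /kernel_out indicE /patch; case: ifPn => _; rewrite ?mulr1 ?mulr0. Qed.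

Lemma integrable_kernel_out : leb.-integrable setT (EFin \o kernel_out).
Proof.
apply/integrableP; split; first by apply/measurable_EFinP; exact: measurable_kernel_out.
under eq_integral do rewrite gee0_abs ?lee_fin ?kernel_out_ge0//.
apply: le_lt_trans (@levy_kernel_tail R d lambda lambda0 r r0).
rewrite [leRHS]integral_mkcond le_eqVlt; apply/orP; left; apply/eqP.
by apply: eq_integral => z _; rewrite /comp kernel_out_restrict restrict_EFin.
Qed.

Lemma g_largeE (c : R) (a : Z -> R) x t :
  g_large c lambda r (slice a t) x = c * large_jumps a (x, t).
Proof.
rewrite /g_large Rintegral_mkcond; congr (_ * _); apply: eq_Rintegral => z _.
rewrite /kernel_out /patch indicE /levy_integrand /slice /shiftZ /=.
by case: ifPn => _; rewrite ?mulr1 ?mulr0 ?mul0r// mulrC.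
Qed.

Lemma measurable_shiftZ z : measurable_fun setT (shiftZ z).
Proof. exact: (measurable_map_pair (measurable_addrV z) (@measurable_id _ _ setT)). Qed.

Lemma preserving_id d' (X : measurableType d') (m : set X -> \bar R) :
  preserving m id.
Proof. by split. Qed.

Lemma preserving_shiftZ z : preserving mu (shiftZ z).
Proof. exact: (preserving_prod (preserving_addrV z) (preserving_id _)). Qed.

Lemma measurable_shiftZ2 : measurable_fun setT (fun y : Z * 'rV[R]_d => shiftZ y.2 y.1).
Proof.
apply/measurable_fun_pairP; split => /=.
  apply: measurable_addrV2 => //.
  exact: measurableT_comp measurable_fst measurable_fst.
exact: measurableT_comp measurable_snd measurable_fst.
Qed.

(** Integrating first in [p], translation invariance gives the product of the L^1 norms of the
    kernel and of [a]. *)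
Lemma integrable_kernel_shift (a : Z -> R) : mu.-integrable setT (EFin \o a) ->
  (mu \x leb)%E.-integrable setT (fun y => (kernel_out y.2 * a (shiftZ y.2 y.1))%:E).
Proof.
move=> ia; have ma : measurable_fun setT a by apply/measurable_EFinP; exact: measurable_int ia.
have mF : measurable_fun setT
    (fun y : Z * 'rV[R]_d => (kernel_out y.2 * a (shiftZ y.2 y.1))%:E).
  apply/measurable_EFinP; apply: measurable_funM.
    exact: measurableT_comp measurable_kernel_out measurable_snd.
  exact: measurableT_comp ma measurable_shiftZ2.
have ma' : measurable_fun setT (fun p => `|(a p)%:E|%E).
  by apply: measurableT_comp => //; exact/measurable_EFinP.
have A_ge0 : (0 <= \int[mu]_p `|(a p)%:E|)%E by exact: integral_ge0.
apply/(integrable21ltyP _ _ mF).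
apply: (@le_lt_trans _ _ (\int[leb]_z ((kernel_out z)%:E * \int[mu]_p `|(a p)%:E|))%E).
  rewrite le_eqVlt; apply/orP; left; apply/eqP; apply: eq_integral => z _ /=.
  rewrite -((preserving_shiftZ z).2 (fun p => `|(a p)%:E|%E))//.
  rewrite -ge0_integralZl_EFin ?kernel_out_ge0//.
    apply: eq_integral => p _.
    by rewrite normrM (ger0_norm (kernel_out_ge0 z)) EFinM.
  exact: measurableT_comp ma' (measurable_shiftZ z).
have [_ aoo] := integrableP _ _ _ ia.
rewrite ge0_integralZr//.
- apply: lte_mul_pinfty; last exact: aoo.
    by apply: integral_ge0 => z _; rewrite lee_fin kernel_out_ge0.
  exact: (integrable_fin_num _ integrable_kernel_out).
- exact: measurable_int integrable_kernel_out.
- by move=> z _; rewrite lee_fin kernel_out_ge0.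
Qed.

Lemma integrable_kernel_base (a : Z -> R) : mu.-integrable setT (EFin \o a) ->
  (mu \x leb)%E.-integrable setT (fun y => (kernel_out y.2 * a y.1)%:E).
Proof.
move=> ia; have ma : measurable_fun setT a by apply/measurable_EFinP; exact: measurable_int ia.
have mF : measurable_fun setT (fun y : Z * 'rV[R]_d => (kernel_out y.2 * a y.1)%:E).
  apply/measurable_EFinP; apply: measurable_funM.
    exact: measurableT_comp measurable_kernel_out measurable_snd.
  exact: measurableT_comp ma measurable_fst.
have ma' : measurable_fun setT (fun p => `|(a p)%:E|%E).
  by apply: measurableT_comp => //; exact/measurable_EFinP.
apply/(integrable21ltyP _ _ mF).
apply: (@le_lt_trans _ _ (\int[leb]_z ((kernel_out z)%:E * \int[mu]_p `|(a p)%:E|))%E).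
  rewrite le_eqVlt; apply/orP; left; apply/eqP; apply: eq_integral => z _ /=.
  rewrite -ge0_integralZl_EFin ?kernel_out_ge0//.
  apply: eq_integral => p _.
  by rewrite normrM (ger0_norm (kernel_out_ge0 z)) EFinM.
have [_ aoo] := integrableP _ _ _ ia.
have A_ge0 : (0 <= \int[mu]_p `|(a p)%:E|)%E by exact: integral_ge0.
rewrite ge0_integralZr//.
- apply: lte_mul_pinfty; last exact: aoo.
    by apply: integral_ge0 => z _; rewrite lee_fin kernel_out_ge0.
  exact: (integrable_fin_num _ integrable_kernel_out).
- exact: measurable_int integrable_kernel_out.
- by move=> z _; rewrite lee_fin kernel_out_ge0.
Qed.

Lemma integrable_large_jumps (a : Z -> R) : mu.-integrable setT (EFin \o a) ->
  mu.-integrable setT (EFin \o large_jumps a).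
Proof.
move=> ia; have ma : measurable_fun setT a by apply/measurable_EFinP; exact: measurable_int ia.
have iJ : (mu \x leb)%E.-integrable setT
    (fun y => (kernel_out y.2 * (a (shiftZ y.2 y.1) - a y.1))%:E).
  have := integrableB measurableT (integrable_kernel_shift ia) (integrable_kernel_base ia).
  by apply: eq_integrable => // y _; rewrite -EFinB mulrBr.
have iF := integrable_fubini_F iJ.
apply: le_integrable iF => //.
  apply/measurable_EFinP.
  apply: (@measurable_Rintegral_param R _ _ _ _ leb
    (fun y => kernel_out y.2 * (a (shiftZ y.2 y.1) - a y.1))).
  by apply/measurable_EFinP; exact: measurable_int iJ.
(* An infinite integral has [fine] equal to 0, so the real value never exceeds the modulus of the
   extended one. *)
move=> p _; rewrite /comp /large_jumps /Rintegral /fubini_F /=.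
by case: (\int[leb]_z _)%E => [x| |] //=; rewrite ?normr0 ?leey.
Qed.

Lemma ae_integrable_kernel_shift (a : Z -> R) : mu.-integrable setT (EFin \o a) ->
  {ae mu, forall p, leb.-integrable setT (fun z => (kernel_out z * a (shiftZ z p))%:E)}.
Proof. by move=> /integrable_kernel_shift /ae_integrable1. Qed.

(** Splitting the difference requires the shifted part to be integrable at the given [p];
    [ae_integrable_kernel_shift] provides this for almost every [p] only. *)
Lemma large_jumpsE (a : Z -> R) p :
  leb.-integrable setT (fun z => (kernel_out z * a (shiftZ z p))%:E) ->
  large_jumps a p =
  \int[leb]_z (kernel_out z * a (shiftZ z p)) - (\int[leb]_z kernel_out z) * a p.
Proof.
move=> ia; rewrite -RintegralZr//; last exact: integrable_kernel_out.
rewrite -RintegralB//; last first.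
  have := integrableZr measurableT (a p) integrable_kernel_out.
  by apply: eq_integrable => // z _; rewrite /comp EFinM.
by apply: eq_Rintegral => z _; rewrite mulrBr.
Qed.

End large_jumps.

(** * The large jumps of the doubled equation have a sign *)

Section jump_term.
Context {R : realType} {d : nat}.
Variables (lambda r rho T C : R).
Hypotheses (lambda0 : 0 < lambda) (r0 : 0 < r).
Hypotheses (rho0 : 0 <= rho) (T0 : 0 <= T) (C0 : 0 <= C).
Local Notation Z := ('rV[R]_d * measurableTypeR R)%type.
Local Notation mu := (spacetime_measure R d).
Local Notation leb := (@lebesgue_rV R d).
Local Notation M := (@double_measure R d).
Local Notation kr := (@kernel_out R d lambda r).
Local Notation jumps := (@large_jumps R d lambda r).

Definition shift2 (h : 'rV[R]_d) (z : Z * Z) : Z * Z := (shiftZ h z.1, shiftZ h z.2).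

Lemma preserving_shift2 h : preserving M (shift2 h).
Proof. exact: (preserving_prod (preserving_shiftZ h) (preserving_shiftZ h)). Qed.

Variables (a b : Z -> R) (sgm Phi : Z * Z -> R).
Hypotheses (ia : mu.-integrable setT (EFin \o a)) (ib : mu.-integrable setT (EFin \o b)).
Hypotheses (msgm : measurable_fun setT sgm) (sgm1 : forall z, `|sgm z| <= 1).
Hypothesis sgmD : forall z, sgm z * (a z.1 - b z.2) = `|a z.1 - b z.2|.
Hypotheses (mPhi : measurable_fun setT Phi) (Phi0 : forall z, 0 <= Phi z).
Hypotheses (PhiC : forall z, Phi z <= C).
Hypothesis Phi_out : forall z, ~ near_pairs rho T z -> Phi z = 0.
Hypothesis Phi_shift : forall h z, Phi (shift2 h z) = Phi z.

Let ma : measurable_fun setT a.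
Proof. by apply/measurable_EFinP; exact: measurable_int ia. Qed.

Let mb : measurable_fun setT b.
Proof. by apply/measurable_EFinP; exact: measurable_int ib. Qed.

(** In the application [a] and [b] are A(u) and A(v), while [sgm] is the sign of u - v; [sgmD] is
    the only link between them. *)
Definition jump_term (z : Z * Z) : R := sgm z * (jumps a z.1 - jumps b z.2) * Phi z.

Lemma integrable_weighted (x y : Z -> R) (F : Z * Z -> R) :
  mu.-integrable setT (EFin \o x) -> mu.-integrable setT (EFin \o y) ->
  measurable_fun setT F -> (forall z, `|F z| <= `|x z.1| + `|y z.2|) ->
  M.-integrable setT (EFin \o (fun z => F z * Phi z)).
Proof.
move=> ix iy mF Fxy.
have iabs (w : Z -> R) : mu.-integrable setT (EFin \o w) ->
    mu.-integrable setT (EFin \o (fun p => C * `|w p|)).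
  move=> iw; have := integrableZl measurableT C (integrable_abse iw).
  by apply: eq_integrable => // p _.
apply: (integrable_near_pairs rho0 T0 (iabs x ix) (iabs y iy)).
- by move=> p; rewrite mulr_ge0.
- by move=> p; rewrite mulr_ge0.
- exact: measurable_funM.
- move=> z _; rewrite normrM (ger0_norm (Phi0 z)) -mulrDr mulrC.
  by apply: ler_pM.
- by move=> z /Phi_out ->; rewrite mulr0.
Qed.

Let mjumps (x : Z -> R) : mu.-integrable setT (EFin \o x) -> measurable_fun setT (jumps x).
Proof.
by move=> ix; apply/measurable_EFinP; exact: measurable_int (integrable_large_jumps lambda0 r0 ix).
Qed.

Lemma integrable_jump_term : M.-integrable setT (EFin \o jump_term).
Proof.
apply: (integrable_weighted (integrable_large_jumps lambda0 r0 ia) (integrable_large_jumps lambda0 r0 ib)).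
  apply: measurable_funM => //; apply: measurable_funB.
    exact: measurableT_comp (mjumps ia) measurable_fst.
  exact: measurableT_comp (mjumps ib) measurable_snd.
move=> z; rewrite normrM.
rewrite (@le_trans _ _ (1 * `|jumps a z.1 - jumps b z.2|)) ?ler_wpM2r//.
by rewrite mul1r ler_normB.
Qed.

Let D (z : Z * Z) := a z.1 - b z.2.

Let mD : measurable_fun setT D.
Proof.
apply: measurable_funB; first exact: measurableT_comp ma measurable_fst.
exact: measurableT_comp mb measurable_snd.
Qed.

Let iD : M.-integrable setT (EFin \o (fun z => `|D z| * Phi z)).
Proof.
apply: (integrable_weighted ia ib); first exact: measurableT_comp.
by move=> z; rewrite normr_id ler_normB.
Qed.

Let Q := \int[M]_z (`|D z| * Phi z).
Let K0 := \int[leb]_h kr h.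

(** Extended valued, so that its integral over the pairs can be computed by Tonelli before pointwise
    convergence is known. *)
Let H (z : Z * Z) : \bar R := (\int[leb]_h (kr h * (`|D (shift2 h z)| * Phi z))%:E)%E.

Let mH2 : measurable_fun setT (fun y : (Z * Z) * 'rV[R]_d =>
  (kr y.2 * (`|D (shift2 y.2 y.1)| * Phi y.1))%:E).
Proof.
have m1 : measurable_fun setT (fun y : (Z * Z) * 'rV[R]_d => (y.1.1, y.2)).
  apply/measurable_fun_pairP; split; last exact: measurable_snd.
  exact: (@measurableT_comp _ _ _ _ _ _ (@fst Z Z) setT (@fst (Z * Z) 'rV[R]_d)
    measurable_fst measurable_fst).
have m2 : measurable_fun setT (fun y : (Z * Z) * 'rV[R]_d => (y.1.2, y.2)).
  apply/measurable_fun_pairP; split; last exact: measurable_snd.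
  exact: (@measurableT_comp _ _ _ _ _ _ (@snd Z Z) setT (@fst (Z * Z) 'rV[R]_d)
    measurable_snd measurable_fst).
have ms2 : measurable_fun setT (fun y : (Z * Z) * 'rV[R]_d => shift2 y.2 y.1).
  apply/measurable_fun_pairP; split => /=.
    exact: (measurableT_comp (@measurable_shiftZ2 R d) m1).
  exact: (measurableT_comp (@measurable_shiftZ2 R d) m2).
apply/measurable_EFinP; apply: measurable_funM.
  exact: measurableT_comp (measurable_kernel_out lambda r) measurable_snd.
apply: measurable_funM; last exact: measurableT_comp mPhi measurable_fst.
by apply: measurableT_comp => //; exact: measurableT_comp mD ms2.
Qed.

Let H_ge0 (y : (Z * Z) * 'rV[R]_d) :
  (0 <= (kr y.2 * (`|D (shift2 y.2 y.1)| * Phi y.1))%:E)%E.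
Proof. by rewrite lee_fin mulr_ge0 ?kernel_out_ge0// mulr_ge0. Qed.

(** For each jump [h] the diagonal translation preserves both the measure and [Phi], so the inner
    integral is [Q] whatever [h] is. *)
Let int_H : (\int[M]_z H z = (K0 * Q)%:E)%E.
Proof.
rewrite -(@tonelli12 _ _ _ _ _ M leb _ mH2 H_ge0) (@tonelli21 _ _ _ _ _ M leb _ mH2 H_ge0) /=.
have QE : (\int[M]_z (`|D z| * Phi z)%:E = Q%:E)%E.
  by rewrite /Q /Rintegral fineK//; exact: (integrable_fin_num _ iD).
have KE : (\int[leb]_h (kr h)%:E = K0%:E)%E.
  rewrite /K0 /Rintegral fineK//.
  exact: (integrable_fin_num _ (integrable_kernel_out lambda0 r0)).
have mDP : measurable_fun setT (fun z => (`|D z| * Phi z)%:E).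
  exact: measurable_int iD.
transitivity (\int[leb]_h ((kr h)%:E * Q%:E))%E; last first.
  rewrite ge0_integralZr//.
  - by rewrite KE EFinM.
  - exact: measurable_int (integrable_kernel_out lambda0 r0).
  - by move=> h _; rewrite lee_fin kernel_out_ge0.
  - by rewrite lee_fin; apply: Rintegral_ge0 => z _; rewrite mulr_ge0.
apply: eq_integral => h _.
rewrite -QE -((preserving_shift2 h).2 (fun z => (`|D z| * Phi z)%:E))//; last first.
  by move=> z; rewrite lee_fin mulr_ge0.
rewrite -ge0_integralZl_EFin ?kernel_out_ge0//.
- by apply: eq_integral => z _; rewrite Phi_shift EFinM.
- by move=> z _; rewrite lee_fin mulr_ge0.
- exact: measurableT_comp mDP (preserving_shift2 h).1.
Qed.

(** Adding [K0 * |D| * Phi] removes the unshifted part of the jumps, since [sgm] times [D] is |D|.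
    What is left is bounded by [H], whose integral [K0 * Q] is exactly the integral of what was
    added. *)
Let g z := jump_term z + K0 * (`|D z| * Phi z).

Let ig : M.-integrable setT (EFin \o g).
Proof.
have := integrableD measurableT integrable_jump_term (integrableZl measurableT K0 iD).
by apply: eq_integrable => // z _.
Qed.

Let g_le : {ae M, forall z, ((g z)%:E <= H z)%E}.
Proof.
have ha := @ae_fst R _ _ Z Z mu mu _ (ae_integrable_kernel_shift lambda0 r0 ia).
have hb := @ae_snd R _ _ Z Z mu mu _ (ae_integrable_kernel_shift lambda0 r0 ib).
apply: filterS2 ha hb => z haz hbz.
have iDz : leb.-integrable setT (fun h => (kr h * D (shift2 h z))%:E).
  have := integrableB measurableT haz hbz.
  by apply: eq_integrable => // h _; rewrite -EFinB -mulrBr.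
have iDa : leb.-integrable setT (EFin \o (fun h => kr h * `|D (shift2 h z)|)).
  have := integrable_abse iDz; apply: eq_integrable => // h _ /=.
  by rewrite normrM (ger0_norm (kernel_out_ge0 _ _ _)).
have -> : H z = ((\int[leb]_h (kr h * `|D (shift2 h z)|)) * Phi z)%:E.
  rewrite /H EFinM /Rintegral fineK; last exact: (integrable_fin_num _ iDa).
  rewrite -ge0_integralZr//.
  - by apply: eq_integral => h _; rewrite mulrA EFinM.
  - exact: measurable_int iDa.
  - by move=> h _; rewrite lee_fin mulr_ge0// kernel_out_ge0.
  - by rewrite lee_fin.
have gE : g z = sgm z * (\int[leb]_h (kr h * D (shift2 h z))) * Phi z.
  rewrite /g /jump_term (large_jumpsE lambda0 r0 haz) (large_jumpsE lambda0 r0 hbz) -/K0.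
  have -> : \int[leb]_h (kr h * D (shift2 h z)) =
      \int[leb]_h (kr h * a (shiftZ h z.1)) - \int[leb]_h (kr h * b (shiftZ h z.2)).
    by rewrite -RintegralB//; apply: eq_Rintegral => h _; rewrite -mulrBr.
  by rewrite /D -sgmD; ring.
apply: (@le_trans _ _ (sgm z * (\int[leb]_h (kr h * D (shift2 h z))) * Phi z)%:E).
  by rewrite -gE.
rewrite lee_fin ler_wpM2r//.
rewrite (@le_trans _ _ `|\int[leb]_h (kr h * D (shift2 h z))|)//.
  rewrite (le_trans (ler_norm _))// normrM -[leRHS]mul1r ler_wpM2r//.
rewrite (le_trans (le_normr_Rintegral _ iDz))//.
rewrite le_eqVlt; apply/orP; left; apply/eqP; apply: eq_Rintegral => h _.
by rewrite normrM (ger0_norm (kernel_out_ge0 _ _ _)).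
Qed.

Lemma jump_term_le0 : \int[M]_z jump_term z <= 0.
Proof.
have K00 : 0 <= K0 by apply: Rintegral_ge0 => h _; exact: kernel_out_ge0.
have gQ : \int[M]_z g z <= K0 * Q.
  rewrite -lee_fin -int_H /Rintegral fineK; last exact: (integrable_fin_num _ ig).
  (* [g] has no sign: its positive part is compared with [H], which is nonnegative. *)
  apply: (@le_trans _ _ (\int[M]_z ((EFin \o g)^\+ z))%E).
    rewrite [leLHS]integralE -[leRHS]sube0 leeB//.
    by apply: integral_ge0 => z _; exact: funeneg_ge0.
  apply: ae_ge0_le_integral => //.
  - by apply: measurable_funepos; exact: measurable_int ig.
  - by move=> z _; apply: integral_ge0 => h _; exact: (H_ge0 (z, h)).
  - exact: (@measurable_int1 _ _ _ _ _ leb _ mH2 H_ge0).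
  - apply: filterS g_le => z gz _; rewrite funeposE ge_max gz/=.
    by apply: integral_ge0 => h _; exact: (H_ge0 (z, h)).
move: gQ; rewrite /g RintegralD//; last 2 first.
- exact: integrable_jump_term.
- by have := integrableZl measurableT K0 iD; apply: eq_integrable.
by rewrite RintegralZl// -/Q gerDr.
Qed.

End jump_term.

(** * The entropy integrand with [k = v q], as a function of the pair *)

Section kruzkov.
Context {R : realType} {d : nat}.
Variables (T c lambda : R) (f : R -> 'rV[R]_d) (A : R -> R) (L : R).
Hypotheses (T0 : 0 < T) (c0 : 0 < c) (lambda0 : 0 < lambda) (lambda2 : lambda < 2).
Hypotheses (L0 : 0 <= L).
Hypothesis fL : forall x y i, `|f x ord0 i - f y ord0 i| <= L * `|x - y|.
Hypothesis AL : forall x y, `|A x - A y| <= L * `|x - y|.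
Hypothesis A_nd : {homo A : x y / x <= y}.
Hypothesis A0 : A 0 = 0.
Local Notation Z := ('rV[R]_d * measurableTypeR R)%type.
Local Notation mu := (spacetime_measure R d).
Local Notation M := (@double_measure R d).

(* The part of the definition of entropy solutions used by the doubling of
   variables, for a function extended by zero outside of Q_T. *)
Record entropy_subsolution (u : Z -> R) : Prop := {
  subsolution_L1 : mu.-integrable setT (EFin \o u) ;
  subsolution_ineq : forall (k r : R) (phi : 'rV[R]_d * R -> R), 0 < r ->
    Cc_infty (QT T) phi -> (forall z, 0 <= phi z) ->
    (0 <= \int[mu]_(z in QT T) (entropy_integrand c lambda f A u k r phi z)%:E)%E
}.

Variables (e dl tau : R).
Hypotheses (e0 : 0 < e) (dl0 : 0 < dl) (dltau : dl < tau) (tauT : tau < T - dl).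
Local Notation tb := (tbump dl tau).
Local Notation dtb := (dtbump dl tau).

Definition Phi (z : Z * Z) : R := testfun e dl tau z.2 z.1.

Definition term_t (u v : Z -> R) (z : Z * Z) : R :=
  `|u z.1 - v z.2| * (moll e (z.1.1 - z.2.1) * (dtb z.1.2 * tb z.2.2)).

Definition term_flux (u v : Z -> R) (z : Z * Z) : R :=
  \sum_(i < d) Num.sg (u z.1 - v z.2) * (f (u z.1) ord0 i - f (v z.2) ord0 i) *
    (dmoll e i (z.1.1 - z.2.1) * (tb z.1.2 * tb z.2.2)).

Definition term_small (r : R) (u v : Z -> R) (z : Z * Z) : R :=
  `|A (u z.1) - A (v z.2)| *
  (c * (small_jumps lambda r (moll e) (z.1.1 - z.2.1) * (tb z.1.2 * tb z.2.2))).

Definition term_large (r : R) (u v : Z -> R) (z : Z * Z) : R :=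
  Num.sg (u z.1 - v z.2) * (c * large_jumps lambda r (A \o u) z.1) * Phi z.

Lemma entropy_integrandE (r : R) (u v : Z -> R) (p q : Z) : 0 < r <= 1 ->
  entropy_integrand c lambda f A u (v q) r (testfun e dl tau q) p =
  term_t u v (p, q) + term_flux u v (p, q) + term_small r u v (p, q) +
  term_large r u v (p, q).
Proof.
move=> r01; rewrite /entropy_integrand dt_testfun //.
rewrite /dotrV; congr (_ + _ + _ + _).
- apply: eq_bigr => i _; rewrite gradx_testfun !mxE /eta'.
  by [].
- by rewrite /eta g_small_testfun.
- rewrite /eta' /term_large /Phi /=; congr (_ * _ * _).
  by rewrite g_largeE; case: p.
Qed.

Lemma time_out (t : R) : ~ (0 < t < T) -> tb t = 0 /\ dtb t = 0.
Proof.
move=> nt; suff h : dl < `|t - tau| by split; [exact: tbump_out|exact: dtbump_out].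
rewrite ltNge ler_norml; apply/negP => /andP[h1 h2]; apply: nt.
by have := dltau; have := tauT; move=> ? ?; apply/andP; split; lra.
Qed.

Lemma not_near_pairs (rho : R) (z : Z * Z) : ~ near_pairs rho T z ->
  [\/ exists i, rho < `|(z.1.1 - z.2.1) ord0 i|,
      tb z.1.2 = 0 /\ dtb z.1.2 = 0 | tb z.2.2 = 0 /\ dtb z.2.2 = 0].
Proof.
move=> nz; have [h1|h1] := pselect (forall i, `|(z.1.1 - z.2.1) ord0 i| <= rho); last first.
  have [i hi] : exists i, ~ (`|(z.1.1 - z.2.1) ord0 i| <= rho) by exact/existsNP.
  by apply: Or31; exists i; rewrite ltNge; apply/negP.
have [h2|h2] := pselect (0 < (z.1.2 : R) < T); last by apply: Or32; exact: time_out.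
have [h3|h3] := pselect (0 < (z.2.2 : R) < T); last by apply: Or33; exact: time_out.
by exfalso; apply: nz.
Qed.

Lemma measurable_sg : measurable_fun setT (Num.sg : R -> R).
Proof.
rewrite (_ : Num.sg = fun x : R => \1_(`]0, +oo[%classic : set R) x - \1_(`]-oo, 0[%classic : set R) x).
  by apply: measurable_funB; apply: measurable_indic; exact: measurable_itv.
apply/funext => x; rewrite !indicE.
have [x0|x0|<-] := ltgtP 0 x.
- by rewrite gtr0_sg// mem_set/= ?in_itv/= ?x0// memNset/= ?in_itv/= ?subr0// ltNge ltW.
- by rewrite ltr0_sg// memNset/= ?in_itv/= ?mem_set/= ?in_itv/= ?x0 ?sub0r// andbT ltNge ltW.
- by rewrite sgr0 !memNset/= ?in_itv/= ?ltxx// subr0.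
Qed.

Section two_functions.
Variables (u v : Z -> R).
Hypotheses (iu : mu.-integrable setT (EFin \o u)) (iv : mu.-integrable setT (EFin \o v)).

Let mu_ : measurable_fun setT u.
Proof. by apply/measurable_EFinP; exact: measurable_int iu. Qed.
Let mv_ : measurable_fun setT v.
Proof. by apply/measurable_EFinP; exact: measurable_int iv. Qed.

Let m1 : measurable_fun setT (fun z : Z * Z => u z.1).
Proof. exact: measurableT_comp mu_ measurable_fst. Qed.
Let m2 : measurable_fun setT (fun z : Z * Z => v z.2).
Proof. exact: measurableT_comp mv_ measurable_snd. Qed.

Lemma measurable_sg_diff : measurable_fun setT (fun z : Z * Z => Num.sg (u z.1 - v z.2)).
Proof. by apply: (measurableT_comp measurable_sg); exact: measurable_funB. Qed.

Let mt1 : measurable_fun setT (fun z : Z * Z => z.1.2 : R).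
Proof.
exact: (@measurableT_comp _ _ _ _ _ _ (@snd 'rV[R]_d (measurableTypeR R)) setT
  (@fst Z Z) measurable_snd measurable_fst).
Qed.
Let mt2 : measurable_fun setT (fun z : Z * Z => z.2.2 : R).
Proof.
exact: (@measurableT_comp _ _ _ _ _ _ (@snd 'rV[R]_d (measurableTypeR R)) setT
  (@snd Z Z) measurable_snd measurable_snd).
Qed.

Let mtb1 : measurable_fun setT (fun z : Z * Z => tb z.1.2).
Proof. exact: measurableT_comp (measurable_tbump dl tau) mt1. Qed.
Let mtb2 : measurable_fun setT (fun z : Z * Z => tb z.2.2).
Proof. exact: measurableT_comp (measurable_tbump dl tau) mt2. Qed.
Let mdtb1 : measurable_fun setT (fun z : Z * Z => dtb z.1.2).
Proof. exact: measurableT_comp (measurable_dtbump dl tau) mt1. Qed.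
Let mdtb2 : measurable_fun setT (fun z : Z * Z => dtb z.2.2).
Proof. exact: measurableT_comp (measurable_dtbump dl tau) mt2. Qed.

Let mmoll : measurable_fun setT (fun z : Z * Z => moll e (z.1.1 - z.2.1)).
Proof. exact: measurableT_comp (measurable_moll e) (@measurable_diff_space R d). Qed.

Lemma integrable_dominated (B rho : R) (F : Z * Z -> R) : 0 <= B -> 0 <= rho ->
  measurable_fun setT F ->
  (forall z, `|F z| <= B * `|u z.1 - v z.2|) ->
  (forall z, ~ near_pairs rho T z -> F z = 0) ->
  M.-integrable setT (EFin \o F).
Proof.
move=> B0 rho0 mF FB F0.
have iabs (w : Z -> R) : mu.-integrable setT (EFin \o w) ->
    mu.-integrable setT (EFin \o (fun p => B * `|w p|)).
  move=> iw; have := integrableZl measurableT B (integrable_abse iw).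
  by apply: eq_integrable => // p _.
apply: (integrable_near_pairs rho0 (ltW T0) (iabs u iu) (iabs v iv)) => //.
- by move=> p; rewrite mulr_ge0.
- by move=> p; rewrite mulr_ge0.
- move=> z _; rewrite (le_trans (FB z))// -mulrDr ler_wpM2l//.
  exact: ler_normB.
Qed.

Let tbB : exists2 B : R, 0 <= B & forall t, `|tb t| <= B /\ `|dtb t| <= B.
Proof.
have [B B0 hB] := @bump_bounds R.
exists (B + dl^-1 * B); first by rewrite addr_ge0 ?mulr_ge0 ?invr_ge0 ?ltW.
move=> t; have [h1 h2 _ _] := hB (dl^-1 * (t - tau)) 0.
have d0 : 0 < dl^-1 by rewrite invr_gt0.
have p0 : 0 < dl^-1 * B by rewrite mulr_gt0.
split; first by rewrite (le_trans h1)// lerDl ltW.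
rewrite /dtbump normrM (gtr0_norm d0) (@le_trans _ _ (dl^-1 * B))//.
  by rewrite ler_pM2l.
by rewrite lerDr ltW.
Qed.

Lemma integrable_weight (g h : R -> R) (G : 'rV[R]_d -> R) (B rho : R) :
  measurable_fun setT g -> measurable_fun setT h -> measurable_fun setT G ->
  0 <= B -> 0 <= rho ->
  (forall t, `|g t| <= B) -> (forall t, `|h t| <= B) -> (forall x, `|G x| <= B) ->
  (forall t, tb t = 0 /\ dtb t = 0 -> g t = 0 /\ h t = 0) ->
  (forall x : 'rV[R]_d, (exists i, rho < `|x ord0 i|) -> G x = 0) ->
  M.-integrable setT (EFin \o
    (fun z => `|u z.1 - v z.2| * (G (z.1.1 - z.2.1) * (g z.1.2 * h z.2.2)))).
Proof.
move=> mg mh mG B0 rho0 gB hB GB gh0 G0.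
apply: (@integrable_dominated (B * (B * B)) rho) => //.
- by rewrite !mulr_ge0.
- apply: measurable_funM; first by apply: measurableT_comp => //; exact: measurable_funB.
  apply: measurable_funM; first exact: measurableT_comp mG (@measurable_diff_space R d).
  by apply: measurable_funM; [exact: measurableT_comp mg mt1|exact: measurableT_comp mh mt2].
- move=> z; rewrite normrM normr_id mulrC ler_wpM2r// !normrM.
  by rewrite ler_pM// ?mulr_ge0// ler_pM.
- move=> z /not_near_pairs[/G0 ->|/gh0[-> _]|/gh0[_ ->]]; rewrite ?mul0r ?mulr0//.
Qed.

Lemma integrable_term_t : M.-integrable setT (EFin \o term_t u v).
Proof.
have [B B0 hB] := @C11_bounded_moll R d e e0; have [C C0 hC] := tbB.
apply: (@integrable_weight dtb tb (moll e) (B + C) e) => //.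
- exact: measurable_dtbump.
- exact: measurable_tbump.
- exact: measurable_moll.
- exact: addr_ge0.
- exact: ltW.
- by move=> t; have [_ h] := hC t; rewrite (le_trans h)// lerDr.
- by move=> t; have [h _] := hC t; rewrite (le_trans h)// lerDr.
- by move=> x; have [h _ _] := hB x 0; rewrite (le_trans h)// lerDl.
- by move=> t [-> ->].
- by move=> x [i]; exact: moll_out.
Qed.

Lemma measurable_Lipschitz (h : R -> R) : (forall x y, `|h x - h y| <= L * `|x - y|) ->
  measurable_fun setT h.
Proof.
move=> hL; apply: continuous_measurable_fun => x; apply/cvgrPdist_le => eta eta0.
have L1 : 0 < L + 1 by rewrite ltr_wpDl.
near=> y; rewrite (le_trans (hL x y))//.
have xy : `|x - y| <= eta / (L + 1).
  by near: y; have := @cvg_id _ (nbhs x); move=> /cvgrPdist_le; apply; rewrite divr_gt0.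
rewrite (@le_trans _ _ ((L + 1) * `|x - y|)) ?ler_wpM2r ?lerDl//.
by rewrite mulrC -ler_pdivlMr.
Unshelve. all: by end_near.
Qed.

Lemma integrable_term_flux : M.-integrable setT (EFin \o term_flux u v).
Proof.
have [B B0 hB] := @dmoll_bound R d e e0; have [C C0 hC] := tbB.
apply: (@integrable_dominated (d%:R * (L * (B * (C * C)))) e).
- by rewrite !mulr_ge0.
- exact: ltW.
- apply: measurable_sum => i; apply: measurable_funM.
    apply: measurable_funM; first exact: measurable_sg_diff.
    have mf : measurable_fun setT (fun x => f x ord0 i) by exact: measurable_Lipschitz.
    by apply: measurable_funB; [exact: measurableT_comp mf m1|exact: measurableT_comp mf m2].
  apply: measurable_funM; last exact: measurable_funM.
  exact: measurableT_comp (measurable_dmoll e i) (@measurable_diff_space R d).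
- move=> z; rewrite (le_trans (ler_norm_sum _ _ _))//.
  have -> : d%:R * (L * (B * (C * C))) * `|u z.1 - v z.2| =
      \sum_(i < d) (L * `|u z.1 - v z.2|) * (B * (C * C)).
    by rewrite sumr_const card_ord -mulr_natl; ring.
  have nE (x1 x2 x3 x4 x5 : R) : `|x1 * x2 * (x3 * (x4 * x5))| =
      `|x1| * `|x2| * (`|x3| * (`|x4| * `|x5|)) by rewrite !normrM.
  apply: ler_sum => i _; rewrite nE.
  have [h1 _] := hC z.1.2; have [h2 _] := hC z.2.2.
  apply: ler_pM; rewrite ?mulr_ge0//.
    rewrite -[leRHS]mul1r; apply: ler_pM => //.
    by rewrite normr_sg; case: (_ != 0).
  by rewrite ler_pM// ?mulr_ge0// ler_pM.
- move=> z nz; rewrite /term_flux big1// => i _.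
  have [[j hj]|[-> _]|[-> _]] := not_near_pairs nz; last 2 first.
  + by rewrite mul0r !mulr0.
  + by rewrite !mulr0.
  by rewrite (dmoll_out e0 _ hj) mul0r mulr0.
Qed.

Lemma Phi_bound : exists2 C : R, 0 <= C & forall z, Phi z <= C.
Proof.
have [B B0 hB] := @C11_bounded_moll R d e e0; have [C C0 hC] := tbB.
exists (B * (C * C)); first by rewrite !mulr_ge0.
move=> z; have [h1 _] := hC z.1.2; have [h2 _] := hC z.2.2.
have [h3 _ _] := hB (z.1.1 - z.2.1) 0.
have nE (x3 x4 x5 : R) : `|x3 * (x4 * x5)| = `|x3| * (`|x4| * `|x5|) by rewrite !normrM.
rewrite (le_trans (ler_norm _))// /Phi /testfun nE.
by rewrite ler_pM// ?mulr_ge0// ler_pM.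
Qed.

Lemma measurable_Phi : measurable_fun setT Phi.
Proof. by apply: measurable_funM => //; exact: measurable_funM. Qed.

Lemma Phi_out z : ~ near_pairs e T z -> Phi z = 0.
Proof.
rewrite /Phi /testfun; move=> /not_near_pairs[[j hj]|[-> _]|[-> _]].
- by rewrite (moll_out e0 hj) mul0r.
- by rewrite mul0r mulr0.
- by rewrite !mulr0.
Qed.

Lemma Phi_shift h z : Phi (shift2 h z) = Phi z.
Proof.
rewrite /Phi /testfun /shift2 /shiftZ /=; congr (moll e _ * _).
by rewrite opprD addrACA subrr addr0.
Qed.

Lemma measurable_A : measurable_fun setT A.
Proof. exact: measurable_Lipschitz. Qed.

Lemma integrable_A (w : Z -> R) : mu.-integrable setT (EFin \o w) ->
  mu.-integrable setT (EFin \o (A \o w)).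
Proof.
move=> iw; have mw : measurable_fun setT w by apply/measurable_EFinP; exact: measurable_int iw.
have := integrableZl measurableT L (integrable_abse iw).
apply: le_integrable => //.
  by apply/measurable_EFinP; exact: measurableT_comp measurable_A mw.
move=> p _ /=; rewrite lee_fin normrM normr_id (ger0_norm L0).
by have := AL (w p) 0; rewrite A0 !subr0.
Qed.

Lemma integrable_term_large (r : R) : 0 < r ->
  M.-integrable setT (EFin \o term_large r u v).
Proof.
move=> r0; have [C C0 PhiC] := Phi_bound.
have iJ := integrable_large_jumps lambda0 r0 (integrable_A iu).
have icJ : mu.-integrable setT (EFin \o (fun p => c * large_jumps lambda r (A \o u) p)).
  by have := integrableZl measurableT c iJ; apply: eq_integrable.
apply: (integrable_weighted (ltW e0) (ltW T0) C0 measurable_Phi _ PhiC Phi_out icJ icJ).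
- by move=> z; exact: testfun_ge0.
- apply: measurable_funM; first exact: measurable_sg_diff.
  have mJ : measurable_fun setT (fun p => c * large_jumps lambda r (A \o u) p).
    by apply/measurable_EFinP; exact: measurable_int icJ.
  exact: measurableT_comp mJ measurable_fst.
- move=> z; rewrite normrM (@le_trans _ _ (1 * `|c * large_jumps lambda r (A \o u) z.1|))//.
    by rewrite ler_wpM2r// normr_sg; case: (_ != 0).
  by rewrite mul1r lerDl.
Qed.

(** A majorant of the small-jump terms, up to a constant, for all [r <= 1] at once: small jumps of
    [moll e] vanish outside the cube of half-side e + r, hence outside that of half-side e + 1. *)
Definition weight (z : Z * Z) : R :=
  `|u z.1 - v z.2| * ((\1_[set x : 'rV[R]_d | forall i, `|x ord0 i| <= e + 1] (z.1.1 - z.2.1)) *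
   (tb z.1.2 * tb z.2.2)).

Lemma weight_ge0 z : 0 <= weight z.
Proof.
apply: mulr_ge0 => //; apply: mulr_ge0; first by rewrite indicE.
by apply: mulr_ge0; exact: tbump_ge0.
Qed.

Lemma integrable_weight1 : M.-integrable setT (EFin \o weight).
Proof.
have [C C0 hC] := tbB.
apply: (@integrable_weight tb tb _ (C + 1) (e + 1)) => //.
- exact: measurable_tbump.
- exact: measurable_tbump.
- apply: measurable_indic.
  rewrite (_ : [set _ | _] = \bigcap_(i in [set: 'I_d])
      ((fun z : 'rV[R]_d => z ord0 i) @^-1` `[- (e + 1), e + 1]%classic)).
    apply: fin_bigcap_measurable => // i _.
    rewrite -[X in measurable X]setTI.
    exact: (measurable_coord i measurableT (measurable_itv _)).
  apply/seteqP; split=> z /= Iz i; first by move=> _; rewrite /= in_itv/= -ler_norml.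
  by have := Iz i Logic.I; rewrite /= in_itv/= -ler_norml.
- by lra.
- by have := e0; lra.
- by move=> t; have [h _] := hC t; lra.
- by move=> t; have [h _] := hC t; lra.
- by move=> x; rewrite indicE; case: (_ \in _); rewrite ?normr1 ?normr0; lra.
- by move=> t [-> _].
- move=> x [i hi]; rewrite indicE memNset//= => /(_ i); rewrite leNgt.
  by rewrite hi.
Qed.

Lemma term_small_le (r B : R) : 0 < r <= 1 -> 0 <= B ->
  (forall x : 'rV[R]_d, `|small_jumps lambda r (moll e) x| <= B) ->
  forall z, `|term_small r u v z| <= L * c * B * weight z.
Proof.
move=> /andP[r0 r1] B0 hB z; rewrite /term_small /weight.
have tt0 : 0 <= tb z.1.2 * tb z.2.2 by apply: mulr_ge0; exact: tbump_ge0.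
rewrite 2!normrM normr_id (gtr0_norm c0) normrM (ger0_norm tt0).
have h : `|small_jumps lambda r (moll e) (z.1.1 - z.2.1)| <=
    B * \1_[set x : 'rV[R]_d | forall i, `|x ord0 i| <= e + 1] (z.1.1 - z.2.1).
  have [h|h] := pselect (forall i, `|(z.1.1 - z.2.1) ord0 i| <= e + 1).
    by rewrite indicE mem_set// mulr1.
  have [i hi] : exists i, ~ (`|(z.1.1 - z.2.1) ord0 i| <= e + 1) by exact/existsNP.
  rewrite (@small_jumps_moll_out _ _ _ _ e0 _ _ i) ?normr0 ?mulr_ge0//.
  by rewrite (@le_lt_trans _ _ (e + 1)) ?lerD2l// ltNge; apply/negP.
have := ler_pM (normr_ge0 _) (mulr_ge0 (normr_ge0 _) tt0) (AL (u z.1) (v z.2))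
  (ler_wpM2r tt0 h).
move=> /(ler_wpM2l (ltW c0)) h2; apply: le_trans (le_trans h2 _).
  by rewrite le_eqVlt; apply/orP; left; apply/eqP; ring.
by rewrite le_eqVlt; apply/orP; left; apply/eqP; ring.
Qed.

Lemma integrable_term_small (r : R) : 0 < r <= 1 ->
  M.-integrable setT (EFin \o term_small r u v).
Proof.
move=> r01; have [/andP[r0 r1]] := (r01); have [B B0 hB] := @C11_bounded_moll R d e e0.
have sB := small_jumps_le lambda0 lambda2 (measurable_moll e) hB _ r1.
have s0 : 0 <= @small_mass R d lambda r.
  by apply: Rintegral_ge0 => z _; rewrite mulr_ge0 ?exprn_ge0 ?enorm_ge0 ?levy_kernel_ge0.
have BB : 0 <= B * @small_mass R d lambda r by rewrite mulr_ge0.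
have := integrableZl measurableT (L * c * (B * @small_mass R d lambda r)) integrable_weight1.
apply: le_integrable => //.
- apply/measurable_EFinP; apply: measurable_funM.
    apply: measurableT_comp => //; apply: measurable_funB.
      exact: measurableT_comp measurable_A m1.
    exact: measurableT_comp measurable_A m2.
  apply: measurable_funM => //; apply: measurable_funM; last exact: measurable_funM.
  apply: measurableT_comp (@measurable_diff_space R d).
  by apply: measurable_small_jumps; exact: measurable_moll.
- move=> z _; rewrite /= lee_fin (le_trans (term_small_le r01 BB sB z))//.
  exact: ler_norm.
Qed.

End two_functions.

End kruzkov.

(** * The doubled inequality, freed of flux and jumps *)

Section kruzkov_inequality.
Context {R : realType} {d : nat}.
Variables (T c lambda : R) (f : R -> 'rV[R]_d) (A : R -> R) (L : R).
Hypotheses (T0 : 0 < T) (c0 : 0 < c) (lambda0 : 0 < lambda) (lambda2 : lambda < 2).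
Hypotheses (L0 : 0 <= L).
Hypothesis fL : forall x y i, `|f x ord0 i - f y ord0 i| <= L * `|x - y|.
Hypothesis AL : forall x y, `|A x - A y| <= L * `|x - y|.
Hypothesis A_nd : {homo A : x y / x <= y}.
Hypothesis A0 : A 0 = 0.
Variables (e dl tau : R).
Hypotheses (e0 : 0 < e) (dl0 : 0 < dl) (dltau : dl < tau) (tauT : tau < T - dl).
Local Notation Z := ('rV[R]_d * measurableTypeR R)%type.
Local Notation mu := (spacetime_measure R d).
Local Notation M := (@double_measure R d).
Local Notation tb := (tbump dl tau).
Local Notation dtb := (dtbump dl tau).
Local Notation Tt := (@term_t R d e dl tau).
Local Notation Tf := (term_flux f e dl tau).
Local Notation Ts := (@term_small R d c lambda A e dl tau).
Local Notation Tl := (@term_large R d c lambda A e dl tau).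

Definition all_terms (r : R) (u v : Z -> R) (z : Z * Z) : R :=
  Tt u v z + Tf u v z + Ts r u v z + Tl r u v z.

Lemma integrable_all_terms (r : R) (u v : Z -> R) : 0 < r <= 1 ->
  mu.-integrable setT (EFin \o u) -> mu.-integrable setT (EFin \o v) ->
  M.-integrable setT (EFin \o all_terms r u v).
Proof.
move=> r01 iu iv; have [/andP[r0 _]] := (r01).
have i1 := integrable_term_t T0 e0 dl0 dltau tauT iu iv.
have i2 := integrable_term_flux T0 L0 fL e0 dl0 dltau tauT iu iv.
have i3 := integrable_term_small T0 c0 lambda0 lambda2 L0 AL e0 dl0 dltau tauT iu iv r01.
have i4 : M.-integrable setT (EFin \o Tl r u v).
  exact: (@integrable_term_large R d T c lambda A L).
have := integrableD measurableT (integrableD measurableT (integrableD measurableT i1 i2) i3) i4.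
exact: eq_integrable.
Qed.

Lemma all_terms_ge0 (r : R) (u v : Z -> R) : 0 < r <= 1 ->
  entropy_subsolution T c lambda f A u -> mu.-integrable setT (EFin \o v) ->
  0 <= \int[M]_z all_terms r u v z.
Proof.
move=> r01 su iv; have [/andP[r0 _]] := (r01).
have iall := integrable_all_terms r01 (subsolution_L1 su) iv.
rewrite /Rintegral; apply: fine_ge0.
(* Fubini with [q] outside: for each [q] the inner integral is the entropy inequality with constant
   [k = v q]. *)
rewrite -[leRHS](@integral21_prod_meas1 _ _ _ _ _ mu mu _ iall).
apply: integral_ge0 => q _.
have := subsolution_ineq su (v q) r0 (Cc_infty_testfun e0 dl0 q dltau tauT)
  (testfun_ge0 e dl tau q).
rewrite integral_mkcond /fubini_G; congr (_ <= _)%E.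
apply: eq_integral => p _; rewrite /patch; case: ifPn => hp.
  by rewrite (entropy_integrandE c f A lambda0 lambda2).
(* Outside [QT] the time bump and its derivative vanish, so integrating over [QT] or over the whole
   space-time is the same. *)
have [t0 dt0] : tb p.2 = 0 /\ dtb p.2 = 0.
  apply: (time_out dl0 dltau tauT) => ht; move/negP: hp; apply.
  by rewrite inE /QT /=; split => //; rewrite /= in_itv.
rewrite /= /all_terms /term_t /term_flux /term_small /term_large /Phi /testfun /= t0 dt0.
rewrite !(mul0r, mulr0) add0r !addr0 big1 // => i _.
by rewrite !(mul0r, mulr0).
Qed.

Lemma kruzkov (u v : Z -> R) :
  entropy_subsolution T c lambda f A u -> entropy_subsolution T c lambda f A v ->
  0 <= \int[M]_z (`|u z.1 - v z.2| * (moll e (z.1.1 - z.2.1) *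
    (dtb z.1.2 * tb z.2.2 + tb z.1.2 * dtb z.2.2))).
Proof.
have final (a b j k : R) : 0 <= a + b + j -> b <= k -> j <= 0 -> - a <= k by lra.
move=> su sv; have iu := subsolution_L1 su; have iv := subsolution_L1 sv.
pose sw (z : Z * Z) := (z.2, z.1).
have isw (F : Z * Z -> R) : M.-integrable setT (EFin \o F) ->
    M.-integrable setT (EFin \o (F \o sw)).
  by move=> iF; exact: (preserving_integrable preserving_swap iF).
have intsw (F : Z * Z -> R) : M.-integrable setT (EFin \o F) ->
    \int[M]_z F (sw z) = \int[M]_z F z.
  move=> iF; apply: (congr1 fine).
  by rewrite -[RHS](preserving_integral preserving_swap)//; exact: measurable_int iF.
set E1 := (fun z => _); rewrite -/E1.
have E1E z : E1 z = Tt u v z + Tt v u (sw z).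
  rewrite /E1 /term_t /= (distrC (v z.2)) -(opprB z.1.1) mollN; ring.
have iE1 : M.-integrable setT (EFin \o E1).
  have i1 := integrable_term_t T0 e0 dl0 dltau tauT iu iv.
  have i2 := isw _ (integrable_term_t T0 e0 dl0 dltau tauT iv iu).
  have := integrableD measurableT i1 i2; apply: eq_integrable => // z _ /=.
  by rewrite E1E.
pose sgm (z : Z * Z) := Num.sg (u z.1 - v z.2).
pose W z := weight e dl tau u v z + weight e dl tau v u (sw z).
have iW : M.-integrable setT (EFin \o W).
  have i1 := integrable_weight1 T0 e0 dl0 dltau tauT iu iv.
  have i2 := isw _ (integrable_weight1 T0 e0 dl0 dltau tauT iv iu).
  by have := integrableD measurableT i1 i2; apply: eq_integrable.
have [B B0 hB] := @C11_bounded_moll R d e e0.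
pose K := L * c * B * \int[M]_z W z.
(* [K] does not depend on [r], so all the dependence on [r] sits in [small_mass], which can be made
   as small as desired afterwards. *)
have key (r : R) : 0 < r <= 1 -> - (\int[M]_z E1 z) <= K * @small_mass R d lambda r.
  move=> r01; have [/andP[r0 r1]] := (r01).
  pose S (z : Z * Z) := Ts r u v z + Ts r v u (sw z).
  pose J := jump_term lambda r (A \o u) (A \o v) sgm (Phi e dl tau).
  have sgm1 z : `|sgm z| <= 1 by rewrite normr_sg; case: (_ != 0).
  have sgmD z : sgm z * ((A \o u) z.1 - (A \o v) z.2) = `|(A \o u) z.1 - (A \o v) z.2|.
    rewrite /sgm /=; have [uv|uv|uv] := ltgtP (u z.1) (v z.2).
    - by rewrite ltr0_sg ?subr_lt0// mulN1r ler0_norm// subr_le0 A_nd// ltW.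
    - by rewrite gtr0_sg ?subr_gt0// mul1r ger0_norm// subr_ge0 A_nd// ltW.
    - by rewrite uv !subrr normr0 mulr0.
  have iAu := integrable_A L0 AL A0 iu; have iAv := integrable_A L0 AL A0 iv.
  have msgm := measurable_sg_diff iu iv.
  have [C C0 PhiC] := @Phi_bound R d e dl tau e0 dl0.
  have Phi0 (z : Z * Z) : 0 <= Phi e dl tau z by exact: testfun_ge0.
  have mPhi := @measurable_Phi R d e dl tau.
  have Pout : forall z, ~ near_pairs e T z -> @Phi R d e dl tau z = 0.
    by move=> z; exact: Phi_out.
  have iJ : M.-integrable setT (EFin \o J).
    exact: (integrable_jump_term lambda0 r0 (ltW e0) (ltW T0) C0 iAu iAv msgm sgm1 mPhi Phi0 PhiC Pout).
  have J0 : \int[M]_z J z <= 0.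
    exact: (jump_term_le0 lambda0 r0 (ltW e0) (ltW T0) C0 iAu iAv msgm sgm1 sgmD mPhi Phi0 PhiC Pout (@Phi_shift R d e dl tau)).
  have iS : M.-integrable setT (EFin \o S).
    have i1 := integrable_term_small T0 c0 lambda0 lambda2 L0 AL e0 dl0 dltau tauT iu iv r01.
    have i2 := isw _ (integrable_term_small T0 c0 lambda0 lambda2 L0 AL e0 dl0 dltau tauT iv iu r01).
    by have := integrableD measurableT i1 i2; apply: eq_integrable.
  have sum_ge0 : 0 <= \int[M]_z all_terms r u v z + \int[M]_z all_terms r v u (sw z).
    apply: addr_ge0; first exact: all_terms_ge0.
    by rewrite intsw; [exact: all_terms_ge0|exact: integrable_all_terms].
  have sumE : \int[M]_z all_terms r u v z + \int[M]_z all_terms r v u (sw z) =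
      \int[M]_z E1 z + \int[M]_z S z + c * \int[M]_z J z.
    have icJ : M.-integrable setT (EFin \o (fun z => c * J z)).
      by have := integrableZl measurableT c iJ; apply: eq_integrable.
    have iES : M.-integrable setT (EFin \o (fun z => E1 z + S z)).
      by have := integrableD measurableT iE1 iS; apply: eq_integrable.
    have ia := integrable_all_terms r01 iu iv.
    have ib := isw _ (integrable_all_terms r01 iv iu).
    apply: (etrans (esym (RintegralD measurableT ia ib))).
    have e2 := RintegralD measurableT iES icJ.
    rewrite (RintegralD measurableT iE1 iS) (RintegralZl c measurableT iJ) in e2.
    apply: etrans e2.
    apply: eq_Rintegral => z _; transitivity (E1 z + S z + c * J z); last by [].
    transitivity (all_terms r u v z + all_terms r v u (sw z)); first by [].
    rewrite E1E /S /J /all_terms /jump_term.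
    (* Three odd factors, namely the sign, the difference of the fluxes and [dmoll], give one change
       of sign: the two flux terms cancel. *)
    have -> : Tf v u (sw z) = - Tf u v z.
      rewrite /term_flux -sumrN; apply: eq_bigr => i _ /=.
      rewrite -(opprB (u z.1)) sgrN -(opprB z.1.1) dmollN; ring.
    (* Here only the sign is odd, so the two large-jump terms combine into the difference of the
       jumps of A(u) and A(v), that is into [c * J]. *)
    have -> : Tl r v u (sw z) =
        - (sgm z * (c * large_jumps lambda r (A \o v) z.2) * Phi e dl tau z).
      rewrite /term_large /sgm /Phi /testfun /= -(opprB (u z.1)) sgrN -(opprB z.1.1) mollN; ring.
    rewrite /term_large /sgm; ring.
  have S_le : \int[M]_z S z <= K * @small_mass R d lambda r.
    have sB := small_jumps_le lambda0 lambda2 (measurable_moll e) hB _ r1.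
    have s0 : 0 <= @small_mass R d lambda r.
      by apply: Rintegral_ge0 => z _; rewrite mulr_ge0 ?exprn_ge0 ?enorm_ge0 ?levy_kernel_ge0.
    have BB : 0 <= B * @small_mass R d lambda r by rewrite mulr_ge0.
    have -> : K * @small_mass R d lambda r =
        \int[M]_z (L * c * (B * @small_mass R d lambda r) * W z).
      by rewrite RintegralZl// /K; ring.
    apply: le_Rintegral => //.
      have := integrableZl measurableT (L * c * (B * @small_mass R d lambda r)) iW.
      exact: eq_integrable.
    move=> z _; rewrite /S /W mulrDr lerD//; apply: (le_trans (ler_norm _));
      exact: (@term_small_le R d c lambda A L).
  have cJ : c * \int[M]_z J z <= 0 by rewrite mulr_ge0_le0// ltW.
  have hh := sum_ge0; rewrite sumE in hh.
  have hf := final _ _ _ _ hh S_le cJ; exact: hf.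
rewrite -oppr_le0; apply/ler_addgt0Pr => x x0; rewrite add0r.
have K0 : 0 <= K.
  rewrite /K !mulr_ge0 ?(ltW c0)//; apply: Rintegral_ge0 => z _.
  by rewrite addr_ge0// weight_ge0.
have K1 : 0 < K + 1 by rewrite ltr_wpDl.
(* Dividing by [K + 1] covers the case [K = 0]. *)
have [r r01 hr] := @levy_kernel_core_small R d _ lambda0 lambda2 (x / (K + 1)) (divr_gt0 x0 K1).
have sr : @small_mass R d lambda r <= x / (K + 1).
  have /andP[_ r1] := r01; rewrite /small_mass /Rintegral -lee_fin fineK//.
  apply: (integrable_fin_num _ (integrable_mass lambda0 lambda2 r1)).
  rewrite (_ : [set _ | _] = [set z : 'rV[R]_d | enorm z \in `]0, r[]); first exact: measurable_enorm_itv.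
  by apply/seteqP; split => z; rewrite /= in_itv.
apply: (le_trans (key r r01)); apply: (le_trans (ler_wpM2l K0 sr)).
rewrite mulrA ler_pdivrMr// mulrC ler_pM2l//.
by rewrite lerDl.
Qed.

End kruzkov_inequality.

(** * Monotonicity in time of the doubled distance *)

Section monotonicity.
Context {R : realType} {d : nat}.
Local Notation Z := ('rV[R]_d * measurableTypeR R)%type.
Local Notation mu := (spacetime_measure R d).
Local Notation M := (@double_measure R d).
Variables (T e dl : R) (u v : Z -> R).
Hypotheses (T0 : 0 < T) (e0 : 0 < e) (dl0 : 0 < dl).
Hypotheses (iu : mu.-integrable setT (EFin \o u)) (iv : mu.-integrable setT (EFin \o v)).

Definition doubled (tau : R) (z : Z * Z) : R :=
  `|u z.1 - v z.2| * testfun e dl tau z.2 z.1.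

Lemma is_derive_tbump (t tau : R) :
  is_derive tau 1 (fun s => tbump dl s t) (- dtbump dl tau t).
Proof.
have h : is_derive tau 1 (fun s : R => dl^-1 * (t - s)) (- dl^-1).
  have := is_deriveZ dl^-1 (is_deriveB (is_derive_cst t (tau : R) (1 : R)) (is_derive_id (tau : R) (1 : R))).
  by rewrite sub0r scalerN -[_ *: 1]/(_ * 1) mulr1.
have := @is_derive1_comp _ bump _ tau _ _ (bump_is_derive _) h.
by rewrite /dtbump mulrN mulrC.
Qed.

Lemma is_derive_doubled (z : Z * Z) (tau : R) :
  is_derive tau 1 (doubled ^~ z) (- (`|u z.1 - v z.2| * (moll e (z.1.1 - z.2.1) *
    (dtbump dl tau z.1.2 * tbump dl tau z.2.2 + tbump dl tau z.1.2 * dtbump dl tau z.2.2)))).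
Proof.
have h := is_deriveZ `|u z.1 - v z.2| (is_deriveZ (moll e (z.1.1 - z.2.1))
  (is_deriveM (is_derive_tbump z.1.2 tau) (is_derive_tbump z.2.2 tau))).
apply: (is_derive_eq h); rewrite -![_ *: _]/(_ * _); ring.
Qed.

Lemma integrable_doubled (tau : R) : dl < tau -> tau < T - dl ->
  M.-integrable setT (EFin \o doubled tau).
Proof.
move=> dltau tauT; have [B B0 hB] := @C11_bounded_moll R d e e0.
have [C C0 PhiC] := @Phi_bound R d e dl tau e0 dl0.
apply: (integrable_weighted (ltW e0) (ltW T0) C0 _ _ PhiC _ iu iv) => //.
- exact: measurable_Phi.
- by move=> z; exact: testfun_ge0.
- by move=> z; exact: Phi_out.
- have mu_ : measurable_fun setT u by apply/measurable_EFinP; exact: measurable_int iu.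
  have mv_ : measurable_fun setT v by apply/measurable_EFinP; exact: measurable_int iv.
  apply: measurableT_comp => //; apply: measurable_funB.
    exact: measurableT_comp mu_ measurable_fst.
  exact: measurableT_comp mv_ measurable_snd.
- by move=> z; rewrite normr_id ler_normB.
Qed.

Hypothesis kruzkovP : forall tau, dl < tau -> tau < T - dl ->
  0 <= \int[M]_z (`|u z.1 - v z.2| * (moll e (z.1.1 - z.2.1) *
    (dtbump dl tau z.1.2 * tbump dl tau z.2.2 + tbump dl tau z.1.2 * dtbump dl tau z.2.2))).

(** The derivative of the doubled distance in [tau] is the opposite of the integral in [kruzkovP],
    hence nonpositive on the open interval where the bump fits in (0, T). *)
Lemma doubled_nonincreasing (s t : R) : dl < s -> s <= t -> t < T - dl ->
  \int[M]_z doubled t z <= \int[M]_z doubled s z.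
Proof.
move=> ds st tT.
have [B B0 hB] := @C11_bounded_moll R d e e0; have [D D0 hD] := @bump_bounds R.
pose K := B * (dl^-1 * D * D + D * (dl^-1 * D)).
have dli : 0 < dl^-1 by rewrite invr_gt0.
have K0 : 0 <= K by rewrite mulr_ge0// addr_ge0// !mulr_ge0// ltW.
(* A majorant of the [tau]-derivative that does not depend on [tau]: for every admissible [tau] the
   derivative vanishes off [near_pairs e T]. *)
pose dom (z : Z * Z) := K * (`|u z.1| + `|v z.2|) * \1_(near_pairs e T) z.
have iabs (w : Z -> R) : mu.-integrable setT (EFin \o w) ->
    mu.-integrable setT (EFin \o (fun p => K * `|w p|)).
  move=> iw; have := integrableZl measurableT K (integrable_abse iw).
  by apply: eq_integrable => // p _.
have mabs (w : Z -> R) : mu.-integrable setT (EFin \o w) -> measurable_fun setT (fun p => `|w p|).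
  by move=> iw; apply: measurableT_comp => //; apply/measurable_EFinP; exact: measurable_int iw.
have idom : M.-integrable setT (EFin \o dom).
  apply: (integrable_near_pairs (ltW e0) (ltW T0) (iabs u iu) (iabs v iv)).
  - by move=> p; rewrite mulr_ge0.
  - by move=> p; rewrite mulr_ge0.
  - apply: measurable_funM; last exact: measurable_indic (measurable_near_pairs e T).
    apply: measurable_funM => //; apply: measurable_funD.
      exact: measurableT_comp (mabs u iu) measurable_fst.
    exact: measurableT_comp (mabs v iv) measurable_snd.
  - move=> z zn; rewrite /dom indicE mem_set// mulr1 -mulrDr ger0_norm//.
    by rewrite mulr_ge0// addr_ge0.
  - by move=> z zn; rewrite /dom indicE memNset// mulr0.
have dom0 z : 0 <= dom z.
  by apply: mulr_ge0; [apply: mulr_ge0 => //; exact: addr_ge0|rewrite indicE].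
pose dF tau (z : Z * Z) := `|u z.1 - v z.2| * (moll e (z.1.1 - z.2.1) *
    (dtbump dl tau z.1.2 * tbump dl tau z.2.2 + tbump dl tau z.1.2 * dtbump dl tau z.2.2)).
have dE tau z : partial1of2 doubled tau z = - dF tau z.
  by rewrite partial1of2E; apply: derive_val; exact: is_derive_doubled.
have dF_le tau z : dl < tau -> tau < T - dl -> `|dF tau z| <= dom z.
  move=> t1 t2; have [zn|zn] := pselect (near_pairs e T z); last first.
    rewrite /dom indicE memNset// mulr0 normr_le0 /dF.
    have [[j hj]|[-> ->]|[-> ->]] := not_near_pairs dl0 t1 t2 zn.
    - by rewrite (moll_out e0 hj) mul0r mulr0.
    - by rewrite !mul0r addr0 !mulr0.
    - by rewrite !mulr0 addr0 !mulr0.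
  rewrite /dom indicE mem_set// mulr1 /dF normrM normr_id mulrC.
  apply: ler_pM => //; last exact: ler_normB.
  rewrite normrM; have [h _ _] := hB (z.1.1 - z.2.1) 0.
  apply: ler_pM => //; apply: (le_trans (ler_normD _ _)).
  have [x1 x2 _ _] := hD (dl^-1 * (z.1.2 - tau)) 0.
  have [y1 y2 _ _] := hD (dl^-1 * (z.2.2 - tau)) 0.
  apply: lerD; rewrite normrM; apply: ler_pM => //;
    by rewrite /dtbump normrM (gtr0_norm dli) ler_pM2l.
pose F tau := \int[M]_z doubled tau z.
have in_I tau : `]dl, (T - dl)[%classic tau -> dl < tau /\ tau < T - dl.
  by rewrite /= in_itv/= => /andP[].
have intd tau : `]dl, (T - dl)[%classic tau -> M.-integrable setT (EFin \o doubled tau).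
  by move=> /in_I[? ?]; exact: integrable_doubled.
have derd tau z : `]dl, (T - dl)[%classic tau -> setT z -> derivable (doubled ^~ z) tau 1.
  by move=> _ _; have h := is_derive_doubled z tau; exact: ex_derive.
have ubd tau z : `]dl, (T - dl)[%classic tau -> setT z -> `|partial1of2 doubled tau z| <= dom z.
  by move=> /in_I[? ?] _; rewrite dE normrN; exact: dF_le.
have derF tau : dl < tau -> tau < T - dl -> derivable F tau 1.
  move=> t1 t2; have tI : `]dl, (T - dl)[%classic tau by rewrite /= in_itv/= t1.
  exact: (derivable_under_integral measurableT tI intd derd dom0 idom ubd).
have dF0 tau : dl < tau -> tau < T - dl -> derive1 F tau <= 0.
  move=> t1 t2; have tI : `]dl, (T - dl)[%classic tau by rewrite /= in_itv/= t1.
  rewrite [derive1 F _](differentiation_under_integral measurableT tI intd derd dom0 idom ubd).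
  rewrite -oppr_ge0; apply: (le_trans (kruzkovP t1 t2)).
  rewrite -mulN1r -RintegralZl//.
    rewrite le_eqVlt; apply/orP; left; apply/eqP; apply: eq_Rintegral => z _.
    by rewrite dE mulN1r opprK.
  have idF : M.-integrable setT (EFin \o dF tau).
    apply: (le_integrable measurableT _ _ idom); last first.
      by move=> z _; rewrite /= lee_fin (ger0_norm (dom0 z)); exact: dF_le.
    apply/measurable_EFinP; apply: measurable_funM.
      apply: measurableT_comp => //; apply: measurable_funB.
        by apply: measurableT_comp measurable_fst; apply/measurable_EFinP; exact: measurable_int iu.
      by apply: measurableT_comp measurable_snd; apply/measurable_EFinP; exact: measurable_int iv.
    apply: measurable_funM.
      exact: measurableT_comp (measurable_moll e) (@measurable_diff_space R d).
    have m1 : measurable_fun setT (fun z : Z * Z => z.1.2 : R).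
      exact: (@measurableT_comp _ _ _ _ _ _ (@snd 'rV[R]_d (measurableTypeR R)) setT
        (@fst Z Z) measurable_snd measurable_fst).
    have m2 : measurable_fun setT (fun z : Z * Z => z.2.2 : R).
      exact: (@measurableT_comp _ _ _ _ _ _ (@snd 'rV[R]_d (measurableTypeR R)) setT
        (@snd Z Z) measurable_snd measurable_snd).
    have mb := measurable_tbump dl tau; have mdb := measurable_dtbump dl tau.
    apply: measurable_funD; apply: measurable_funM.
    - exact: measurableT_comp mdb m1.
    - exact: measurableT_comp mb m2.
    - exact: measurableT_comp mb m1.
    - exact: measurableT_comp mdb m2.
  have := integrableZl measurableT (- 1) idF; apply: eq_integrable => // z _.
  by rewrite /= dE -EFinM mulN1r.
have inI tau : tau \in `]dl, (T - dl)[ -> dl < tau /\ tau < T - dl.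
  by rewrite in_itv/= => /andP[].
have dF' x : x \in `]dl, (T - dl)[ -> derivable F x 1 by move=> /inI[]; exact: derF.
have dF0' x : x \in `]dl, (T - dl)[ -> derive1 F x <= 0 by move=> /inI[]; exact: dF0.
have cF : {in `]dl, (T - dl)[%classic, continuous F}.
  move=> x; rewrite inE => /= /dF' h; apply: differentiable_continuous; exact/derivable1_diffP.
have Fni := ler0_derive1_le_oo dF' dF0' cF; apply: (Fni t s _ _ st).
- by rewrite in_itv/= (lt_le_trans ds st).
- by rewrite in_itv/= ds (le_lt_trans st tT).
Qed.

End monotonicity.

(** * Masses of the mollifiers *)

Lemma integral_pos_fin {R : realType} d (X : measurableType d) (m : {measure set X -> \bar R})
    (f : X -> R) (A A' : set X) (B c : R) :
  measurable A -> measurable A' -> measurable_fun setT f ->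
  (forall x, 0 <= f x) -> (forall x, f x <= B) -> (forall x, ~ A x -> f x = 0) ->
  0 < c -> (forall x, A' x -> c <= f x) -> (m A < +oo)%E -> (0 < m A')%E ->
  exists2 W : R, 0 < W & (\int[m]_x (f x)%:E = W%:E)%E.
Proof.
move=> mA mA' mf f0 fB fA c0 fc Aoo A'0.
have I0 : (0 <= \int[m]_x (f x)%:E)%E by apply: integral_ge0 => x _; rewrite lee_fin.
have mfE : measurable_fun setT (fun x => (f x)%:E) by exact/measurable_EFinP.
have upper : (\int[m]_x (f x)%:E < +oo)%E.
  have B0 : 0 <= `|B| by [].
  apply: (@le_lt_trans _ _ (\int[m]_x (`|B|%:E * (\1_A x)%:E))%E); last first.
    rewrite ge0_integralZl_EFin//; last by apply/measurable_EFinP; exact: measurable_indic.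
    by rewrite integral_indic// setIT lte_mul_pinfty.
  apply: ge0_le_integral => //.
  - by move=> x _; rewrite lee_fin.
  - by apply: emeasurable_funM => //; apply/measurable_EFinP; exact: measurable_indic.
  - move=> x _; rewrite -EFinM lee_fin indicE; have [h|h] := pselect (A x).
      by rewrite mem_set// mulr1 (le_trans (fB x))// ler_norm.
    by rewrite memNset// mulr0 fA.
have lower : (0 < \int[m]_x (f x)%:E)%E.
  apply: (@lt_le_trans _ _ (\int[m]_x (c%:E * (\1_A' x)%:E))%E).
    rewrite ge0_integralZl_EFin ?(ltW c0)//; last by apply/measurable_EFinP; exact: measurable_indic.
    by rewrite integral_indic// setIT mule_gt0.
  apply: ge0_le_integral => //.
  - by move=> x _; rewrite -EFinM lee_fin mulr_ge0// ltW.
  - by apply: emeasurable_funM => //; apply/measurable_EFinP; exact: measurable_indic.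
  - move=> x _; rewrite -EFinM lee_fin indicE; have [h|h] := pselect (A' x).
      by rewrite mem_set// mulr1 fc.
    by rewrite memNset// mulr0.
exists (fine (\int[m]_x (f x)%:E)); last by rewrite fineK// ge0_fin_numE.
by rewrite fine_gt0// lower upper.
Qed.

Lemma lebesgue_rV_cube {R : realType} d (rho : R) : 0 < rho ->
  measurable [set x : 'rV[R]_d | forall i, `|x ord0 i| <= rho] /\
  lebesgue_rV d [set x : 'rV[R]_d | forall i, `|x ord0 i| <= rho] = ((2 * rho) ^+ d)%:E.
Proof.
move=> rho0.
pose I (i : 'I_d) := `[(- rho), rho]%classic : set R.
have -> : [set x : 'rV[R]_d | forall i, `|x ord0 i| <= rho] =
    [set x : 'rV[R]_d | forall i, I i (x ord0 i)].
  by apply/seteqP; split => x /= h i; have := h i; rewrite /I/= in_itv/= ler_norml.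
split.
  rewrite (_ : [set _ | _] = \bigcap_(i in [set: 'I_d]) ((fun x : 'rV[R]_d => x ord0 i) @^-1` I i)).
    apply: fin_bigcap_measurable => // i _.
    rewrite -[X in measurable X]setTI.
    exact: (measurable_coord i measurableT (measurable_itv _)).
  by apply/seteqP; split=> x /= Ix i; [move=> _|]; exact: Ix.
rewrite [LHS](@lebesgue_rV_box _ d I (fun i => measurable_itv _)).
rewrite (eq_bigr (fun=> (2 * rho)%:E)); last first.
  move=> i _; rewrite lebesgue_measure_itv/= lte_fin gtrN//.
  by rewrite -EFinB opprK mulr_natl mulr2n.
by rewrite prodEFin prodr_const card_ord.
Qed.

Lemma lebesgue_itvcc_gt0 {R : realType} (r : R) : 0 < r ->
  (0 < @lebesgue_measure R `[(- r)%R, r])%E.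
Proof.
by move=> r0; rewrite lebesgue_measure_itv/= lte_fin gtrN// -EFinB lte_fin opprK addr_gt0.
Qed.

Section masses.
Context {R : realType} {d : nat}.
Local Notation leb := (@lebesgue_rV R d).

(** Finite by compact support, positive by [moll_lower], and independent of [x] by invariance under
    reflection and translation. *)
Lemma moll_mass (e : R) : 0 < e -> exists2 W : R, 0 < W &
  forall x : 'rV[R]_d, (\int[leb]_y (moll e (x - y))%:E = W%:E)%E.
Proof.
move=> e0; have [B B0 hB] := @C11_bounded_moll R d e e0.
have [c c0 hc] := @moll_lower R d e e0.
have e20 : 0 < e / 2 by rewrite divr_gt0.
have [mA A1] := @lebesgue_rV_cube R d _ e0; have [mA' A1'] := @lebesgue_rV_cube R d _ e20.
have mmoll : measurable_fun setT (moll e : 'rV[R]_d -> R) by exact: measurable_moll.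
have m0 : forall x : 'rV[R]_d, 0 <= moll e x by move=> x; exact: moll_ge0.
have mB : forall x : 'rV[R]_d, moll e x <= B.
  by move=> x; have [h _ _] := hB x 0; exact: le_trans (ler_norm _) h.
have mout : forall x : 'rV[R]_d, ~ (forall i, `|x ord0 i| <= e) -> moll e x = 0.
  by move=> x /existsNP[i hi]; apply: (moll_out e0 (i := i)); rewrite ltNge; apply/negP.
have [||W W0 hW] := integral_pos_fin (m := leb) mA mA' mmoll m0 mB mout c0 hc.
- by have h := @ltry R ((2 * e) ^+ d); rewrite -A1 in h.
- have h : (0 < ((2 * (e / 2)) ^+ d)%:E)%E by rewrite lte_fin exprn_gt0// mulr_gt0.
  by rewrite -A1' in h.
exists W; first by [].
move=> x.
have mE : measurable_fun setT (fun y : 'rV[R]_d => (moll e y)%:E) by exact/measurable_EFinP.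
have mE2 : measurable_fun setT (fun y : 'rV[R]_d => (moll e (y + x))%:E).
  exact: measurableT_comp mE (preserving_addrV x).1.
have E0 (y : 'rV[R]_d) : (0 <= (moll e y)%:E)%E by rewrite lee_fin.
have E1 := (preserving_addrV x).2 (fun y => (moll e y)%:E) mE E0.
have E2 := (preserving_oprV (R := R) d).2 (fun y => (moll e (y + x))%:E) mE2 (fun y => E0 (y + x)).
apply: etrans hW; apply: etrans E1; apply: etrans E2.
by apply: eq_integral => y _; rewrite addrC.
Qed.

Lemma tbump_mass (dl : R) : 0 < dl -> exists2 m : R, 0 < m &
  forall tau : R, (\int[@lebesgue_measure R]_(t in [set: measurableTypeR R]) (tbump dl tau t)%:E = m%:E)%E.
Proof.
move=> dl0; have [B B0 hB] := @bump_bounds R; have [c c0 hc] := @bump_lower R.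
have mb0 : measurable_fun setT (tbump dl 0 : measurableTypeR R -> R) by exact: measurable_tbump.
have b0 : forall t : measurableTypeR R, 0 <= tbump dl 0 t by move=> t; exact: tbump_ge0.
have bB : forall t : measurableTypeR R, tbump dl 0 t <= B.
  by move=> t; have [h _ _ _] := hB (dl^-1 * (t - 0)) 0; exact: le_trans (ler_norm _) h.
have bout : forall t : measurableTypeR R, ~ `[- dl, dl]%classic t -> tbump dl 0 t = 0.
  move=> t ht; apply: tbump_out => //; rewrite subr0 ltNge ler_norml; apply/negP => h.
  by apply: ht; rewrite /= in_itv.
have blow : forall t : measurableTypeR R, `[- (dl / 2), dl / 2]%classic t -> c <= tbump dl 0 t.
  move=> t; rewrite /= in_itv/= -ler_norml => ht; apply: hc.
  rewrite subr0 normrM gtr0_norm ?invr_gt0// mulrC ler_pdivrMr//.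
  by rewrite mulrC.
have dl2 : 0 < dl / 2 by rewrite divr_gt0.
have [||m m0 hm] := @integral_pos_fin _ _ (measurableTypeR R) (@lebesgue_measure R) _ _ _ _ _ (measurable_itv `[- dl, dl]) (measurable_itv `[- (dl / 2), dl / 2]) mb0 b0 bB bout c0 blow.
- exact: lebesgue_itv_lty.
- exact: lebesgue_itvcc_gt0.
exists m; first by [].
move=> tau; apply: etrans hm.
have mE : measurable_fun setT (fun t : measurableTypeR R => (tbump dl 0 t)%:E).
  exact/measurable_EFinP.
have E0 (t : measurableTypeR R) : (0 <= (tbump dl 0 t)%:E)%E by rewrite lee_fin.
have E1 := (preserving_addr (- tau)).2 (fun t : R => (tbump dl 0 t)%:E) mE E0.
apply: etrans _ E1.
by apply: eq_integral => t _; rewrite /tbump subr0.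
Qed.

End masses.

(** * Integrating out the mollifiers *)

Section comparison.
Context {R : realType} {d : nat}.
Local Notation Z := ('rV[R]_d * measurableTypeR R)%type.
Local Notation mu := (spacetime_measure R d).
Local Notation leb := (@lebesgue_rV R d).
Local Notation leb1 := (@lebesgue_measure R).
Local Notation M := (@double_measure R d).
Variables (e dl tau W m : R).
Hypotheses (e0 : 0 < e) (dl0 : 0 < dl) (W0 : 0 < W) (m0 : 0 < m).
Hypothesis WE : forall x : 'rV[R]_d, (\int[leb]_y (moll e (x - y))%:E = W%:E)%E.
Hypothesis mE : (\int[leb1]_(t in [set: measurableTypeR R]) (tbump dl tau t)%:E = m%:E)%E.
Local Notation tb := (tbump dl tau).
Local Notation cut := (@Phi R d e dl tau).

Let mtb : measurable_fun setT (tb : measurableTypeR R -> R).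
Proof. exact: measurable_tbump. Qed.

Let mcut : measurable_fun setT cut.
Proof. exact: measurable_Phi. Qed.

Let cut0 z : 0 <= cut z.
Proof. exact: testfun_ge0. Qed.

Let mmoll : measurable_fun setT (moll e : 'rV[R]_d -> R).
Proof. exact: measurable_moll. Qed.

Lemma measurable_section (g : Z -> R) (t : measurableTypeR R) : measurable_fun setT g ->
  measurable_fun setT (fun x => g (x, t)).
Proof. by move=> mg; exact: (measurable_fun_pair1 t mg). Qed.

(** Only the times at which the bump is alive matter, which is how continuity at the single time
    [tau] is exploited. *)
Lemma integral_slices_le (g : Z -> R) (K : R) : measurable_fun setT g ->
  (forall z, 0 <= g z) -> 0 <= K ->
  (forall t, `|t - tau| <= dl -> (\int[leb]_x (g (x, t))%:E <= K%:E)%E) ->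
  (\int[mu]_p (g p * tb p.2)%:E <= (K * m)%:E)%E.
Proof.
move=> mg g0 K0 gK.
have mF : measurable_fun setT (fun p : Z => (g p * tb p.2)%:E).
  by apply/measurable_EFinP; apply: measurable_funM => //; exact: measurableT_comp mtb measurable_snd.
have F0 (p : Z) : (0 <= (g p * tb p.2)%:E)%E by rewrite lee_fin mulr_ge0// tbump_ge0.
rewrite (@tonelli21 _ _ _ _ _ leb leb1 _ mF F0) /= EFinM -mE.
rewrite -ge0_integralZl_EFin//; last 2 first.
- by move=> t _; rewrite lee_fin tbump_ge0.
- exact/measurable_EFinP.
apply: ge0_le_integral => //.
- by move=> t _; apply: integral_ge0 => x _; exact: (F0 (x, t)).
- exact: (@measurable_int2 _ _ _ _ _ leb _ mF F0).
- apply: emeasurable_funM => //; exact/measurable_EFinP.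
- move=> t _; have [h|h] := leP `|t - tau| dl; last first.
    rewrite (tbump_out dl0 h) mule0; under eq_integral do rewrite mulr0.
    by rewrite integral0.
  under eq_integral do rewrite EFinM.
  rewrite ge0_integralZr//.
  + by apply: lee_wpmul2r; rewrite ?lee_fin ?tbump_ge0//; exact: gK.
  + by apply/measurable_EFinP; exact: measurable_section.
  + by move=> x _; rewrite lee_fin.
  + by rewrite lee_fin tbump_ge0.
Qed.

Lemma integral_slice_cst (g : 'rV[R]_d -> R) : measurable_fun setT g ->
  (forall x, 0 <= g x) ->
  (\int[mu]_p (g p.1 * tb p.2)%:E = \int[leb]_x (g x)%:E * m%:E)%E.
Proof.
move=> mg g0.
have mF : measurable_fun setT (fun p : Z => (g p.1 * tb p.2)%:E).
  apply/measurable_EFinP; apply: measurable_funM; last exact: measurableT_comp mtb measurable_snd.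
  exact: measurableT_comp mg measurable_fst.
have F0 (p : Z) : (0 <= (g p.1 * tb p.2)%:E)%E by rewrite lee_fin mulr_ge0// tbump_ge0.
rewrite (@tonelli12 _ _ _ _ _ leb leb1 _ mF F0) /=.
rewrite -ge0_integralZr//; last 3 first.
- exact/measurable_EFinP.
- by move=> x _; rewrite lee_fin.
- by rewrite lee_fin ltW.
apply: eq_integral => x _; rewrite -mE -ge0_integralZl_EFin//.
- by move=> t _; rewrite lee_fin tbump_ge0.
- exact/measurable_EFinP.
Qed.

Lemma integral_moll_tbump (x : 'rV[R]_d) :
  (\int[mu]_q (moll e (x - q.1) * tb q.2)%:E = (W * m)%:E)%E.
Proof.
rewrite (@integral_slice_cst (fun y => moll e (x - y))) ?WE//.
  by apply: measurableT_comp mmoll _; apply: measurable_subrV2.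
by move=> y; exact: moll_ge0.
Qed.

(** When the integrand depends on the first point only, integrating the second one out leaves the
    total mass [W * m]. *)
Lemma integral_cut_fst (g : Z -> R) : measurable_fun setT g -> (forall z, 0 <= g z) ->
  (\int[M]_z (g z.1 * cut z)%:E = (\int[mu]_p (g p * tb p.2)%:E) * (W * m)%:E)%E.
Proof.
move=> mg g0.
have mF : measurable_fun setT (fun z : Z * Z => (g z.1 * cut z)%:E).
  apply/measurable_EFinP; apply: measurable_funM => //.
  exact: measurableT_comp mg measurable_fst.
have F0 (z : Z * Z) : (0 <= (g z.1 * cut z)%:E)%E by rewrite lee_fin mulr_ge0.
rewrite [LHS](@tonelli12 _ _ _ _ _ mu mu _ mF F0) /=.
have mg2 : measurable_fun setT (fun p : Z => (g p * tb p.2)%:E).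
  by apply/measurable_EFinP; apply: measurable_funM => //; exact: measurableT_comp mtb measurable_snd.
have g2 (p : Z) : 0 <= g p * tb p.2 by rewrite mulr_ge0// tbump_ge0.
rewrite -ge0_integralZr//; last 2 first.
- by move=> p _; rewrite lee_fin.
- by rewrite lee_fin ltW// mulr_gt0.
apply: eq_integral => p _.
rewrite -(integral_moll_tbump p.1) -ge0_integralZl_EFin//.
- by apply: eq_integral => q _; rewrite -EFinM /Phi /testfun /=; congr EFin; ring.
- by move=> q _; rewrite lee_fin mulr_ge0 ?moll_ge0// tbump_ge0.
- apply/measurable_EFinP; apply: measurable_funM; last exact: measurableT_comp mtb measurable_snd.
  by apply: measurableT_comp mmoll _; apply: measurable_subrV2.
Qed.

(* Substituting [x + h] for the second space variable [y] separates [h] from [x]. *)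
Lemma integral_translation_le (w : 'rV[R]_d -> R) (eps : R) : measurable_fun setT w ->
  0 <= eps ->
  (forall h : 'rV[R]_d, (forall i, `|h ord0 i| <= e) ->
    (\int[leb]_x `|(w (x + h) - w x)%:E| <= eps%:E)%E) ->
  (\int[M]_z (`|w z.2.1 - w z.1.1| * cut z)%:E <= (eps * m * (W * m))%:E)%E.
Proof.
move=> mw eps0 weps.
pose F (z : Z * Z) := (`|w z.2.1 - w z.1.1| * cut z)%:E.
have m11 : measurable_fun setT (fun z : Z * Z => z.1.1).
  exact: measurableT_comp measurable_fst measurable_fst.
have m21 : measurable_fun setT (fun z : Z * Z => z.2.1).
  exact: measurableT_comp measurable_fst measurable_snd.
have mF : measurable_fun setT F.
  apply/measurable_EFinP; apply: measurable_funM => //; apply: measurableT_comp => //.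
  by apply: measurable_funB; [exact: measurableT_comp mw m21|exact: measurableT_comp mw m11].
have F0 z : (0 <= F z)%E by rewrite lee_fin mulr_ge0.
rewrite [leLHS](@tonelli12 _ _ _ _ _ mu mu F mF F0).
have ms : measurable_fun setT (fun z : Z * Z => (z.1, shiftZ z.1.1 z.2)).
  have m2 : measurable_fun setT (fun z : Z * Z => (z.2, z.1.1)).
    by apply/measurable_fun_pairP; split; [exact: measurable_snd|exact: m11].
  apply/measurable_fun_pairP; split; first exact: measurable_fst.
  exact: (measurableT_comp (@measurable_shiftZ2 R d) m2).
have mF2 : measurable_fun setT (fun z : Z * Z => F (z.1, shiftZ z.1.1 z.2)).
  exact: measurableT_comp mF ms.
have -> : (\int[mu]_p \int[mu]_q F (p, q) = \int[mu]_p \int[mu]_q F (p, shiftZ p.1 q))%E.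
  apply: eq_integral => p _.
  rewrite ((preserving_shiftZ p.1).2 (fun q => F (p, q)))//.
  exact: (measurable_fun_pair2 p mF).
rewrite -(@tonelli12 _ _ _ _ _ mu mu _ mF2 (fun z => F0 _)).
rewrite (@tonelli21 _ _ _ _ _ mu mu _ mF2 (fun z => F0 _)) /=.
rewrite EFinM -(integral_moll_tbump 0) -ge0_integralZl_EFin//; last 3 first.
- by move=> q _; rewrite lee_fin mulr_ge0 ?moll_ge0// tbump_ge0.
- apply/measurable_EFinP; apply: measurable_funM; last exact: measurableT_comp mtb measurable_snd.
  by apply: measurableT_comp mmoll _; apply: measurable_subrV2.
- by rewrite mulr_ge0// ltW.
apply: ge0_le_integral => //.
- by move=> q _; apply: integral_ge0.
- exact: (@measurable_int2 _ _ _ _ _ mu _ mF2 (fun z => F0 _)).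
- apply: emeasurable_funM => //; apply/measurable_EFinP; apply: measurable_funM; last exact: measurableT_comp mtb measurable_snd.
  by apply: measurableT_comp mmoll _; apply: measurable_subrV2.
move=> q _.
have mwh : measurable_fun setT (fun x : 'rV[R]_d => `|w (x + q.1) - w x|).
  apply: measurableT_comp => //; apply: measurable_funB => //.
  exact: measurableT_comp mw (measurable_addrV q.1).
have -> : (\int[mu]_p F (p, shiftZ p.1 q) =
    \int[mu]_p ((moll e (0 - q.1) * tb q.2)%:E * (`|w (p.1 + q.1) - w p.1| * tb p.2)%:E))%E.
  apply: eq_integral => p _; rewrite -EFinM /F /Phi /testfun /shiftZ /=; congr EFin.
  rewrite (addrC q.1) opprD addrA subrr; ring.
have mt0 : 0 <= moll e (0 - q.1) * tb q.2 by rewrite mulr_ge0 ?moll_ge0// tbump_ge0.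
rewrite ge0_integralZl_EFin//; last 2 first.
- by move=> p _; rewrite lee_fin mulr_ge0// tbump_ge0.
- apply/measurable_EFinP; apply: measurable_funM; last exact: measurableT_comp mtb measurable_snd.
  exact: measurableT_comp mwh measurable_fst.
rewrite (integral_slice_cst mwh)// muleC.
have [h|/existsNP[i hi]] := pselect (forall i, `|q.1 ord0 i| <= e); last first.
  rewrite (moll_out e0 (i := i)); last by rewrite sub0r mxE normrN ltNge; apply/negP.
  by rewrite mul0r !mule0.
apply: lee_wpmul2r; first by rewrite lee_fin.
by rewrite EFinM lee_wpmul2r ?lee_fin ?(ltW m0)//; exact: weps.
Qed.

End comparison.

(** * The doubled distance against the L^1 distance at time [tau] *)

Section slice_comparison.
Context {R : realType} {d : nat}.
Local Notation Z := ('rV[R]_d * measurableTypeR R)%type.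
Local Notation mu := (spacetime_measure R d).
Local Notation leb := (@lebesgue_rV R d).
Local Notation leb1 := (@lebesgue_measure R).
Local Notation M := (@double_measure R d).
Variables (e dl tau W m eps : R) (u v : Z -> R).
Hypotheses (e0 : 0 < e) (dl0 : 0 < dl) (W0 : 0 < W) (m0 : 0 < m) (eps0 : 0 <= eps).
Hypothesis WE : forall x : 'rV[R]_d, (\int[leb]_y (moll e (x - y))%:E = W%:E)%E.
Hypothesis mE : (\int[leb1]_(t in [set: measurableTypeR R]) (tbump dl tau t)%:E = m%:E)%E.
Hypotheses (mu_ : measurable_fun setT u) (mv_ : measurable_fun setT v).
Hypothesis ueps : forall t, `|t - tau| <= dl ->
  (\int[leb]_x `|(u (x, t) - u (x, tau))%:E| <= eps%:E)%E.
Hypothesis veps : forall t, `|t - tau| <= dl ->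
  (\int[leb]_x `|(v (x, t) - v (x, tau))%:E| <= eps%:E)%E.
Hypothesis vshift : forall h : 'rV[R]_d, (forall i, `|h ord0 i| <= e) ->
  (\int[leb]_x `|(v ((x + h)%R, tau) - v (x, tau))%:E| <= eps%:E)%E.
Local Notation cut := (@Phi R d e dl tau).
Local Notation C := (m * (W * m)).

Let mcut : measurable_fun setT cut.
Proof. exact: measurable_Phi. Qed.

Let cut0 z : 0 <= cut z.
Proof. exact: testfun_ge0. Qed.

Let m11 : measurable_fun setT (fun z : Z * Z => z.1.1).
Proof. exact: measurableT_comp measurable_fst measurable_fst. Qed.

Let m21 : measurable_fun setT (fun z : Z * Z => z.2.1).
Proof. exact: measurableT_comp measurable_fst measurable_snd. Qed.

Let time_error_measurable (w : Z -> R) : measurable_fun setT w ->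
  measurable_fun setT (fun p : Z => `|w p - w (p.1, tau)|).
Proof.
move=> mw; apply: measurableT_comp => //; apply: measurable_funB => //.
exact: measurableT_comp (measurable_section (tau : measurableTypeR R) mw) measurable_fst.
Qed.

Let time_error (w : Z -> R) : measurable_fun setT w ->
  (forall t, `|t - tau| <= dl ->
    (\int[leb]_x `|(w (x, t) - w (x, tau))%:E| <= eps%:E)%E) ->
  (\int[M]_z (`|w z.1 - w (z.1.1, tau)| * cut z)%:E <= (eps * C)%:E)%E.
Proof.
move=> mw weps; have mg := time_error_measurable mw.
rewrite (integral_cut_fst W0 m0 WE mE mg)//.
rewrite (_ : eps * C = (eps * m) * (W * m)) ?[in leRHS]EFinM; last by rewrite mulrA.
apply: lee_wpmul2r; first by rewrite lee_fin ltW// mulr_gt0.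
exact: (integral_slices_le dl0 mE mg).
Qed.

(** This symmetry lets the estimate of the time error for the first point serve for the second. *)
Let cutC (z : Z * Z) : cut (z.2, z.1) = cut z.
Proof. by rewrite /Phi /testfun /= -opprB mollN mulrC (mulrC (tbump _ _ z.2.2)) mulrC. Qed.

Let time_error_snd :
  (\int[M]_z (`|v z.2 - v (z.2.1, tau)| * cut z)%:E <= (eps * C)%:E)%E.
Proof.
have mg : measurable_fun setT (fun z : Z * Z => (`|v z.1 - v (z.1.1, tau)| * cut z)%:E).
  apply/measurable_EFinP; apply: measurable_funM => //.
  exact: measurableT_comp (time_error_measurable mv_) measurable_fst.
have g0 (z : Z * Z) : (0 <= (`|v z.1 - v (z.1.1, tau)| * cut z)%:E)%E.
  by rewrite lee_fin mulr_ge0.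
have h := time_error mv_ veps; rewrite -(preserving_swap.2 _ mg g0) in h.
apply: le_trans h; rewrite le_eqVlt; apply/orP; left; apply/eqP.
by apply: eq_integral => z _; rewrite /= cutC.
Qed.

(** The cost of replacing u p - v q by u (x, tau) - v (x, tau), where [x] is the space component of
    [p]: [u] is moved in time, [v] in time and then in space. Each of the three terms contributes
    [eps] times the mass [C]. *)
Definition slice_error (z : Z * Z) : R :=
  `|u z.1 - u (z.1.1, tau)| + `|v z.2 - v (z.2.1, tau)| +
  `|v (z.2.1, tau) - v (z.1.1, tau)|.

Let merr : measurable_fun setT slice_error.
Proof.
apply: measurable_funD; first apply: measurable_funD.
- exact: measurableT_comp (time_error_measurable mu_) measurable_fst.
- exact: measurableT_comp (time_error_measurable mv_) measurable_snd.
- have mt := measurable_section (tau : measurableTypeR R) mv_.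
  apply: measurableT_comp => //; apply: measurable_funB.
    exact: measurableT_comp mt m21.
  exact: measurableT_comp mt m11.
Qed.

Let err0 z : 0 <= slice_error z.
Proof. by rewrite !addr_ge0. Qed.

Lemma integral_slice_error :
  (\int[M]_z (slice_error z * cut z)%:E <= (3 * eps * C)%:E)%E.
Proof.
have mt := measurable_section (tau : measurableTypeR R) mv_.
have h1 := time_error mu_ ueps; have h2 := time_error_snd.
have h3 := integral_translation_le e0 m0 WE mE mt eps0 vshift.
have -> : (3 * eps * C)%:E = ((eps * C)%:E + (eps * C)%:E + (eps * m * (W * m))%:E)%E.
  by rewrite -!EFinD; congr EFin; ring.
apply: le_trans (leeD (leeD h1 h2) h3).
have ma : measurable_fun setT (fun z : Z * Z => (`|u z.1 - u (z.1.1, tau)| * cut z)%:E).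
  apply/measurable_EFinP; apply: measurable_funM => //.
  exact: measurableT_comp (time_error_measurable mu_) measurable_fst.
have mb : measurable_fun setT (fun z : Z * Z => (`|v z.2 - v (z.2.1, tau)| * cut z)%:E).
  apply/measurable_EFinP; apply: measurable_funM => //.
  exact: measurableT_comp (time_error_measurable mv_) measurable_snd.
have mc : measurable_fun setT (fun z : Z * Z => (`|v (z.2.1, tau) - v (z.1.1, tau)| * cut z)%:E).
  apply/measurable_EFinP; apply: measurable_funM => //.
  apply: measurableT_comp => //; apply: measurable_funB.
    exact: measurableT_comp mt m21.
  exact: measurableT_comp mt m11.
have p0 (x : R) (z : Z * Z) : (0 <= (`|x| * cut z)%:E)%E by rewrite lee_fin mulr_ge0.
rewrite -ge0_integralD//.
rewrite -ge0_integralD//; last 2 first.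
- by move=> z _; rewrite adde_ge0.
- exact: emeasurable_funD.
rewrite le_eqVlt; apply/orP; left; apply/eqP; apply: eq_integral => z _.
by rewrite -!EFinD -!mulrDl.
Qed.

Let N := (\int[leb]_x (`|u (x, tau) - v (x, tau)|)%:E)%E.

Let mslice : measurable_fun setT (fun p : Z => `|u (p.1, tau) - v (p.1, tau)|).
Proof.
apply: measurableT_comp => //; apply: measurable_funB.
  exact: measurableT_comp (measurable_section (tau : measurableTypeR R) mu_) measurable_fst.
exact: measurableT_comp (measurable_section (tau : measurableTypeR R) mv_) measurable_fst.
Qed.

Let slice_int :
  (\int[M]_z (`|u (z.1.1, tau) - v (z.1.1, tau)| * cut z)%:E = N * C%:E)%E.
Proof.
rewrite (integral_cut_fst W0 m0 WE mE mslice)//.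
rewrite (@integral_slice_cst _ _ dl tau m m0 mE (fun x => `|u (x, tau) - v (x, tau)|))//.
  by rewrite -muleA -EFinM.
apply: measurableT_comp => //; apply: measurable_funB.
  exact: (measurable_section (tau : measurableTypeR R) mu_).
exact: (measurable_section (tau : measurableTypeR R) mv_).
Qed.

Let mD : measurable_fun setT (fun z : Z * Z => (doubled e dl u v tau z)%:E).
Proof.
apply/measurable_EFinP; apply: measurable_funM => //; apply: measurableT_comp => //.
apply: measurable_funB; first exact: measurableT_comp mu_ measurable_fst.
exact: measurableT_comp mv_ measurable_snd.
Qed.

Let mS : measurable_fun setT (fun z : Z * Z => (`|u (z.1.1, tau) - v (z.1.1, tau)| * cut z)%:E).
Proof.
apply/measurable_EFinP; apply: measurable_funM => //.
exact: measurableT_comp mslice measurable_fst.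
Qed.

Let mErr : measurable_fun setT (fun z : Z * Z => (slice_error z * cut z)%:E).
Proof. by apply/measurable_EFinP; exact: measurable_funM. Qed.

Let integral_leD (f g : Z * Z -> R) :
  measurable_fun setT (fun z => (f z * cut z)%:E) ->
  measurable_fun setT (fun z => (g z * cut z)%:E) ->
  (forall z, 0 <= f z) -> (forall z, 0 <= g z) ->
  (forall z, f z <= g z + slice_error z) ->
  (\int[M]_z (f z * cut z)%:E <= \int[M]_z (g z * cut z)%:E + (3 * eps * C)%:E)%E.
Proof.
move=> mf mg f0 g0 fg.
apply: le_trans (leeD2l _ integral_slice_error).
have pos (h : Z * Z -> R) : (forall z, 0 <= h z) -> forall z, (0 <= (h z * cut z)%:E)%E.
  by move=> h0 z; rewrite lee_fin mulr_ge0.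
rewrite -ge0_integralD//; last 2 first.
- by move=> z _; exact: pos.
- by move=> z _; exact: pos.
apply: ge0_le_integral => //.
- by move=> z _; exact: pos.
- exact: emeasurable_funD.
- by move=> z _; rewrite -EFinD lee_fin -mulrDl ler_wpM2r.
Qed.

Lemma doubled_upper :
  (\int[M]_z (doubled e dl u v tau z)%:E <= N * C%:E + (3 * eps * C)%:E)%E.
Proof.
rewrite -slice_int; apply: integral_leD => // z; rewrite /slice_error.
set a := u z.1; set a' := u (z.1.1, tau); set b := v z.2; set b' := v (z.2.1, tau).
set b'' := v (z.1.1, tau).
have -> : a - b = (a' - b'') + ((a - a') - (b - b') - (b' - b'')) by ring.
apply: (le_trans (ler_normD _ _)); rewrite lerD2l.
by apply: (le_trans (ler_normB _ _)); rewrite lerD2r ler_normB.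
Qed.

Lemma doubled_lower :
  (N * C%:E <= \int[M]_z (doubled e dl u v tau z)%:E + (3 * eps * C)%:E)%E.
Proof.
rewrite -slice_int.
apply: (@integral_leD _ (fun z => `|u z.1 - v z.2|)) => // z; rewrite /slice_error.
set a := u z.1; set a' := u (z.1.1, tau); set b := v z.2; set b' := v (z.2.1, tau).
set b'' := v (z.1.1, tau).
have -> : a' - b'' = (a - b) + (- (a - a') + (b - b') + (b' - b'')) by ring.
apply: (le_trans (ler_normD _ _)); rewrite lerD2l.
apply: (le_trans (ler_normD _ _)); rewrite lerD2r.
by apply: (le_trans (ler_normD _ _)); rewrite normrN.
Qed.

End slice_comparison.

(** * The L^1 distance of two solutions is nonincreasing in (0, T) *)

Section contraction.
Context {R : realType} {d : nat}.
Local Notation Z := ('rV[R]_d * measurableTypeR R)%type.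
Local Notation mu := (spacetime_measure R d).
Local Notation leb := (@lebesgue_rV R d).
Variables (T c lambda : R) (f : R -> 'rV[R]_d) (A : R -> R) (L : R).
Hypotheses (T0 : 0 < T) (c0 : 0 < c) (lambda0 : 0 < lambda) (lambda2 : lambda < 2).
Hypotheses (L0 : 0 <= L).
Hypothesis fL : forall x y i, `|f x ord0 i - f y ord0 i| <= L * `|x - y|.
Hypothesis AL : forall x y, `|A x - A y| <= L * `|x - y|.
Hypothesis A_nd : {homo A : x y / x <= y}.
Hypothesis A0 : A 0 = 0.

Definition slice_continuous (w : Z -> R) (t : R) := forall eps : R, 0 < eps ->
  exists2 dl : R, 0 < dl & forall s : R, `|s - t| <= dl ->
    (\int[leb]_x `|(w (x, s) - w (x, t))%:E| <= eps%:E)%E.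

Variables (u v : Z -> R).
Hypotheses (su : entropy_subsolution T c lambda f A u)
  (sv : entropy_subsolution T c lambda f A v).
Hypothesis uc : forall t, 0 < t < T -> slice_continuous u t.
Hypothesis vc : forall t, 0 < t < T -> slice_continuous v t.
Hypothesis vi : forall t : R, 0 < t < T -> leb.-integrable setT (fun x => (v (x, t))%:E).

Let mu_ : measurable_fun setT u.
Proof. by apply/measurable_EFinP; exact: measurable_int (subsolution_L1 su). Qed.

Let mv_ : measurable_fun setT v.
Proof. by apply/measurable_EFinP; exact: measurable_int (subsolution_L1 sv). Qed.

Let common_dl (a eps : R) : 0 < a < T -> 0 < eps -> exists2 dl : R, 0 < dl &
  (forall t, `|t - a| <= dl ->
    (\int[leb]_x `|(u (x, t) - u (x, a))%:E| <= eps%:E)%E) /\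
  (forall t, `|t - a| <= dl ->
    (\int[leb]_x `|(v (x, t) - v (x, a))%:E| <= eps%:E)%E).
Proof.
move=> aT eps0; have [d1 d10 h1] := uc aT eps0; have [d2 d20 h2] := vc aT eps0.
exists (Num.min d1 d2); first by rewrite lt_min d10.
by split => t; rewrite le_min => /andP[t1 t2]; [exact: h1|exact: h2].
Qed.

(** The doubled distance is compared with the L^1 distance at the two times [a] and [b] only, so
    continuity is used there alone and one pair [e], [dl] can be chosen for both. *)
Lemma L1_contraction (a b : R) : 0 < a -> a <= b -> b < T ->
  (\int[leb]_x `|(u (x, b) - v (x, b))%:E| <=
   \int[leb]_x `|(u (x, a) - v (x, a))%:E|)%E.
Proof.
move=> a0 ab bT.
have aI : 0 < a < T by rewrite a0 (le_lt_trans ab).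
have bI : 0 < b < T by rewrite (lt_le_trans a0 ab).
apply/lee_addgt0Pr => x x0.
(* The comparisons at [a] and at [b] each lose [3 * eps], relative to the common mass. *)
pose eps := x / 6; have eps0 : 0 < eps by rewrite divr_gt0.
have [d1 d10 [ua va]] := common_dl aI eps0.
have [d2 d20 [ub vb]] := common_dl bI eps0.
(* Besides the moduli of continuity, the bumps centred at [a] and at [b] have to stay inside (0,
   T). *)
pose dl := Num.min (Num.min d1 d2) (Num.min (a / 2) ((T - b) / 2)).
have [dl0 dld1 dld2 dla dlb] : [/\ 0 < dl, dl <= d1, dl <= d2, dl < a & b < T - dl].
  have Tb : 0 < T - b by rewrite subr_gt0.
  have h1 : dl <= a / 2 by rewrite /dl !ge_min lexx !orbT.
  have h2 : dl <= (T - b) / 2 by rewrite /dl !ge_min lexx !orbT.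
  split; rewrite ?/dl ?lt_min ?ge_min ?lexx ?orbT ?d10 ?d20 ?divr_gt0//; rewrite -/dl; lra.
have [e1 e10 ta] := L1_translation (vi aI) eps0.
have [e2 e20 tb] := L1_translation (vi bI) eps0.
pose e := Num.min e1 e2.
have e0 : 0 < e by rewrite lt_min e10.
have [W W0 WE] := @moll_mass R d e e0; have [m m0 mE] := @tbump_mass R dl dl0.
have kr : forall tau, dl < tau -> tau < T - dl -> _ := fun tau h1 h2 =>
  kruzkov T0 c0 lambda0 lambda2 L0 fL AL A_nd A0 e0 dl0 h1 h2 su sv.
have iu := subsolution_L1 su; have iv := subsolution_L1 sv.
have noninc := doubled_nonincreasing T0 e0 dl0 iu iv kr dla ab dlb.
have inc : (\int[@double_measure R d]_z (doubled e dl u v b z)%:E <=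
    \int[@double_measure R d]_z (doubled e dl u v a z)%:E)%E.
  have ib := integrable_doubled T0 e0 dl0 iu iv (lt_le_trans dla ab) dlb.
  have ia := integrable_doubled T0 e0 dl0 iu iv dla (le_lt_trans ab dlb).
  move: noninc; rewrite /Rintegral -lee_fin !fineK//; exact: integrable_fin_num.
have weaken (w : Z -> R) (s dl' : R) : dl <= dl' ->
    (forall t, `|t - s| <= dl' -> (\int[leb]_x `|(w (x, t) - w (x, s))%:E| <= eps%:E)%E) ->
    forall t, `|t - s| <= dl -> (\int[leb]_x `|(w (x, t) - w (x, s))%:E| <= eps%:E)%E.
  by move=> dd h t ts; apply: h; exact: le_trans dd.
have shift (s e' : R) : e <= e' -> (forall h : 'rV[R]_d, (forall i, `|h ord0 i| <= e') ->
    (\int[leb]_x `|(v ((x + h)%R, s) - v (x, s))%:E| <= eps%:E)%E) ->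
    forall h : 'rV[R]_d, (forall i, `|h ord0 i| <= e) ->
    (\int[leb]_x `|(v ((x + h)%R, s) - v (x, s))%:E| <= eps%:E)%E.
  by move=> ee hh h hi; apply: hh => i; exact: le_trans ee.
have ee1 : e <= e1 by rewrite /e ge_min lexx.
have ee2 : e <= e2 by rewrite /e ge_min lexx orbT.
have up := doubled_upper e0 dl0 W0 m0 (ltW eps0) WE (mE a) mu_ mv_
  (weaken _ _ _ dld1 ua) (weaken _ _ _ dld1 va) (shift _ _ ee1 ta).
have low := doubled_lower e0 dl0 W0 m0 (ltW eps0) WE (mE b) mu_ mv_
  (weaken _ _ _ dld2 ub) (weaken _ _ _ dld2 vb) (shift _ _ ee2 tb).
(* The same positive factor multiplies both distances, since [W] and [m] do not depend on the time;
   it is divided out. *)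
have C0 : 0 < m * (W * m) by rewrite !mulr_gt0.
have := le_trans low (leeD2r _ (le_trans inc up)).
rewrite -addeA -EFinD (_ : 3 * eps * (m * (W * m)) + _ = x * (m * (W * m))); last first.
  by rewrite /eps; field.
rewrite (EFinM x) -ge0_muleDl; last 2 first.
- exact: integral_ge0.
- by rewrite lee_fin ltW.
by rewrite lee_pmul2r.
Qed.

End contraction.

(** * From entropy solutions to integrable functions on space-time *)

Section solutions.
Context {R : realType} {d : nat}.
Local Notation Z := ('rV[R]_d * measurableTypeR R)%type.
Local Notation mu := (spacetime_measure R d).
Local Notation leb := (@lebesgue_rV R d).
Variables (T c lambda : R) (f : R -> 'rV[R]_d) (A : R -> R) (u0 : 'rV[R]_d -> R).
Hypothesis T0 : 0 < T.
Variable u : Z -> R.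
Hypothesis su : entropy_solution T c lambda f A u0 u.

Lemma solution_slice_near (t eps : R) : 0 <= t <= T -> 0 < eps ->
  exists2 dl : R, 0 < dl & forall s : R, 0 <= s <= T -> `|s - t| <= dl ->
    (\int[leb]_x `|(u (x, s) - u (x, t))%:E| <= eps%:E)%E.
Proof.
move=> tT eps0; have tI : t \in `[0, T] by rewrite in_itv.
have /fine_cvgP[h1 /cvgrPdist_le /(_ _ eps0) h2] := entropy_continuous su tI.
have [dl /= dl0 hdl] := filterI h1 h2.
(* Halving allows equality in the condition on [s], while the ball is given by a strict
   inequality. *)
exists (dl / 2); first by rewrite divr_gt0.
move=> s sT st; have [] := hdl s _ _.
- by rewrite /ball_ /= distrC (le_lt_trans st)// ltr_pdivrMr// ltr_pMr// ltr1n.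
- by rewrite in_itv.
move=> sf; rewrite sub0r normrN ger0_norm ?fine_ge0 ?Lnorm_ge0// => hs.
by move: hs; rewrite -lee_fin fineK// Lnorm1.
Qed.

Lemma solution_slice_integrable (t : R) : 0 <= t <= T ->
  leb.-integrable setT (fun x => (u (x, t))%:E).
Proof.
move=> tT; have tI : t \in `[0, T] by rewrite in_itv.
exact: (iffLR (Lfun1_integrable _ _) (entropy_L1 su tI)).
Qed.

Lemma measurable_slice (t : R) : 0 <= t <= T -> measurable_fun setT (fun x => u (x, t)).
Proof.
by move=> tT; apply/measurable_EFinP; exact: measurable_int (solution_slice_integrable tT).
Qed.

(** The L^1 norm of the slices is continuous on the compact interval [0, T] by the triangle
    inequality, so it attains a maximum. *)
Lemma solution_norm_bounded : exists K : R, forall t : R, 0 <= t <= T ->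
  (\int[leb]_x `|(u (x, t))%:E| <= K%:E)%E.
Proof.
pose n (t : R) := fine (\int[leb]_x `|(u (x, t))%:E|)%E.
have fin t : 0 <= t <= T -> (\int[leb]_x `|(u (x, t))%:E|)%E \is a fin_num.
  move=> tT; rewrite ge0_fin_numE; last exact: integral_ge0.
  by have /integrableP[] := solution_slice_integrable tT.
have ler_n (s t eps : R) : 0 <= s <= T -> 0 <= t <= T ->
    (\int[leb]_x `|(u (x, s) - u (x, t))%:E| <= eps%:E)%E -> n s <= n t + eps.
  move=> sT tT h; rewrite -lee_fin EFinD /n !fineK//; try exact: fin.
  apply: le_trans (leeD2l _ h).
  have ms := measurable_slice sT; have mt := measurable_slice tT.
  have := L1_dist_tri leb ms mt (@measurable_cst _ _ _ _ setT (0 : R)).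
  by under eq_integral do rewrite subr0; under [X in (_ <= _ + X)%E -> _]eq_integral do rewrite subr0;
    rewrite addeC.
have cn : {within `[0, T], continuous n}.
  apply/subspace_continuousP => t; rewrite /= in_itv /= => tT.
  apply/cvgrPdist_le => eps eps0.
  have [dl dl0 hdl] := solution_slice_near tT eps0.
  exists dl => //= s /= st; rewrite in_itv /= => sT.
  have h := hdl s sT; rewrite distrC (ltW st) in h; have {}h := h isT.
  rewrite ler_distlC lerBlDr (ler_n _ _ _ sT tT h) andbT.
  apply: ler_n => //; apply: le_trans h.
  rewrite le_eqVlt; apply/orP; left; apply/eqP; apply: eq_integral => x _.
  by rewrite !abse_EFin distrC.
have [t _ ht] := EVT_max (ltW T0) cn.
exists (n t) => s sT; rewrite -(fineK (fin s sT)) lee_fin; apply: ht.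
by rewrite in_itv.
Qed.

(** Joint measurability is taken from membership in L^oo; measurability of each slice would not give
    it. *)
Lemma measurable_extension : measurable_fun setT (u \_ (@QT R d T)).
Proof. by have := entropy_Linfty su; rewrite inE => /andP[]; rewrite inE. Qed.

Lemma extensionE (x : 'rV[R]_d) (t : R) : 0 < t < T -> (u \_ (@QT R d T)) (x, t) = u (x, t).
Proof. by move=> tT; rewrite patchE mem_set// /QT; split => //; rewrite /= in_itv. Qed.

Lemma extension_out (x : 'rV[R]_d) (t : R) : ~ (0 < t < T) -> (u \_ (@QT R d T)) (x, t) = 0.
Proof. by move=> tT; rewrite patchE memNset// /QT => -[_]; rewrite /= in_itv. Qed.

(** Tonelli with time outside: the slices have norm at most [K], and the times lie in the bounded
    interval (0, T). *)
Lemma solution_extension_integrable : mu.-integrable setT (EFin \o (u \_ (@QT R d T))).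
Proof.
have [K hK] := solution_norm_bounded.
have mw := measurable_extension.
have mF : measurable_fun setT (fun z : Z => `|((u \_ (@QT R d T)) z)%:E|)%E.
  by apply: measurableT_comp => //; exact/measurable_EFinP.
apply/integrableP; split; first exact/measurable_EFinP.
have F0 (z : Z) : (0 <= `|((u \_ (@QT R d T)) z)%:E|)%E by [].
rewrite [ltLHS](@tonelli21 _ _ _ _ _ leb (@lebesgue_measure R) _ mF F0) /=.
have mI : measurable (`]0%R, T[%classic : set (measurableTypeR R)) by exact: measurable_itv.
have K0 : 0 <= K.
  have := hK 0; rewrite lexx ltW// => /(_ isT); rewrite -lee_fin; apply: le_trans.
  exact: integral_ge0.
apply: (@le_lt_trans _ _ (\int[@lebesgue_measure R]_(t in [set: measurableTypeR R])
    (K%:E * (\1_(`]0%R, T[%classic : set (measurableTypeR R)) t)%:E))%E); last first.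
  rewrite ge0_integralZl_EFin//; last by apply/measurable_EFinP; exact: measurable_indic.
  rewrite integral_indic// setIT lte_mul_pinfty//.
  by rewrite (le_lt_trans (lebesgue_itvoo_le (ltW T0)))// ltry.
apply: ge0_le_integral => //.
- by move=> t _; apply: integral_ge0.
- exact: (@measurable_int2 _ _ _ _ _ leb _ mF F0).
- by apply: emeasurable_funM => //; apply/measurable_EFinP; exact: measurable_indic.
move=> t _; rewrite indicE; have [tI|tI] := pselect (0 < t < T).
  rewrite mem_set/= ?in_itv// mule1.
  under eq_integral do rewrite extensionE//.
  by apply: hK; have /andP[t0 tT] := tI; rewrite !ltW.
rewrite memNset/= ?in_itv// mule0.
by under eq_integral do rewrite extension_out// normr0; rewrite integral0.
Qed.

(** At a time of (0, T) the entropy integrand, nonlocal part included, depends on the slice at that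
    time only, and the extension by zero does not change that slice. *)
Lemma solution_subsolution : entropy_subsolution T c lambda f A (u \_ (@QT R d T)).
Proof.
split; first exact: solution_extension_integrable.
move=> k r phi r0 Cphi phi0; have := entropy_inequality su k r0 Cphi phi0.
congr (_ <= _)%E; apply: eq_integral => -[x t] xt.
have tT : 0 < t < T by move: xt; rewrite inE => -[_]; rewrite /= in_itv.
have ut y : (u \_ (@QT R d T)) (y, t) = u (y, t) by exact: extensionE.
have st : slice (u \_ (@QT R d T)) t = slice u t by apply/funext => y; exact: ut.
have sA : slice (A \o (u \_ (@QT R d T))) t = slice (A \o u) t.
  by apply/funext => y; rewrite /slice /= ut.
by rewrite /entropy_integrand /= ut sA.
Qed.

End solutions.

(** * Uniqueness *)

Section entropy_solution_unique.
Context {R : realType} {d : nat}.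
Local Notation Z := ('rV[R]_d * measurableTypeR R)%type.
Local Notation mu := (spacetime_measure R d).
Local Notation leb := (@lebesgue_rV R d).
Variables (T c lambda : R) (f : R -> 'rV[R]_d) (A : R -> R) (u0 : 'rV[R]_d -> R) (L : R).
Hypotheses (T0 : 0 < T) (c0 : 0 < c) (lambda0 : 0 < lambda) (lambda2 : lambda < 2).
Hypotheses (L0 : 0 <= L).
Hypothesis fL : forall x y i, `|f x ord0 i - f y ord0 i| <= L * `|x - y|.
Hypothesis AL : forall x y, `|A x - A y| <= L * `|x - y|.
Hypothesis A_nd : {homo A : x y / x <= y}.
Hypothesis A0 : A 0 = 0.
Variables u v : Z -> R.
Hypotheses (su : entropy_solution T c lambda f A u0 u)
  (sv : entropy_solution T c lambda f A u0 v).

Lemma extension_slice_continuous (w : Z -> R) (t : R) :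
  entropy_solution T c lambda f A u0 w -> 0 < t < T ->
  slice_continuous (w \_ (@QT R d T)) t.
Proof.
move=> sw tT eps eps0; have [t0 tT'] := andP tT.
have [|dl dl0 hdl] := solution_slice_near sw (t := t) _ eps0; first by rewrite !ltW.
(* The bounds by t/2 and (T - t)/2 keep [s] in (0, T), where the extension agrees with the
   solution. *)
have [dl1 [dl10 dl1dl dl1t dl1T]] : exists dl1 : R, [/\ 0 < dl1, dl1 <= dl, dl1 <= t / 2 & dl1 <= (T - t) / 2].
  exists (Num.min dl (Num.min (t / 2) ((T - t) / 2))).
  by split; rewrite ?lt_min ?ge_min ?lexx ?orbT// dl0 !divr_gt0// subr_gt0.
exists dl1 => // s st; have st' := st; move: st'; rewrite ler_distl => /andP[h1 h2].
have sT : 0 < s < T by lra.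
under eq_integral do rewrite !extensionE//.
by apply: hdl; [have /andP[? ?] := sT; rewrite !ltW|exact: le_trans st _].
Qed.

(** The contraction holds between positive times only. The distance at a small time [a] is at most
    that from u(a) to u(0) plus that from v(0) to v(a), because the initial slices agree almost
    everywhere. *)
Lemma slices_eq (b : R) : 0 < b < T ->
  (\int[leb]_x `|(u (x, b) - v (x, b))%:E|)%E = 0%E.
Proof.
move=> bT; have [b0 bT'] := andP bT.
have zT : (0 : R) <= 0 <= T by rewrite lexx ltW.
apply/eqP; rewrite eq_le integral_ge0 ?andbT//; apply/lee_addgt0Pr => eps eps0.
rewrite add0e.
have e20 : 0 < eps / 2 by rewrite divr_gt0.
have [d1 d10 h1] := solution_slice_near su zT e20.
have [d2 d20 h2] := solution_slice_near sv zT e20.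
have [a [a0 a1 a2 ab]] : exists a, [/\ 0 < a, a <= d1, a <= d2 & a <= b].
  exists (Num.min d1 (Num.min d2 b)).
  by split; rewrite ?lt_min ?ge_min ?lexx ?orbT// d10 d20.
have aT : 0 < a < T by rewrite a0 (le_lt_trans ab).
have aT' : 0 <= a <= T by have /andP[? ?] := aT; rewrite !ltW.
have iv (t : R) : 0 < t < T ->
    leb.-integrable setT (fun x => ((v \_ (@QT R d T)) (x, t))%:E).
  move=> tT; under eq_fun do rewrite extensionE//.
  by apply: (solution_slice_integrable sv); have /andP[? ?] := tT; rewrite !ltW.
have := L1_contraction T0 c0 lambda0 lambda2 L0 fL AL A_nd A0
  (solution_subsolution T0 su) (solution_subsolution T0 sv)
  (fun t => @extension_slice_continuous u t su) (fun t => @extension_slice_continuous v t sv) iv a0 ab bT'.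
under eq_integral do rewrite !extensionE//.
under [X in (_ <= X)%E -> _]eq_integral do rewrite !extensionE//.
move=> /le_trans; apply.
have ma := measurable_slice su aT'; have mb := measurable_slice sv aT'.
have m0 := measurable_slice su zT; have m0' := measurable_slice sv zT.
apply: (le_trans (L1_dist_tri leb ma m0 mb)).
apply: (@le_trans _ _ ((eps / 2)%:E + (eps / 2)%:E)%E); last first.
  by rewrite -EFinD -splitr.
apply: leeD; first by apply: h1 => //; rewrite subr0 gtr0_norm.
(* The common initial datum allows [u] at time 0 to be replaced by [v] under the integral. *)
have <- : (\int[leb]_x `|(v (x, 0) - v (x, a))%:E| =
    \int[leb]_x `|(u (x, 0) - v (x, a))%:E|)%E.
  apply: ae_eq_integral => //.
  - by do 2 apply: measurableT_comp => //; exact: measurable_funB.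
  - by do 2 apply: measurableT_comp => //; exact: measurable_funB.
  - apply: filterS2 (entropy_initial su) (entropy_initial sv) => x -> -> _.
    by [].
have := h2 a aT'; rewrite subr0 gtr0_norm// => /(_ a2); apply: le_trans.
rewrite le_eqVlt; apply/orP; left; apply/eqP; apply: eq_integral => x _.
by rewrite !abse_EFin distrC.
Qed.

Lemma entropy_solution_unique : {ae mu, forall z, QT T z -> u z = v z}.
Proof.
pose w (z : Z) := (u \_ (@QT R d T)) z - (v \_ (@QT R d T)) z.
have mw : measurable_fun setT w.
  by apply: measurable_funB; [exact: measurable_extension su|exact: measurable_extension sv].
have mF : measurable_fun setT (fun z : Z => `|(w z)%:E|)%E.
  by apply: measurableT_comp => //; exact/measurable_EFinP.
have F0 (z : Z) : (0 <= `|(w z)%:E|)%E by [].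
have int0 : (\int[mu]_z `|(w z)%:E| = 0)%E.
  rewrite [LHS](@tonelli21 _ _ _ _ _ leb (@lebesgue_measure R) _ mF F0) /=.
  apply: integral0_eq => t _; have [tT|tT] := pselect (0 < t < T).
    by under eq_integral do rewrite /w !extensionE//; exact: slices_eq.
  by under eq_integral do rewrite /w !extension_out// subr0 normr0; rewrite integral0.
have mwE : measurable_fun setT (EFin \o w) by exact/measurable_EFinP.
have [+ _] := ae_eq_integral_abs mu measurableT mwE => /(_ int0).
apply: filterS => z /(_ I) wz zQ; have {wz} : w z = 0 by case: wz.
by rewrite /w !patchE mem_set// => /eqP; rewrite subr_eq0 => /eqP.
Qed.

End entropy_solution_unique.

Theorem corollary3p2 (R : realType) (d : nat) (T c lambda : R)
    (f : R -> 'rV[R]_d) (A : R -> R) (u0 : 'rV[R]_d -> R)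
    (hd : (1 <= d)%N) (hT : 0 < T) (hc : 0 < c)
    (hlambda : 0 < lambda < 2)
    (hf : lipschitz f) (hA : lipschitz A)
    (A_nondecreasing : {homo A : x y / x <= y}) (A0 : A 0 = 0)
    (u v : 'rV[R]_d * R -> R) :
  entropy_solution T c lambda f A u0 u ->
  entropy_solution T c lambda f A u0 v ->
  {ae spacetime_measure R d, forall z, QT T z -> u z = v z}.
Proof.
have [l0 l2] := andP hlambda.
have [L [L0 fL AL]] : exists L : R, [/\ 0 <= L,
    forall x y i, `|f x ord0 i - f y ord0 i| <= L * `|x - y| &
    forall x y, `|A x - A y| <= L * `|x - y|].
  have hf' : \forall L \near +oo, L.-lipschitz f by exact: hf.
  have hA' : \forall L \near +oo, L.-lipschitz A by exact: hA.
  (* [lipschitz] provides all sufficiently large constants, so a single nonnegative one serves both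
     [f] and [A]. *)
  have [L [[fL AL] L0]] := filter_ex
    (filterI (filterI hf' hA') (nbhs_pinfty_ge (num_real (0 : R)))).
  exists L; split=> // x y; last exact: (AL (x, y) (conj I I)).
  move=> i; apply: le_trans (fL (x, y) (conj I I)).
  (* The norm on row vectors is the sup norm, hence it bounds each coordinate. *)
  have := le_bigmax 0 (fun k : 'I_1 * 'I_d => `|(f x - f y) k.1 k.2|) (ord0, i).
  by rewrite -(mx_normrE (f x - f y)) /= !mxE.
exact: (entropy_solution_unique hT hc l0 l2 L0 fL AL).
Qed.
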